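(* (1) The algebra $\mathcal{B}(\ell^{2}(\omega_{1}))/\mathcal{S}(\ell^{2}(\omega_{1}))$ is convex-transitive. (2) Let $\kappa$ be any infinite cardinal and let $\tau$ be the topology of uniform convergence on separable subspaces. Then the algebra $\mathcal{C}(\ell^{2}(\kappa))=\mathcal{B}(\ell^{2}(\kappa))/\mathcal{K}(\ell^{2}(\kappa))$ is $\tau$-convex-transitive.
   Context: Hilbert spaces are over the complex field. $\mathcal{B}(X)$ is the algebra of bounded linear operators on $X$ with the operator norm, $\mathcal{K}(X)$ is the ideal of compact operators, and $\mathcal{S}(X)\subset\mathcal{B}(X)$ is the two-sided ideal of operators with separable range. Quotients carry the quotient norm. The topology $\tau$ of uniform convergence on separable subspaces on $\mathcal{B}(X)$ is generated by the basis of sets $\{T\in\mathcal{B}(X):\ \|T_{i}|_{Y}-T|_{Y}\|_{\mathcal{B}(Y,X)}<\epsilon,\ i=1,\dots,n\}$, where $T_1,\dots,T_n\in\mathcal{B}(X)$, $Y\subset X$ is a separable subspace and $\epsilon>0$. If $E$ is a Banach space with a locally convex topology $\tau$ and $F\subset E$ is a subspace, then $E/F$ is considered in the topology (still denoted $\tau$) consisting of the sets $U+F$, $U\in\tau$. For a Banach space $X$, $\mathcal{G}_X$ is the group of isometric (linear, surjective) automorphisms of $X$. $X$ is convex-transitive if for every $x$ in its unit sphere the norm-closed convex hull of $\{T(x): T\in\mathcal{G}_X\}$ equals the closed unit ball $\mathbf{B}_X$; it is $\tau$-convex-transitive if for every $x$ in its unit sphere the $\tau$-closed convex hull of $\{T(x):T\in\mathcal{G}_X\}$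 equals $\mathbf{B}_X$. *)

(* Defs.v *)
From HB Require Import structures.
From mathcomp Require Import all_boot all_order all_algebra.
From mathcomp Require Import generic_quotient ring_quotient.
From mathcomp Require Import finmap.
From mathcomp Require Import all_classical all_reals all_analysis.
From mathcomp Require Import complex ring lra.
Set Implicit Arguments.
Unset Strict Implicit.
Unset Printing Implicit Defensive.
Import Order.TTheory GRing.Theory Num.Theory.
Import numFieldNormedType.Exports.
Local Open Scope classical_set_scope.
Local Open Scope complex_scope.
Local Open Scope ring_scope.

(* Norms of a normed space over R[i] take their values in R[i]; rnorm is the
   same norm with values in R. *)
Definition rnorm (R : realType) (V : normedZmodType R[i]) (x : V) : R :=
  complex.Re `|x|.

Section rnorm_theory.
Context (R : realType) (V : normedZmodType R[i]).
Implicit Types x y : V.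

Lemma rnormE x : `|x| = (rnorm x)%:C.
Proof. by rewrite /rnorm RRe_real// normr_real. Qed.

Lemma rnorm_ge0 x : 0 <= rnorm x.
Proof. by rewrite -ler0c -rnormE. Qed.

Lemma rnormD x y : rnorm (x + y) <= rnorm x + rnorm y.
Proof. by rewrite -lecR rmorphD/= -!rnormE ler_normD. Qed.

Lemma rnormN x : rnorm (- x) = rnorm x.
Proof. by rewrite /rnorm normrN. Qed.

Lemma rnormB x y : rnorm (x - y) = rnorm (y - x).
Proof. by rewrite /rnorm distrC. Qed.

Lemma rnorm0 : rnorm (0 : V) = 0.
Proof. by rewrite /rnorm normr0. Qed.

Lemma rnorm0_eq0 x : rnorm x = 0 -> x = 0.
Proof. by move=> x0; apply/eqP; rewrite -normr_eq0 rnormE x0. Qed.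

Lemma rnorm_tri x y z : rnorm (x - z) <= rnorm (x - y) + rnorm (y - z).
Proof. by rewrite -[x - z](subrKA y) rnormD. Qed.

End rnorm_theory.

Lemma rnormM (R : realType) (z w : R[i]) : rnorm (z * w) = rnorm z * rnorm w.
Proof. by apply: complexI; rewrite rmorphM/= -!rnormE normrM. Qed.

Lemma rnormZ (R : realType) (V : normedModType R[i]) (a : R[i]) (x : V) :
  rnorm (a *: x) = rnorm a * rnorm x.
Proof. by apply: complexI; rewrite rmorphM/= -!rnormE normrZ. Qed.

Section ell2.
Context (R : realType) (I : choiceType).

Definition sqsum (f : I -> R[i]) : \bar R :=
  \esum_(i in [set: I]) ((rnorm (f i)) ^+ 2)%:E.

Definition ell2_pred : {pred I -> R[i]} := [pred f | (sqsum f < +oo)%E].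

Lemma sqsumP f (M : R) :
  (sqsum f <= M%:E)%E <->
  forall A : {fset I}, \sum_(i <- A) rnorm (f i) ^+ 2 <= M.
Proof.
split=> [fM A|fM].
  rewrite -lee_fin; apply: le_trans fM; apply: esum_ge.
  exists [set` A]; first by split; [exact: finite_fset|exact: subsetT].
  rewrite fsbig_finite//= set_fsetK sumEFin lexx//.
apply: ge_ereal_sup => _ [A [finA _] <-].
by rewrite fsbig_finite//= sumEFin lee_fin.
Qed.

Lemma sqsum_ge0 f : (0 <= sqsum f)%E.
Proof. by apply: esum_ge0 => i _; rewrite lee_fin sqr_ge0. Qed.

Lemma sumD_le (A : {fset I}) (f g : I -> R[i]) (s t : R) : 0 <= s -> 0 <= t ->
  \sum_(i <- A) rnorm (f i) ^+ 2 <= s ^+ 2 ->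
  \sum_(i <- A) rnorm (g i) ^+ 2 <= t ^+ 2 ->
  \sum_(i <- A) rnorm ((f + g) i) ^+ 2 <= (s + t) ^+ 2.
Proof.
move=> s0 t0 fs gt.
set a := fun i => rnorm (f i); set b := fun i => rnorm (g i).
have step : \sum_(i <- A) rnorm ((f + g) i) ^+ 2 <= \sum_(i <- A) (a i + b i) ^+ 2.
  by apply: ler_sum => i _; rewrite ler_pXn2r ?nnegrE ?addr_ge0 ?rnorm_ge0 ?rnormD.
apply: (le_trans step).
have E : \sum_(i <- A) (a i + b i) ^+ 2 =
   \sum_(i <- A) a i ^+ 2 + \sum_(i <- A) b i ^+ 2 + 2 * \sum_(i <- A) a i * b i.
  rewrite mulr_sumr -!big_split/=; apply: eq_bigr => i _.
  by rewrite sqrrD -mulr_natl addrAC.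
have zero (u v : I -> R) : \sum_(i <- A) u i ^+ 2 <= 0 -> \sum_(i <- A) u i * v i = 0.
  move=> u0; have {u0} : \sum_(i <- A) u i ^+ 2 = 0.
    by apply/eqP; rewrite eq_le u0 sumr_ge0// => i _; rewrite sqr_ge0.
  move=> /eqP; rewrite psumr_eq0; last by move=> i _; rewrite sqr_ge0.
  move=> /allP u0; rewrite big_seq big1// => i /u0 /=.
  by rewrite sqrf_eq0 => /eqP ->; rewrite mul0r.
have ab : \sum_(i <- A) a i * b i <= s * t.
  have [s00|s00] := eqVneq s 0.
    by rewrite zero ?s00 ?mul0r//; rewrite s00 expr0n/= in fs.
  have [t00|t00] := eqVneq t 0.
    rewrite t00 expr0n/= in gt.
    under eq_bigr do rewrite mulrC.
    by rewrite zero// t00 mulr0.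
  have st : 0 < s * t by rewrite mulr_gt0// lt_neqAle eq_sym ?s00 ?t00.
  rewrite -(ler_pM2l st) -(ler_pM2l (ltr0n R 2)) mulrA mulr_sumr.
  apply: (@le_trans _ _ (t ^+ 2 * \sum_(i <- A) a i ^+ 2 +
                         s ^+ 2 * \sum_(i <- A) b i ^+ 2)).
    rewrite !mulr_sumr -big_split/=; apply: ler_sum => i _.
    rewrite -subr_ge0 (_ : _ - _ = (t * a i - s * b i) ^+ 2) ?sqr_ge0//.
    ring.
  apply: (@le_trans _ _ (t ^+ 2 * s ^+ 2 + s ^+ 2 * t ^+ 2)).
    by rewrite lerD// ler_wpM2l ?sqr_ge0.
  by rewrite le_eqVlt; apply/orP; left; apply/eqP; ring.
rewrite E [leRHS](_ : _ = s ^+ 2 + t ^+ 2 + 2 * (s * t)); last by ring.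
by rewrite lerD ?lerD// ler_pM2l.
Qed.

Lemma ell2_predP f : reflect
  (exists2 M : R, 0 <= M &
     forall A : {fset I}, \sum_(i <- A) rnorm (f i) ^+ 2 <= M ^+ 2)
  (f \in ell2_pred).
Proof.
apply: (iffP idP) => [|[M M0 /sqsumP fM]]; rewrite inE/=.
  move=> foo; have := sqsum_ge0 f.
  case E : (sqsum f) foo => [r| |]// _; rewrite lee_fin => r0.
  exists (Num.sqrt r); rewrite ?sqrtr_ge0// => A.
  by rewrite sqr_sqrtr//; apply: (sqsumP f r).1; rewrite E.
by rewrite (le_lt_trans fM)// ltry.
Qed.

Lemma ell2_pred_submod : GRing.submod_closed ell2_pred.
Proof.
split=> [|a f g /ell2_predP[s s0 fs] /ell2_predP[t t0 gt]].
  apply/ell2_predP; exists 0 => // A; rewrite big1 ?expr0n// => i _.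
  by rewrite rnorm0 expr0n.
apply/ell2_predP; exists (rnorm a * s + t).
  by rewrite addr_ge0// mulr_ge0// rnorm_ge0.
move=> A; apply: sumD_le => //; first by rewrite mulr_ge0// rnorm_ge0.
under eq_bigr => i _ do rewrite [rnorm _]rnormM exprMn.
by rewrite -mulr_sumr exprMn ler_wpM2l// sqr_ge0.
Qed.

HB.instance Definition _ :=
  GRing.isSubmodClosed.Build R[i] (I -> R[i]) ell2_pred ell2_pred_submod.

(* l^2(#|I|), realised on the index set I. *)
Record ell2 := Ell2 { ell2_fun :> I -> R[i]; ell2_subproof : ell2_fun \in ell2_pred }.

HB.instance Definition _ := [isSub for ell2_fun].
HB.instance Definition _ := [Choice of ell2 by <:].
HB.instance Definition _ := [SubChoice_isSubLmodule of ell2 by <:].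

Definition ell2_norm (f : ell2) : R := Num.sqrt (fine (sqsum f)).

Lemma ell2_norm_ge0 f : 0 <= ell2_norm f. Proof. exact: sqrtr_ge0. Qed.

Lemma ell2_norm_le (f : ell2) (M : R) : 0 <= M -> ell2_norm f <= M <->
  forall A : {fset I}, \sum_(i <- A) rnorm (f i) ^+ 2 <= M ^+ 2.
Proof.
move=> M0; rewrite -sqsumP /ell2_norm.
have := ell2_subproof f; rewrite inE/=; have := sqsum_ge0 f.
case: (sqsum f) => [r| |]//; rewrite lee_fin => r0 _ /=.
rewrite lee_fin -[in X in _ <-> X](sqr_sqrtr r0) ler_pXn2r//.
by rewrite nnegrE sqrtr_ge0.
Qed.

Lemma ell2_sum_le (f : ell2) (A : {fset I}) :
  \sum_(i <- A) rnorm (f i) ^+ 2 <= ell2_norm f ^+ 2.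
Proof. exact: (ell2_norm_le f (ell2_norm_ge0 f)).1. Qed.

Lemma ell2_coord_le (f : ell2) i : rnorm (f i) <= ell2_norm f.
Proof.
have := ell2_sum_le f [fset i]%fset; rewrite big_seq_fset1.
by rewrite ler_pXn2r ?nnegrE ?rnorm_ge0 ?ell2_norm_ge0.
Qed.

Lemma ell2_normD (f g : ell2) : ell2_norm (f + g) <= ell2_norm f + ell2_norm g.
Proof.
apply/ell2_norm_le; first by rewrite addr_ge0 ?ell2_norm_ge0.
move=> A; apply: sumD_le; rewrite ?ell2_norm_ge0//; exact: ell2_sum_le.
Qed.

Lemma ell2_normZ_le (a : R[i]) (f : ell2) :
  ell2_norm (a *: f) <= rnorm a * ell2_norm f.
Proof.
apply/ell2_norm_le; first by rewrite mulr_ge0 ?rnorm_ge0 ?ell2_norm_ge0.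
move=> A; under eq_bigr => i _ do rewrite [rnorm _]rnormM exprMn.
by rewrite -mulr_sumr exprMn ler_wpM2l ?sqr_ge0// ell2_sum_le.
Qed.

Lemma ell2_norm_eq0 (f : ell2) : ell2_norm f = 0 -> f = 0.
Proof.
move=> f0; apply: val_inj; apply/funext => i /=; apply: rnorm0_eq0.
by apply/eqP; rewrite eq_le rnorm_ge0 -f0 ell2_coord_le.
Qed.

Lemma ell2_normZ (a : R[i]) (f : ell2) :
  ell2_norm (a *: f) = rnorm a * ell2_norm f.
Proof.
apply/eqP; rewrite eq_le ell2_normZ_le/=.
have [->|a0] := eqVneq a 0.
  by rewrite rnorm0 mul0r ell2_norm_ge0.
have an : 0 < rnorm a by rewrite -ltcR -rnormE normr_gt0.
rewrite -ler_pdivlMl// -[X in ell2_norm X <= _](scale1r f) -(mulVf a0) -scalerA.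
rewrite (le_trans (ell2_normZ_le _ _))// ler_wpM2r ?ell2_norm_ge0//.
rewrite -(ler_pM2l an) -rnormM divff// mulfV ?gt_eqF//.
by rewrite /rnorm normr1.
Qed.

Let ell2_cnormD (f g : ell2) :
  (ell2_norm (f + g))%:C <= (ell2_norm f)%:C + (ell2_norm g)%:C.
Proof. by rewrite -rmorphD lecR ell2_normD. Qed.

Let ell2_cnormZ (a : R[i]) (f : ell2) :
  (ell2_norm (a *: f))%:C = `|a| * (ell2_norm f)%:C.
Proof. by rewrite ell2_normZ rmorphM rnormE. Qed.

Let ell2_cnorm_eq0 (f : ell2) : (ell2_norm f)%:C = 0 -> f = 0.
Proof. by move=> /complexI /ell2_norm_eq0. Qed.

HB.instance Definition _ :=
  Lmodule_isNormed.Build R[i] ell2 ell2_cnormD ell2_cnormZ ell2_cnorm_eq0.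

Lemma rnorm_ell2 (f : ell2) : rnorm f = ell2_norm f. Proof. by []. Qed.

Lemma ell2_complete (F : set_system ell2) : ProperFilter F -> cauchy F -> cvg F.
Proof.
move=> PF /cauchyP Fc.
have Fc' (e : R) : 0 < e -> exists g : ell2, F [set f | rnorm (g - f) < e].
  move=> e0; have /Fc[g Fg] : (0 : R[i]) < e%:C by rewrite ltcR.
  exists g; apply: filterS Fg => f; rewrite /ball/= => fe.
  by rewrite -ltcR -rnormE.
pose reP (p : ell2 -> I -> R) :=
  forall f g i, `|p f i - p g i| <= rnorm (f - g).
have cvgP p : reP p -> forall i, cvg (p^~ i @ F).
  move=> pP i; apply/cauchy_cvgP/cauchyP => e e0.
  have [g Fg] := Fc' _ e0; exists (p g i).
  change (F [set f | ball (p g i) e (p f i)]).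
  by apply: filterS Fg => f; apply: le_lt_trans; exact: (pP g f i).
have absRe (z : R[i]) : `|complex.Re z| <= rnorm z.
  case: z => a b /=; rewrite -sqrtr_sqr ler_wsqrtr// lerDl sqr_ge0//.
have absIm (z : R[i]) : `|complex.Im z| <= rnorm z.
  case: z => a b /=; rewrite -sqrtr_sqr ler_wsqrtr// lerDr sqr_ge0//.
have cRe := cvgP (fun f i => complex.Re (f i)).
have cIm := cvgP (fun f i => complex.Im (f i)).
have {}cRe i : cvg ((fun f : ell2 => complex.Re (f i)) @ F).
  apply: cRe => {}f g {}i; rewrite -raddfB.
  exact: le_trans (absRe _) (ell2_coord_le (f - g) i).
have {}cIm i : cvg ((fun f : ell2 => complex.Im (f i)) @ F).
  apply: cIm => {}f g {}i; rewrite -raddfB.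
  exact: le_trans (absIm _) (ell2_coord_le (f - g) i).
pose a i : R[i] := Complex (lim ((fun f : ell2 => complex.Re (f i)) @ F))
                           (lim ((fun f : ell2 => complex.Im (f i)) @ F)).
have rnorm2 (z : R[i]) : rnorm z ^+ 2 = complex.Re z ^+ 2 + complex.Im z ^+ 2.
  by case: z => x y; rewrite /rnorm/= sqr_sqrtr// addr_ge0 ?sqr_ge0.
have key (e : R) (g : ell2) : 0 <= e -> F [set f | rnorm (g - f) < e] ->
    forall A : {fset I}, \sum_(i <- A) rnorm (g i - a i) ^+ 2 <= e ^+ 2.
  move=> e0 Fg A.
  have cv : (fun f : ell2 => \sum_(i <- A) rnorm (g i - f i) ^+ 2) @ F -->
      \sum_(i <- A) rnorm (g i - a i) ^+ 2.
    apply: cvg_big => [x|i _]; first exact: add_continuous.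
    rewrite (_ : (fun f : ell2 => _) = (fun f : ell2 =>
      (complex.Re (g i) - complex.Re (f i)) ^+ 2 +
      (complex.Im (g i) - complex.Im (f i)) ^+ 2)); last first.
      by apply/funext => f; rewrite rnorm2 !raddfB.
    rewrite rnorm2 !raddfB/=.
    by apply: cvgD; rewrite expr2; apply: cvgM; apply: cvgB => //; exact: cvg_cst.
  rewrite -(cvg_lim _ cv)//; apply: limr_le; first by apply/cvg_ex; eexists; exact: cv.
  near=> f.
  apply: le_trans (ell2_sum_le (g - f) A) _.
  rewrite ler_pXn2r ?nnegrE ?ell2_norm_ge0//.
  by rewrite -rnorm_ell2 ltW//; near: f.
have [g0 Fg0] := Fc' 1 ltr01.
have ga : (g0 : I -> R[i]) - a \in ell2_pred.
  by apply/ell2_predP; exists 1 => //; exact: key Fg0.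
have aP : a \in ell2_pred.
  by rewrite -(subKr (g0 : I -> R[i]) a) rpredB//; exact: ell2_subproof.
apply/cvg_ex; exists (Ell2 aP).
apply/cvgrPdist_le => e e0.
have er : e = (complex.Re e)%:C by rewrite RRe_real// gtr0_real.
have {e0 er} : exists2 r, 0 < r & e = r%:C.
  by exists (complex.Re e) => //; rewrite -ltcR -er.
case=> r r0 ->.
have r2 : 0 < r / 2 by rewrite divr_gt0.
have [g Fg] := Fc' _ r2.
apply: (filterS _ Fg) => f gf; rewrite rnormE lecR.
rewrite (le_trans (rnorm_tri _ g _))// [leRHS](splitr r) lerD//; last exact: ltW.
rewrite rnormB rnorm_ell2; apply/ell2_norm_le; first exact: ltW.
by move=> A; exact: (key _ g (ltW r2) Fg A).
Unshelve. all: by end_near.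
Qed.

HB.instance Definition _ := Uniform_isComplete.Build ell2 ell2_complete.

End ell2.

Section bounded_operators.
Context (R : realType) (X : normedModType R[i]).

Definition bounded_linear : {pred X -> X} := [pred f : X -> X | `[< linear f /\
  exists M : R, forall x, rnorm (f x) <= M * rnorm x >]].

Lemma bounded_linearP (f : X -> X) : reflect
  (linear f /\ exists2 M : R, 0 <= M & forall x, rnorm (f x) <= M * rnorm x)
  (f \in bounded_linear).
Proof.
rewrite inE; apply: (iffP (asboolP _)) => -[lf]; last first.
  by case=> M _ fM; split => //; exists M.
case=> M fM; split => //; exists `|M| => // x.
by rewrite (le_trans (fM x))// ler_wpM2r ?rnorm_ge0// ler_norm.
Qed.

Lemma bounded_linear_submod : GRing.submod_closed bounded_linear.
Proof.
split=> [|a f g /bounded_linearP[lf [s s0 fs]] /bounded_linearP[lg [t t0 gt]]].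
  apply/bounded_linearP; split; first by move=> c x y; rewrite scaler0 addr0.
  by exists 0 => // x; rewrite mul0r [leLHS]rnorm0.
apply/bounded_linearP; split.
  move=> c x y; change (a *: f (c *: x + y) + g (c *: x + y) =
    c *: (a *: f x + g x) + (a *: f y + g y)).
  by rewrite lf lg !scalerDr !scalerA mulrC addrACA.
exists (rnorm a * s + t); first by rewrite addr_ge0// mulr_ge0// rnorm_ge0.
move=> x; rewrite (le_trans (rnormD _ _))// mulrDl lerD//.
by rewrite rnormZ -mulrA ler_wpM2l// rnorm_ge0.
Qed.

HB.instance Definition _ :=
  GRing.isSubmodClosed.Build R[i] (X -> X) bounded_linear bounded_linear_submod.

Record bounded_op := BoundedOp {
  bounded_op_fun :> X -> X ;
  bounded_op_subproof : bounded_op_fun \in bounded_linear }.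

HB.instance Definition _ := [isSub for bounded_op_fun].
HB.instance Definition _ := [Choice of bounded_op by <:].
HB.instance Definition _ := [SubChoice_isSubLmodule of bounded_op by <:].

Lemma bounded_op_linear (T : bounded_op) : linear T.
Proof. by have /bounded_linearP[] := bounded_op_subproof T. Qed.

HB.instance Definition _ (T : bounded_op) :=
  GRing.isLinear.Build R[i] X X *:%R (bounded_op_fun T) (@bounded_op_linear T).

(* The norm of T|_Y in B(Y, X). *)
Definition opnorm_on (Y : set X) (T : bounded_op) : R :=
  sup [set rnorm (T x) | x in [set x | Y x /\ rnorm x <= 1]].

Definition opnorm (T : bounded_op) : R := opnorm_on [set: X] T.

Lemma opnorm_on_ge (Y : set X) (T : bounded_op) x :
  Y x -> rnorm x <= 1 -> rnorm (T x) <= opnorm_on Y T.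
Proof.
move=> Yx x1; apply: ub_le_sup; last by exists x.
have /bounded_linearP[_ [M M0 TM]] := bounded_op_subproof T.
exists M => _ [y [_ y1] <-]; rewrite (le_trans (TM y))//.
by rewrite ler_piMr.
Qed.

Lemma opnorm_on_le (Y : set X) (T : bounded_op) (M : R) : 0 <= M ->
  (forall x, Y x -> rnorm x <= 1 -> rnorm (T x) <= M) -> opnorm_on Y T <= M.
Proof.
move=> M0 TM; rewrite /opnorm_on.
have [->|/set0P A0] := eqVneq [set rnorm (T x) | x in [set x | Y x /\ rnorm x <= 1]] set0.
  by rewrite sup0.
by apply: ge_sup => // _ [x [Yx x1] <-]; exact: TM.
Qed.

Lemma opnorm_on_ge0 (Y : set X) (T : bounded_op) : 0 <= opnorm_on Y T.
Proof.
have [E|/set0P[_ [x [Yx x1] _]]] :=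
  eqVneq [set rnorm (T x) | x in [set x | Y x /\ rnorm x <= 1]] set0.
  by rewrite /opnorm_on E sup0.
by rewrite (le_trans (rnorm_ge0 (T x)))// opnorm_on_ge.
Qed.

Lemma opnorm_on_subset (Y Z : set X) (T : bounded_op) :
  Y `<=` Z -> opnorm_on Y T <= opnorm_on Z T.
Proof.
move=> YZ; apply: opnorm_on_le; first exact: opnorm_on_ge0.
by move=> x /YZ Zx x1; exact: opnorm_on_ge.
Qed.

Lemma opnorm_onD (Y : set X) (S T : bounded_op) :
  opnorm_on Y (S + T) <= opnorm_on Y S + opnorm_on Y T.
Proof.
apply: opnorm_on_le; first by rewrite addr_ge0 ?opnorm_on_ge0.
move=> x Yx x1; rewrite (le_trans (rnormD _ _))//.
by rewrite lerD// opnorm_on_ge.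
Qed.

Lemma opnorm_onB (Y : set X) (S T : bounded_op) : opnorm_on Y (S - T) = opnorm_on Y (T - S).
Proof.
rewrite /opnorm_on; congr (sup (_ @` _)); apply/funext => x.
exact: rnormB.
Qed.

Lemma rnorm_op_le (T : bounded_op) x : rnorm (T x) <= opnorm T * rnorm x.
Proof.
have [->|x0] := eqVneq x 0; first by rewrite linear0 !rnorm0 mulr0.
have xn : 0 < rnorm x by rewrite -ltcR -rnormE normr_gt0.
rewrite -ler_pdivrMr// mulrC.
have xE : rnorm (rnorm x)^-1%:C = (rnorm x)^-1.
  by apply: complexI; rewrite -rnormE ger0_norm// ler0c invr_ge0 ltW.
rewrite -xE -rnormZ -linearZ/=; apply: opnorm_on_ge => //.
by rewrite rnormZ xE mulVf// gt_eqF.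
Qed.

Let opnorm_cD (S T : bounded_op) : (opnorm (S + T))%:C <= (opnorm S)%:C + (opnorm T)%:C.
Proof. by rewrite -rmorphD lecR opnorm_onD. Qed.

Let opnorm_cZ (a : R[i]) (T : bounded_op) : (opnorm (a *: T))%:C = `|a| * (opnorm T)%:C.
Proof.
have le b S : opnorm (b *: S) <= rnorm b * opnorm S.
  apply: opnorm_on_le; first by rewrite mulr_ge0 ?rnorm_ge0 ?opnorm_on_ge0.
  by move=> x _ x1; rewrite [leLHS]rnormZ ler_wpM2l ?rnorm_ge0// opnorm_on_ge.
rewrite rnormE -rmorphM; congr _%:C; apply/eqP; rewrite eq_le le/=.
have [->|a0] := eqVneq a 0; first by rewrite rnorm0 mul0r opnorm_on_ge0.
have an : 0 < rnorm a by rewrite -ltcR -rnormE normr_gt0.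
rewrite -ler_pdivlMl// -[X in opnorm X <= _](scale1r T) -(mulVf a0) -scalerA.
rewrite (le_trans (le _ _))// ler_wpM2r ?opnorm_on_ge0//.
rewrite -(ler_pM2l an) -rnormM divff// mulfV ?gt_eqF//.
by rewrite /rnorm normr1.
Qed.

Let opnorm_c_eq0 (T : bounded_op) : (opnorm T)%:C = 0 -> T = 0.
Proof.
move=> /complexI T0; apply: val_inj; apply/funext => x /=; apply: rnorm0_eq0.
by apply/eqP; rewrite eq_le rnorm_ge0 (le_trans (rnorm_op_le _ _))// T0 mul0r.
Qed.

HB.instance Definition _ :=
  Lmodule_isNormed.Build R[i] bounded_op opnorm_cD opnorm_cZ opnorm_c_eq0.

Lemma rnorm_op (T : bounded_op) : rnorm T = opnorm T. Proof. by []. Qed.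

End bounded_operators.

Section closure_rnorm.
Context (R : realType) (X : normedModType R[i]).

Lemma closure_rnormP (A : set X) x : closure A x <->
  forall e : R, 0 < e -> exists2 y, A y & rnorm (x - y) < e.
Proof.
split=> [Ax e e0|Ax B].
  have [|y [Ay]] := Ax (ball x e%:C); first by apply: nbhsx_ballx; rewrite ltcR.
  by rewrite -ball_normE/= rnormE ltcR; exists y.
rewrite -nbhs_ballE => -[e /= e0 eB].
have er : e = (complex.Re e)%:C by rewrite RRe_real// gtr0_real.
have [|y Ay xy] := Ax (complex.Re e); first by rewrite -ltcR -er.
by exists y; split => //; apply: eB; rewrite -ball_normE/= er rnormE ltcR.
Qed.

End closure_rnorm.

Definition separable_set (T : topologicalType) (A : set T) : Prop :=
  exists D : set T, [/\ countable D, D `<=` A & A `<=` closure D].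

Lemma separable_setW (R : realType) (X : normedModType R[i]) (A D : set X) :
  countable D -> A `<=` closure D -> separable_set A.
Proof.
move=> cD AD.
pose W (p : X * nat) := [set y | A y /\ rnorm (p.1 - y) < p.2.+1%:R^-1].
exists [set y | A y /\ exists2 p, (D `*` setT) p & y = xget 0 (W p)]; split.
- apply: (@sub_countable _ _ _ ((fun p => xget 0 (W p)) @` (D `*` setT))).
    by apply: subset_card_le => y [_ [p Dp ->]]; exists p.
  by apply: card_le_trans (card_image_le _ _) _; exact: countableX.
- by move=> y [].
- move=> x Ax; apply/closure_rnormP => e e0.
  have [n n0] : exists n : nat, n.+1%:R^-1 < e / 2.
    have e2 : 0 < (e / 2)^-1 by rewrite invr_gt0 divr_gt0.
    exists (Num.truncn (e / 2)^-1).
    by rewrite -[ltRHS]invrK ltf_pV2 ?posrE// truncnS_gt.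
  have n1 : 0 < n.+1%:R^-1 :> R by rewrite invr_gt0.
  have [d Dd xd] := (closure_rnormP D x).1 (AD _ Ax) _ n1.
  have [Ay dy] : W (d, n) (xget 0 (W (d, n))).
    by apply: xgetPex; exists x; split => //; rewrite rnormB.
  exists (xget 0 (W (d, n))); first by split => //; exists (d, n).
  rewrite (le_lt_trans (rnorm_tri _ d _))// (splitr e) ltrD//.
    exact: lt_trans xd n0.
  exact: lt_trans dy n0.
Qed.

(* Closedness makes the quotient seminorm a norm. *)
Record closed_subspace (K : numFieldType) (E : normedModType K) := ClosedSubspace {
  subspace_pred :> {pred E} ;
  subspace_submod : GRing.submod_closed subspace_pred ;
  subspace_closed : closed [set x | x \in subspace_pred] }.

HB.instance Definition _ (K : numFieldType) (E : normedModType K)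
    (F : closed_subspace E) :=
  GRing.isSubmodClosed.Build K E (subspace_pred F) (subspace_submod F).

Section separable_range_operators.
Context (R : realType) (X : normedModType R[i]).

Definition sep_op : {pred bounded_op X} :=
  [pred T : bounded_op X | `[< separable_set (range T) >]].

Lemma sep_opP (T : bounded_op X) :
  reflect (exists2 D, countable D & range T `<=` closure D) (T \in sep_op).
Proof.
rewrite inE; apply: (iffP (asboolP _)) => [[D [cD _ TD]]|[D cD TD]].
  by exists D.
exact: separable_setW TD.
Qed.

Lemma sep_op_submod : GRing.submod_closed sep_op.
Proof.
split=> [|a S T /sep_opP[D cD SD] /sep_opP[E cE TE]]; apply/sep_opP.
  exists [set 0]; first exact: countable1.
  by move=> _ [x _ <-]; apply: subset_closure.
exists ((fun p => a *: p.1 + p.2) @` (D `*` E)).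
  by apply: card_le_trans (card_image_le _ _) _; exact: countableX.
move=> _ [x _ <-]; apply/closure_rnormP => e e0.
have a0 : 0 < rnorm a + 1 by rewrite ltr_wpDl// rnorm_ge0.
have e1 : 0 < e / 2 / (rnorm a + 1) by rewrite !divr_gt0.
have e2 : 0 < e / 2 by rewrite !divr_gt0.
have [|d Dd xd] := (closure_rnormP D (S x)).1 _ _ e1; first exact: SD.
have [|d' Ed' xd'] := (closure_rnormP E (T x)).1 _ _ e2; first exact: TE.
exists (a *: d + d'); first by exists (d, d').
have -> : (a *: S + T) x - (a *: d + d') = a *: (S x - d) + (T x - d').
  by rewrite scalerBr opprD addrACA.
rewrite (le_lt_trans (rnormD _ _))// (splitr e) ler_ltD//.
rewrite rnormZ (@le_trans _ _ (rnorm a * (e / 2 / (rnorm a + 1))))//.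
  by rewrite ler_wpM2l ?rnorm_ge0// ltW.
by rewrite mulrCA ger_pMr// ler_pdivrMr// mul1r lerDl.
Qed.

Lemma sep_op_closed : closed [set T | T \in sep_op].
Proof.
move=> T /closure_rnormP clT; apply/sep_opP.
have inv0 n : 0 < n.+1%:R^-1 :> R by rewrite invr_gt0.
have /choice[D DP] n : exists D : set X, countable D /\
    forall x, rnorm x <= 1 -> exists2 d, D d & rnorm (T x - d) < n.+1%:R^-1.
  have n2 : 0 < n.+1%:R^-1 / 2 :> R by rewrite divr_gt0.
  have [S /sep_opP[D cD SD] TS] := clT _ n2.
  exists D; split => // x x1.
  have [|d Dd xd] := (closure_rnormP D (S x)).1 _ _ n2; first exact: SD.
  exists d => //.
  rewrite (le_lt_trans (rnorm_tri _ (S x) _))// [ltRHS]splitr ler_ltD//.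
  apply: le_trans (ltW TS).
  exact: (@opnorm_on_ge _ _ setT (T - S) x).
pose Dk := \bigcup_n D n.
exists ((fun p : nat * X => p.1%:R *: p.2) @` ([set: nat] `*` Dk)).
  apply: card_le_trans (card_image_le _ _) _; apply: countableX => //.
  by apply: bigcup_countable => // n _; exact: (DP n).1.
move=> _ [x _ <-]; apply/closure_rnormP => e e0.
pose m := (Num.truncn (rnorm x)).+1.
have m0 : 0 < m%:R :> R by rewrite ltr0n.
have mE : rnorm (m%:R : R[i]) = m%:R.
  by apply: complexI; rewrite -rnormE normr_nat rmorph_nat.
have mx : rnorm ((m%:R : R[i])^-1 *: x) <= 1.
  have -> : rnorm ((m%:R : R[i])^-1 *: x) = m%:R^-1 * rnorm x.
    rewrite rnormZ; congr (_ * _); apply: complexI.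
    by rewrite -rnormE normfV normr_nat fmorphV rmorph_nat.
  by rewrite mulrC ler_pdivrMr// mul1r ltW// truncnS_gt.
have [n n0] : exists n : nat, n.+1%:R^-1 < e / m%:R.
  have e2 : 0 < (e / m%:R)^-1 by rewrite invr_gt0 divr_gt0.
  exists (Num.truncn (e / m%:R)^-1).
  by rewrite -[ltRHS]invrK ltf_pV2 ?posrE// truncnS_gt.
have [d Dd xd] := (DP n).2 _ mx.
exists (m%:R *: d); first by exists (m, d) => //; split => //; exists n.
have -> : T x - (m%:R : R[i]) *: d = (m%:R : R[i]) *: (T ((m%:R : R[i])^-1 *: x) - d).
  by rewrite scalerBr [T (_ *: x)]linearZ scalerA divff ?scale1r// pnatr_eq0.
by rewrite rnormZ mE mulrC -ltr_pdivlMr// (lt_trans xd).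
Qed.

Definition sep_ops : closed_subspace (bounded_op X) :=
  ClosedSubspace sep_op_submod sep_op_closed.

End separable_range_operators.

Section compact_operators.
Context (R : realType) (X : completeNormedModType R[i]).

Definition compact_op : {pred bounded_op X} :=
  [pred T : bounded_op X | `[< precompact (T @` [set x | `|x| <= 1]) >]].

Lemma compact_opP (T : bounded_op X) :
  reflect (precompact (T @` [set x | `|x| <= 1])) (T \in compact_op).
Proof. by rewrite inE; exact: asboolP. Qed.

Lemma compact_op_submod : GRing.submod_closed compact_op.
Proof.
have sub (A B : set X) : A `<=` B -> compact B -> precompact A.
  move=> AB cB; apply: (@precompact_subset _ _ B) => //.
  by rewrite precompact_closed//; apply: compact_closed => //; exact: norm_hausdorff.
split=> [|a S T /compact_opP cS /compact_opP cT]; apply/compact_opP.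
  by apply: (sub _ [set (0 : X)]); [move=> _ [x _ <-]|exact: compact_set1].
rewrite !precompactE in cS cT.
have cont : continuous (fun p : X * X => a *: p.1 + p.2).
  move=> p; apply: cvgD; last exact: cvg_snd.
  by apply: cvgZl_tmp; exact: cvg_fst.
apply: (sub _ _ _ (continuous_compact (continuous_subspaceT cont) (compact_setX cS cT))).
move=> _ [x x1 <-]; exists (S x, T x) => //.
by split; apply: subset_closure; exists x.
Qed.

Lemma compact_op_closed : closed [set T | T \in compact_op].
Proof.
move=> T /closure_rnormP clT; apply/compact_opP; rewrite precompactE compact_ultra.
move=> F UF FA.
have PF : ProperFilter F by exact: ultra_proper.
suff cF : cauchy F.
  have Fp : F --> lim F by exact: (@cauchy_cvg X F PF cF).
  have cl : closed (closure (T @` [set x | `|x| <= 1])) by exact: closed_closure.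
  exists (lim F); split=> //.
  by apply: cl => B /Fp FB; exact: filter_ex (filterI FA FB).
apply/cauchyP => e e0.
have er : e = (complex.Re e)%:C by rewrite RRe_real// gtr0_real.
pose r := complex.Re e.
have r0 : 0 < r by rewrite -ltcR -er.
have r4 : 0 < r / 4 by rewrite divr_gt0.
have [S /compact_opP + TS] := clT _ r4.
rewrite precompactE compact_cover => cS.
have [||D _ cov] := cS X [set: X] (fun x => ball x (r / 4)%:C).
- by move=> x _; apply: ball_open; rewrite ltcR.
- by move=> x _; exists x => //; apply: ballxx; rewrite ltcR.
have : F (\bigcup_(d in [set` D]) [set y | rnorm (d - y) < r]).
  apply: filterS FA => y /closure_rnormP/(_ _ r4)[_ [x x1 <-] yx].
  have [|d Dd dx] := cov (S x); first by apply: subset_closure; exists x.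
  move: dx; rewrite -ball_normE/= rnormE ltcR => dx.
  exists d => //=.
  have ST : rnorm (S x - T x) < r / 4.
    apply: le_lt_trans TS; rewrite rnormB.
    apply: (@opnorm_on_ge _ _ setT (T - S) x) => //.
    by rewrite -lecR -rnormE.
  have := rnorm_tri d (S x) y; have := rnorm_tri (S x) (T x) y.
  rewrite (rnormB (T x)); move: yx ST dx r0.
  lra.
move=> FD; have [d _ Fd] : exists2 d, d \in D & F [set y | rnorm (d - y) < r].
  apply: contrapT => /forall2NP noF.
  have FI : F (\bigcap_(d in [set` D]) ~` [set y | rnorm (d - y) < r]).
    apply: filter_bigI => d Dd; have [/(_ Dd)//|nF] := noF d.
    by have [] := in_ultra_setVsetC [set y | rnorm (d - y) < r] UF.
  have := filterI FD FI; rewrite -setC_bigcup setICr => F0.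
  exact: (filter_not_empty F (F0 _)).
exists d; apply: filterS Fd => y; rewrite /= -ball_normE/= rnormE er ltcR//.
Qed.

Definition compact_ops : closed_subspace (bounded_op X) :=
  ClosedSubspace compact_op_submod compact_op_closed.

End compact_operators.

Section quotient_space.
Local Open Scope quotient_scope.
Context (R : realType) (E : normedModType R[i]) (F : closed_subspace E).

Definition quot_space : Type := ring_quotient.Quotient.quot (subspace_pred F).

HB.instance Definition _ := GRing.Zmodule.on quot_space.
HB.instance Definition _ := Choice.on quot_space.

Definition quot_pi (x : E) : quot_space :=
  \pi_(ring_quotient.Quotient.quot (subspace_pred F)) x.

Lemma quot_piD : {morph quot_pi : x y / x + y}.
Proof. by move=> x y; rewrite /quot_pi raddfD. Qed.

Lemma quot_piB : {morph quot_pi : x y / x - y}.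
Proof. by move=> x y; rewrite /quot_pi raddfB. Qed.

Lemma quot_piP x y : quot_pi x = quot_pi y <-> x - y \in F.
Proof.
by rewrite (ring_quotient.Quotient.idealrBE F); split=> [/eqP|/eqP].
Qed.

Lemma quot_piS (q : quot_space) : exists x, quot_pi x = q.
Proof. by exists (repr (q : ring_quotient.Quotient.quot (subspace_pred F))); exact: reprK. Qed.

(* repr is a choice of representative; see quot_piZ. *)
Definition quot_scale (a : R[i]) (q : quot_space) : quot_space :=
  quot_pi (a *: repr (q : ring_quotient.Quotient.quot (subspace_pred F))).

Lemma quot_piZ a x : quot_pi (a *: x) = quot_scale a (quot_pi x).
Proof.
apply/quot_piP; rewrite -scalerBr rpredZ//; apply/quot_piP.
by rewrite [RHS]reprK.
Qed.

Let quot_scaleA a b q : quot_scale a (quot_scale b q) = quot_scale (a * b) q.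
Proof. by have [x <-] := quot_piS q; rewrite -!quot_piZ scalerA. Qed.

Let quot_scale1 q : quot_scale 1 q = q.
Proof. by have [x <-] := quot_piS q; rewrite -!quot_piZ scale1r. Qed.

Let quot_scaleDr : right_distributive quot_scale +%R.
Proof.
move=> a p q; have [x <-] := quot_piS p; have [y <-] := quot_piS q.
by rewrite -quot_piD -!quot_piZ scalerDr quot_piD.
Qed.

Let quot_scaleDl q : {morph quot_scale^~ q : a b / a + b}.
Proof.
by move=> a b; have [x <-] := quot_piS q; rewrite -!quot_piZ scalerDl quot_piD.
Qed.

HB.instance Definition _ := GRing.Zmodule_isLmodule.Build R[i] quot_space
  quot_scaleA quot_scale1 quot_scaleDr quot_scaleDl.

Lemma quot_pi_linear : linear quot_pi.
Proof. by move=> a x y; rewrite quot_piD quot_piZ. Qed.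

HB.instance Definition _ :=
  GRing.isLinear.Build R[i] E quot_space *:%R quot_pi quot_pi_linear.

Definition quot_norm (q : quot_space) : R :=
  inf [set rnorm x | x in [set x | quot_pi x = q]].

Lemma quot_norm_le x : quot_norm (quot_pi x) <= rnorm x.
Proof.
by apply: ge_inf; [exists 0 => _ [y _ <-]; exact: rnorm_ge0|exists x].
Qed.

Lemma quot_norm_ge (M : R) (q : quot_space) :
  (forall x, quot_pi x = q -> M <= rnorm x) -> M <= quot_norm q.
Proof.
move=> qM; apply: lb_le_inf; last by move=> _ [x /qM + <-].
by have [x xq] := quot_piS q; exists (rnorm x); exists x.
Qed.

Lemma quot_norm_ge0 q : 0 <= quot_norm q.
Proof. by apply: quot_norm_ge => x _; exact: rnorm_ge0. Qed.

Lemma quot_norm_adherent (q : quot_space) (e : R) : 0 < e ->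
  exists2 x, quot_pi x = q & rnorm x < quot_norm q + e.
Proof.
move=> e0.
have [|_ [x xq <-] xe] := @inf_adherent _ [set rnorm x | x in [set x | quot_pi x = q]] _ e0.
  split; first by have [x xq] := quot_piS q; exists (rnorm x); exists x.
  by exists 0 => _ [y _ <-]; exact: rnorm_ge0.
by exists x.
Qed.

Let quot_cD p q : (quot_norm (p + q))%:C <= (quot_norm p)%:C + (quot_norm q)%:C.
Proof.
rewrite -rmorphD lecR; apply/ler_addgt0Pr => e e0.
have e2 : 0 < e / 2 by rewrite divr_gt0.
have [x <- xe] := quot_norm_adherent p e2.
have [y <- ye] := quot_norm_adherent q e2.
rewrite -quot_piD (le_trans (quot_norm_le _))// (le_trans (rnormD _ _))//.
by rewrite [in leRHS](splitr e) addrACA lerD// ltW.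
Qed.

Let quot_cZ (a : R[i]) q : (quot_norm (a *: q))%:C = `|a| * (quot_norm q)%:C.
Proof.
have le b p : quot_norm (b *: p) <= rnorm b * quot_norm p.
  have [->|b0] := eqVneq b 0.
    by rewrite rnorm0 mul0r scale0r -(raddf0 quot_pi) -(rnorm0 E) quot_norm_le.
  have bn : 0 < rnorm b by rewrite -ltcR -rnormE normr_gt0.
  rewrite mulrC -ler_pdivrMr//; apply: quot_norm_ge => x <-.
  by rewrite ler_pdivrMr// mulrC -rnormZ -linearZ quot_norm_le.
rewrite rnormE -rmorphM; congr _%:C; apply/eqP; rewrite eq_le le/=.
have [->|a0] := eqVneq a 0; first by rewrite rnorm0 mul0r quot_norm_ge0.
have an : 0 < rnorm a by rewrite -ltcR -rnormE normr_gt0.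
rewrite -ler_pdivlMl// -[X in quot_norm X <= _](scale1r q) -(mulVf a0) -scalerA.
rewrite (le_trans (le _ _))// ler_wpM2r ?quot_norm_ge0//.
rewrite -(ler_pM2l an) -rnormM divff// mulfV ?gt_eqF//.
by rewrite /rnorm normr1.
Qed.

Let quot_c_eq0 q : (quot_norm q)%:C = 0 -> q = 0.
Proof.
move=> /complexI q0; have [x xq] := quot_piS q.
rewrite -xq -(raddf0 quot_pi); apply/quot_piP; rewrite subr0.
apply: (subspace_closed (c := F)); apply/closure_rnormP => e e0.
have [y yq] := quot_norm_adherent q e0.
rewrite q0 add0r => ye; exists (x - y); last by rewrite opprB addrC subrK.
by apply/quot_piP; rewrite xq.
Qed.

HB.instance Definition _ :=
  Lmodule_isNormed.Build R[i] quot_space quot_cD quot_cZ quot_c_eq0.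

Lemma rnorm_quot (q : quot_space) : rnorm q = quot_norm q. Proof. by []. Qed.

End quotient_space.

Section uniform_convergence_on_separable_subspaces.
Context (R : realType) (X : normedModType R[i]).

Definition tau_basis : set (set (bounded_op X)) := [set U |
  exists (n : nat) (S : 'I_n -> bounded_op X) (Y : set X) (e : R),
    [/\ GRing.submod_closed (mem Y), separable_set Y, 0 < e &
        U = [set T | forall i, opnorm_on Y (S i - T) < e]]].

Lemma tau_basisP (T : bounded_op X) U : tau_basis U -> U T ->
  exists (Y : set X) (e : R), [/\ GRing.submod_closed (mem Y), separable_set Y,
    0 < e & [set S | opnorm_on Y (T - S) < e] `<=` U].
Proof.
move=> [n [S [Y [e [Ysub Ysep e0 ->]]]]] /= UT.
have : \forall d \near 0^'+, forall i, opnorm_on Y (S i - T) + d <= e.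
  apply: filter_forall => i; near=> d.
  rewrite -lerBrDl; near: d; apply: nbhs_right_le.
  by rewrite subr_gt0.
move=> near_d.
have [d [d0 dP]] : exists d : R, 0 < d /\ forall i, opnorm_on Y (S i - T) + d <= e.
  near (0 : R)^'+ => d; exists d; split; first by near: d; exact: nbhs_right_gt.
  by near: d.
exists Y, d; split => // V TV i.
rewrite (lt_le_trans _ (dP i))//.
rewrite -(subrKA T (S i) (- V)) (le_lt_trans (opnorm_onD _ _ _))//.
by rewrite ltrD2l.
Unshelve. all: by end_near.
Qed.

Lemma tau_basis_cover : \bigcup_(U in tau_basis) U = [set: bounded_op X].
Proof.
apply/seteqP; split=> // T _.
exists [set: bounded_op X] => //; exists 0%N, (fun=> 0), [set 0], 1; split => //.
- split=> [|a x y]; rewrite ?inE//= => -> ->; by rewrite scaler0 addr0.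
- exists [set 0]; split => //; exact: subset_closure.
- by apply/seteqP; split => // S _ [].
Qed.

Lemma tau_basis_join (U V : set (bounded_op X)) T : tau_basis U -> tau_basis V ->
  U T -> V T -> exists W, [/\ tau_basis W, W T & W `<=` U `&` V].
Proof.
move=> bU bV UT VT.
have [Y [d [[Y0 Ysub] [D [cD DY YD]] d0 YU]]] := tau_basisP bU UT.
have [Z [e [[Z0 Zsub] [E [cE EZ ZE]] e0 ZV]]] := tau_basisP bV VT.
pose YZ := [set y + z | y in Y & z in Z].
rewrite !inE in Y0 Z0.
have YYZ : Y `<=` YZ by move=> y Yy; exists y => //; exists 0; rewrite ?addr0.
have ZYZ : Z `<=` YZ by move=> z Zz; exists 0 => //; exists z; rewrite ?add0r.
exists [set S | opnorm_on YZ (T - S) < Num.min d e]; split.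
- exists 1%N, (fun=> T), YZ, (Num.min d e); split => //.
  + split; first by rewrite inE; exact: YYZ.
    move=> a _ _ /[!inE] -[x Yx [x' Zx' <-]] [y Yy [y' Zy' <-]].
    exists (a *: x + y); first by have := Ysub a x y; rewrite !inE; exact.
    exists (a *: x' + y'); first by have := Zsub a x' y'; rewrite !inE; exact.
    by rewrite scalerDr addrACA.
  + apply: (@separable_setW _ _ _ [set y + z | y in D & z in E]).
      rewrite image2E.
      by apply: card_le_trans (card_image_le _ _) _; exact: countableX.
    move=> _ [y Yy [z Zz <-]]; apply/closure_rnormP => r r0.
    have r2 : 0 < r / 2 by rewrite divr_gt0.
    have [y' Dy' yy'] := (closure_rnormP D y).1 (YD _ Yy) _ r2.
    have [z' Ez' zz'] := (closure_rnormP E z).1 (ZE _ Zz) _ r2.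
    exists (y' + z'); first by exists y' => //; exists z'.
    by rewrite opprD addrACA (le_lt_trans (rnormD _ _))// (splitr r) ltrD.
  + by rewrite lt_min d0.
  + by apply/seteqP; split=> S /= ST => [_|]//; exact: (ST ord0).
- by rewrite /= subrr lt_min !(le_lt_trans (@opnorm_on_le _ _ _ _ 0 _ _))// => x _ _;
    rewrite [leLHS]rnorm0.
- move=> S /=; rewrite lt_min => /andP[Sd Se]; split.
    by apply: YU; exact: le_lt_trans (opnorm_on_subset _ YYZ) Sd.
  by apply: ZV; exact: le_lt_trans (opnorm_on_subset _ ZYZ) Se.
Qed.

(* An alias of bounded_op X carrying the topology generated by tau_basis, instead of
   the operator norm topology. *)
Definition tau_op : Type := bounded_op X.

HB.instance Definition _ := GRing.Zmodule.on tau_op.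
HB.instance Definition _ := Choice.on tau_op.

Let tau_join (U V : set tau_op) (T : tau_op) : tau_basis U -> tau_basis V ->
  U T -> V T -> exists W : set tau_op, [/\ tau_basis W, W T & W `<=` U `&` V].
Proof. exact: tau_basis_join. Qed.

HB.instance Definition _ := @isBaseTopological.Build tau_op
  (set tau_op : pointedType) tau_basis idfun tau_basis_cover tau_join.

Lemma tau_openP (U : set tau_op) : open U <-> forall T, U T ->
  exists (Y : set X) (e : R), [/\ GRing.submod_closed (mem Y), separable_set Y,
    0 < e & [set S : bounded_op X | opnorm_on Y (T - S) < e] `<=` U].
Proof.
split=> [[B Bb <-] T [V BV VT]|UP].
  have [Y [e [Ysub Ysep e0 YV]]] := tau_basisP (Bb _ BV) VT.
  by exists Y, e; split => // S /YV VS; exists V.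
exists [set V | tau_basis V /\ V `<=` U]; first by move=> V [].
apply/seteqP; split=> [T [V [_ VU] /VU]//|T UT].
have [Y [e [Ysub Ysep e0 YU]]] := UP T UT.
exists [set S : bounded_op X | opnorm_on Y (T - S) < e].
  split => //; exists 1%N, (fun=> T), Y, e; split => //.
  by apply/seteqP; split=> S /= ST => [_|]//; exact: (ST ord0).
by rewrite /= subrr (le_lt_trans (@opnorm_on_le _ _ _ _ 0 _ _))// => x _ _;
    rewrite [leLHS]rnorm0.
Qed.

Lemma tau_open_translate (U : set tau_op) (S : tau_op) :
  open U -> open [set T | U (T + S)].
Proof.
move=> /tau_openP oU; apply/tau_openP => T /= /oU[Y [e [Ysub Ysep e0 YU]]].
exists Y, e; split => // V TV /=; apply: YU => /=.
by rewrite opprD addrACA subrr addr0.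
Qed.

Context (F : closed_subspace (bounded_op X)).

(* An alias of quot_space F whose open sets are the images under quot_pi of the
   tau-open sets, that is the sets U + F. *)
Definition tau_quot : Type := quot_space F.

HB.instance Definition _ := Choice.on tau_quot.

Definition tau_quot_open : set (set tau_quot) :=
  [set quot_pi F @` U | U in [set U | open (U : set tau_op)]].

Let tau_quot_openT : tau_quot_open setT.
Proof.
exists setT; first exact: openT.
by apply/seteqP; split=> // q _; have [x xq] := quot_piS q; exists x.
Qed.

Let tau_quot_openI : setI_closed tau_quot_open.
Proof.
move=> _ _ [U oU <-] [V oV <-].
pose U' : set tau_op := \bigcup_(f in [set f | f \in F]) [set T | U (T + f)].
have oU' : open U'.
  by apply: bigcup_open => f _; exact: tau_open_translate.
exists (U' `&` V); first exact: openI.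
apply/seteqP; split=> [_ [T [[f Ff UTf] VT] <-]|_ [[S US <-] [T VT ST]]].
  split; last by exists T.
  by exists (T + f) => //; apply/quot_piP; rewrite addrAC subrr add0r.
exists T => //; split => //; exists (S - T); last by rewrite /= addrC subrK.
by apply/quot_piP.
Qed.

Let tau_quot_open_bigU (J : Type) (f : J -> set tau_quot) :
  (forall i, tau_quot_open (f i)) -> tau_quot_open (\bigcup_i f i).
Proof.
move=> of_.
have /choice[U fU] i : exists U : set tau_op, open U /\ quot_pi F @` U = f i.
  by have [U oU fU] := of_ i; exists U.
exists (\bigcup_i U i).
  by apply: bigcup_open => i _; have [] := fU i.
by rewrite image_bigcup; apply: eq_bigcupr => i _; have [] := fU i.
Qed.

HB.instance Definition _ := isOpenTopological.Build tau_quot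
  tau_quot_openT tau_quot_openI tau_quot_open_bigU.

End uniform_convergence_on_separable_subspaces.

(* Over K = R[i] the coefficients of convex_set range over {i01 K}; as z <= w in
   R[i] forces z and w to have the same imaginary part, these are the reals of
   [0, 1]. *)
Definition convex_hull (K : numDomainType) (E : lmodType K) (A : set E) : set E :=
  smallest (@convex_set K E) A.

Definition isometry_group (K : numDomainType) (X : normedModType K) :
    set {linear X -> X} :=
  [set T | (forall x, `|T x| = `|x|) /\ (forall y, exists x, T x = y)].

Definition orbit_hull (K : numDomainType) (X : normedModType K) (x : X) : set X :=
  convex_hull [set T x | T in @isometry_group K X].

Definition convex_transitive (K : numDomainType) (X : normedModType K) : Prop :=
  forall x : X, `|x| = 1 -> closure (orbit_hull x) = [set y | `|y| <= 1].

(* The isometries, the unit sphere and the unit ball are those of the quotient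
   norm; only the closure is taken for the quotient of tau. *)
Definition tau_convex_transitive (R : realType) (X : normedModType R[i])
    (F : closed_subspace (bounded_op X)) : Prop :=
  forall x : quot_space F, `|x| = 1 ->
    @closure (tau_quot F) (orbit_hull x) = [set y | `|y| <= 1].

(* The order type omega_1: an uncountable well-order all of whose initial segments
   are countable; it is unique up to isomorphism. *)
Definition omega1_order (I : eqType) (r : rel I) : Prop :=
  [/\ wochoice.well_order r, ~ countable [set: I] &
      forall i, countable [set j | r j i]].

Lemma omega1_exists : exists (I : choiceType) (r : rel I), omega1_order r.
Proof.
have [le le_wo] := wochoice.well_ordering_principle (set nat : eqType).
have pair_wo x y : exists z, [/\ z = x \/ z = y, le z x & le z y] /\
    forall t, (t = x \/ t = y) -> le t x -> le t y -> z = t.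
  have [|z [[zxy lz] zu]] := le_wo (mem [set x; y]).
    by exists x; rewrite inE; left.
  rewrite inE in zxy; exists z; split.
    by split => //; apply: lz; rewrite inE; [left|right].
  move=> t txy tx ty; apply: zu; split; first by rewrite inE.
  by move=> u; rewrite inE => -[|] ->.
have le_anti x y : le x y -> le y x -> x = y.
  move=> xy yx.
  have xx : le x x by have [z [[[]-> //]]] := pair_wo x x.
  have yy : le y y by have [z [[[]-> //]]] := pair_wo y y.
  have [z [_ zu]] := pair_wo x y.
  by rewrite -(zu x (or_introl erefl) xx xy) (zu y (or_intror erefl) yx yy).
pose P := [pred x : set nat | `[< countable [set y | le y x] >]].
pose I : choiceType := {x : set nat | P x}.
pose r : rel I := fun i j => le (val i) (val j).
exists I, r; split.
- move=> A [i0 Ai0].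
  pose A' := mem [set val i | i in [set i | i \in A]].
  have [|z [[zA' lz] zu]] := le_wo A'; first by exists (val i0); rewrite inE; exists i0.
  move: zA'; rewrite inE => -[i Ai iz]; exists i; split.
    split => // j Aj; rewrite /r iz; apply: lz.
    by rewrite inE; exists j.
  move=> j [Aj lj]; apply: val_inj; rewrite iz; apply: zu; split.
    by rewrite inE; exists j.
  by move=> x; rewrite inE => -[k Ak <-]; exact: lj.
- move=> cI.
  have cP : countable [set x | P x].
    apply: (@sub_countable _ _ _ (val @` [set: I])).
      by apply: subset_card_le => x Px; exists (exist _ x Px).
    by apply: card_le_trans (card_image_le _ _) _.
  have allP x : P x.
    apply: contrapT => nPx.
    have [|m [[mN lm] _]] := le_wo (mem [set x | ~ P x]); first by exists x; rewrite inE.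
    rewrite inE /= in mN; apply/mN/asboolP.
    apply: (@sub_countable _ _ _ ([set x | P x] `|` [set m])).
      apply: subset_card_le => y ym; have [Py|nPy] := pselect (P y); first by left.
      by right; apply: le_anti => //; apply: lm; rewrite inE.
    rewrite -bigcup2E; apply: bigcup_countable => // -[|[|n]] _ //=.
  have : countable [set: set nat].
    by apply: sub_countable cP; apply: subset_card_le => x _; exact: allP.
  move=> /countable_injP[f finj].
  pose D : set nat := [set n | exists2 A : set nat, f A = n & ~ A n].
  have ND : ~ D (f D).
    move=> DD; have [A fA] := DD; apply.
    by rewrite (finj A D) ?inE.
  by apply: (ND); exists D.
- move=> i; have /asboolP ci := valP i.
  apply: sub_countable ci.
  have -> : ([set j | r j i] #<= [set y | le y (val i)])%card =
      (val @` [set j | r j i] #<= [set y | le y (val i)])%card.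
    by apply: card_le_eql; rewrite card_eq_sym; apply: inj_card_eq => ? ? _ _ /val_inj.
  by apply: subset_card_le => _ [j rji <-].
Qed.

(* Main.v *)
(** Left and right multiplications by unitaries act isometrically on both
    quotients, so the closed convex hull [G] of an orbit is stable under them.
    If [T] has quotient norm 1, then [T] is almost isometric along a large family
    of unit vectors [x_l] with disjoint supports whose images [T x_l] also have
    almost disjoint supports: for separable-range operators one avoids the
    countable set of coordinates linked to the previous choices, for compact
    operators one avoids a finite set up to a summable error. With [X] and [Y] the
    isometries sending the basis to [x_l] and to the normalized images, [T X] is
    close to [Y], and [T X X^*] is the mean of [T] and of [T (2 X X^* - 1)]; so [G]
    almost contains [Y X^*]. Unitaries exchanging orthogonal isometries then
    carry [Y X^*] to [B A^*] for all isometries [A], [B] whose ranges leave a large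
    set of coordinates free, hence [B A^*] belongs to [G].

    A strict contraction [Q] dilates to the two isometries [A' Q +- C D], where
    [D^2 = 1 - Q^* Q], and averaging them yields the compressions of a contraction
    [S] to the complements of large coordinate sets. Averaging over [n] disjoint
    such sets recovers [S] up to an error [O(1/n)].

    For the topology tau only the restriction of [S] to a separable subspace
    matters, and this restriction lives on countably many coordinates. *)
Require Import Defs.
From HB Require Import structures.
From mathcomp Require Import all_boot all_order all_algebra.
From mathcomp Require Import finmap.
From mathcomp Require Import all_classical all_reals all_analysis.
From mathcomp Require Import complex ring lra zify.
Set Implicit Arguments.
Unset Strict Implicit.
Unset Printing Implicit Defensive.
Import Order.TTheory GRing.Theory Num.Theory.
Import numFieldNormedType.Exports.
Local Open Scope classical_set_scope.
Local Open Scope complex_scope.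
Local Open Scope ring_scope.

(** * The real inner product of l^2 *)

(** Only unitaries act on the quotients, and a partial isometry extends to a unitary only if the
    complements match. Every isometry of [ell2 R L] therefore comes with a large set of coordinates
    on which its values vanish: it hosts a third isometry, orthogonal to the two that have to be
    exchanged, and each exchange becomes a self-adjoint unitary given by a formula. This is also why
    compressions occur: a dilation acting on all coordinates would leave no room for the defect
    part. The averages converge because errors on disjoint coordinate sets add up to an operator
    bounded by the contraction itself, whatever their number.

    Both cases run the same argument over a well-founded index set L whose proper initial segments
    preserve small sets under union. For compact operators L is [nat] whatever the cardinal, since
    tau sees countably many coordinates at a time. The inclusion of the closed hull in the unit ball
    is immediate for the norm but not for tau: it amounts to a lower semicontinuity of the quotient
    norm, proved with unit vectors of disjoint finite supports, nearly norming a representative,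
    inside one separable subspace. *)

Section scalars.
Context (R : realType).
Implicit Types (z w : R[i]) (a b : R).

Lemma rnorm_sqE z : rnorm z ^+ 2 = complex.Re z ^+ 2 + complex.Im z ^+ 2.
Proof. by case: z => x y; rewrite /rnorm/= sqr_sqrtr// addr_ge0 ?sqr_ge0. Qed.

Lemma rnorm_real a : rnorm (a%:C) = `|a|.
Proof. by apply: complexI; rewrite -rnormE normc_def/= expr0n/= addr0 sqrtr_sqr. Qed.

Lemma rnorm_real_ge0 a : 0 <= a -> rnorm (a%:C) = a.
Proof. by move=> a0; rewrite rnorm_real ger0_norm. Qed.

Lemma rnorm_inv z : rnorm z^-1 = (rnorm z)^-1.
Proof. by apply: complexI; rewrite -rnormE normfV rnormE fmorphV. Qed.

Lemma rnorm1 : rnorm (1 : R[i]) = 1.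
Proof. by rewrite (_ : 1 = 1%:C) // rnorm_real_ge0. Qed.

Lemma rnorm_i : rnorm ('i : R[i]) = 1.
Proof. by rewrite /rnorm/= expr0n/= add0r expr1n sqrtr1. Qed.

Lemma rnorm_nat n : rnorm (n%:R : R[i]) = n%:R.
Proof. by rewrite -(rmorph_nat (real_complex R)) rnorm_real_ge0. Qed.

Lemma rnorm_half : rnorm (2^-1 : R[i]) = 2^-1.
Proof. by rewrite rnorm_inv rnorm_nat. Qed.

End scalars.

Section inner_product.
Context (R : realType) (I : choiceType).
Local Notation H := (ell2 R I).
Implicit Types f g h : H.

Lemma sqsum_rnorm f : sqsum f = (rnorm f ^+ 2)%:E.
Proof.
have := ell2_subproof f; rewrite inE/=; have := sqsum_ge0 f.
rewrite rnorm_ell2 /ell2_norm; case: (sqsum f) => [r| |]//=.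
by rewrite lee_fin => r0 _; rewrite sqr_sqrtr.
Qed.

(** Sums of nonnegative terms over the index set are additive without any summability argument. Each
    identity between squared norms is therefore arranged with nonnegative terms on both sides and
    checked at one coordinate. *)
Lemma rnorm_sq_additive (s t : seq H) :
  (forall i, \sum_(f <- s) rnorm (f i) ^+ 2 = \sum_(f <- t) rnorm (f i) ^+ 2) ->
  \sum_(f <- s) rnorm f ^+ 2 = \sum_(f <- t) rnorm f ^+ 2.
Proof.
move=> st.
have E (u : seq H) : (\sum_(f <- u) rnorm f ^+ 2)%:E =
    \esum_(i in [set: I]) (\sum_(f <- u) rnorm (f i) ^+ 2)%:E.
  rewrite -sumEFin; under eq_bigr do rewrite -sqsum_rnorm.
  rewrite -esum_sum; last by move=> *; rewrite lee_fin sqr_ge0.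
  by apply: eq_esum => i _; rewrite sumEFin.
by apply: EFin_inj; rewrite !E; apply: eq_esum => i _; rewrite st.
Qed.

Lemma le_rnorm_coord f g : (forall i, rnorm (f i) <= rnorm (g i)) -> rnorm f <= rnorm g.
Proof.
move=> fg; rewrite rnorm_ell2; apply/ell2_norm_le; first exact: rnorm_ge0.
move=> A; apply: le_trans (ell2_sum_le g A).
by apply: ler_sum => i _; rewrite ler_pXn2r ?nnegrE ?rnorm_ge0.
Qed.

(* Real part of the inner product, by polarization: it depends on the norm only,
   so isometries preserve it. *)
Definition ip f g : R := (rnorm (f + g) ^+ 2 - rnorm f ^+ 2 - rnorm g ^+ 2) / 2.

Lemma ipC f g : ip f g = ip g f.
Proof. by rewrite /ip [g + f]addrC; congr (_ / _); rewrite addrAC. Qed.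

Lemma ipE f : ip f f = rnorm f ^+ 2.
Proof.
by rewrite /ip -mulr2n -scaler_nat rnormZ rnorm_nat; field.
Qed.

(** Additivity of the polarized form is the identity |f+g+h|^2 + |f|^2 + |g|^2 + |h|^2 = |f+g|^2 +
    |g+h|^2 + |f+h|^2, which holds for scalars. *)
Lemma ipDl f g h : ip (f + g) h = ip f h + ip g h.
Proof.
rewrite /ip -mulrDl; congr (_ / _).
have /rnorm_sq_additive : forall i, \sum_(u <- [:: f + g + h; f; g; h]) rnorm (u i) ^+ 2 =
    \sum_(u <- [:: f + g; g + h; f + h]) rnorm (u i) ^+ 2.
  move=> i; rewrite !big_cons !big_nil.
  change (rnorm (f i + g i + h i) ^+ 2 + (rnorm (f i) ^+ 2 + (rnorm (g i) ^+ 2 +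
    (rnorm (h i) ^+ 2 + 0))) =
    rnorm (f i + g i) ^+ 2 + (rnorm (g i + h i) ^+ 2 + (rnorm (f i + h i) ^+ 2 + 0))).
  by case: (f i) (g i) (h i) => ? ? [? ?] [? ?]; rewrite !rnorm_sqE/=; ring.
rewrite !big_cons !big_nil.
have aux (a b c p q r s : R) : p + (a + (b + (c + 0))) = q + (r + (s + 0)) ->
  p - q - c = s - a - c + (r - b - c) by lra.
exact: aux.
Qed.

Lemma ip0l f : ip 0 f = 0.
Proof. by apply: (addrI (ip 0 f)); rewrite -ipDl !addr0. Qed.

Lemma ipNl f g : ip (- f) g = - ip f g.
Proof. by apply/eqP; rewrite -addr_eq0 -ipDl addNr ip0l. Qed.

Lemma ipDr f g h : ip h (f + g) = ip h f + ip h g.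
Proof. by rewrite ipC ipDl !(ipC h). Qed.

Lemma ip0r f : ip f 0 = 0. Proof. by rewrite ipC ip0l. Qed.

Lemma ipNr f g : ip f (- g) = - ip f g.
Proof. by rewrite ipC ipNl ipC. Qed.

Lemma ipBl f g h : ip (f - g) h = ip f h - ip g h.
Proof. by rewrite ipDl ipNl. Qed.

Lemma ipBr f g h : ip h (f - g) = ip h f - ip h g.
Proof. by rewrite ipDr ipNr. Qed.

Let ipZl_ge0 (t : R) f g : 0 <= t -> ip (t%:C *: f) g = t * ip f g.
Proof.
move=> t0; rewrite /ip mulrA; congr (_ / _).
(* Scaling by the square root turns the weight t |f|^2 into a squared norm, the only kind of term
   that [rnorm_sq_additive] accepts. *)
have sE : rnorm (Num.sqrt t)%:C ^+ 2 = t by rewrite rnorm_real_ge0 ?sqrtr_ge0// sqr_sqrtr.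
have /rnorm_sq_additive : forall i,
    \sum_(u <- [:: t%:C *: f + g; (Num.sqrt t)%:C *: f; (Num.sqrt t)%:C *: g]) rnorm (u i) ^+ 2 =
    \sum_(u <- [:: t%:C *: f; g; (Num.sqrt t)%:C *: (f + g)]) rnorm (u i) ^+ 2.
  move=> i; rewrite !big_cons !big_nil.
  change (rnorm (t%:C * f i + g i) ^+ 2 + (rnorm ((Num.sqrt t)%:C * f i) ^+ 2 +
    (rnorm ((Num.sqrt t)%:C * g i) ^+ 2 + 0)) =
    rnorm (t%:C * f i) ^+ 2 + (rnorm (g i) ^+ 2 +
    (rnorm ((Num.sqrt t)%:C * (f i + g i)) ^+ 2 + 0))).
  rewrite [rnorm ((Num.sqrt t)%:C * f i)]rnormM [rnorm ((Num.sqrt t)%:C * g i)]rnormM.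
  rewrite [rnorm ((Num.sqrt t)%:C * _)]rnormM !exprMn sE.
  by case: (f i) (g i) => a b [c d]; rewrite !rnorm_sqE/=; ring.
rewrite !big_cons !big_nil ![rnorm ((Num.sqrt t)%:C *: _)]rnormZ !exprMn sE.
have aux (a b p q r : R) : p + (t * a + (t * b + 0)) = q + (b + (t * r + 0)) ->
  p - q - b = t * (r - a - b) by clear; lra.
exact: aux.
Qed.

Lemma ipZl (t : R) f g : ip (t%:C *: f) g = t * ip f g.
Proof.
have [t0|/ltW t0] := leP 0 t; first exact: ipZl_ge0.
by rewrite -[t]opprK rmorphN scaleNr ipNl ipZl_ge0 ?oppr_ge0// !mulNr.
Qed.

Lemma ipZr (t : R) f g : ip f (t%:C *: g) = t * ip f g.
Proof. by rewrite ipC ipZl ipC. Qed.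

(** Multiplication by i is an isometry of square -1, hence skew for [ip]. This is how the real form
    remembers the complex structure, and it makes the adjoint complex linear. *)
Lemma ip_conj (c : R[i]) f g : ip (c *: f) g = ip f (c^* *: g).
Proof.
have ip_i u v : ip ('i%C *: u) v = - ip u ('i%C *: v).
  have : ip ('i%C *: u) ('i%C *: ('i%C *: v)) = ip u ('i%C *: v).
    by rewrite /ip -scalerDr ![rnorm ('i%C *: _)]rnormZ rnorm_i !mul1r.
  rewrite scalerA -expr2 sqr_i scaleN1r ipNr => <-.
  by rewrite opprK.
have -> : c = (complex.Re c)%:C + (complex.Im c)%:C * 'i%C.
  by case: c => a b; rewrite mulrC complexiE -complexE.
have -> : ((complex.Re c)%:C + (complex.Im c)%:C * 'i%C)^* =
          (complex.Re c)%:C - (complex.Im c)%:C * 'i%C.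
  rewrite rmorphD rmorphM/=.
  by rewrite -mulrN; congr (_ + _ * _); apply/eqP; rewrite eq_complex/= ?oppr0 ?eqxx.
rewrite !scalerDl scaleNr -!scalerA ipDl ipBr !ipZl !ipZr ip_i; lra.
Qed.

Lemma ip_le f g : ip f g <= rnorm f * rnorm g.
Proof.
have [g0|g0] := eqVneq (rnorm g) 0.
  by rewrite (rnorm0_eq0 g0) ip0r rnorm0 mulr0.
have gp : 0 < rnorm g by rewrite lt_neqAle eq_sym g0 rnorm_ge0.
have [f0|f0] := eqVneq (rnorm f) 0.
  by rewrite (rnorm0_eq0 f0) ip0l rnorm0 mul0r.
have fp : 0 < rnorm f by rewrite lt_neqAle eq_sym f0 rnorm_ge0.
have := sqr_ge0 (rnorm ((rnorm g)%:C *: f - (rnorm f)%:C *: g)).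
rewrite -ipE ipBl !ipBr !ipZl !ipZr !ipE (ipC g f) => h.
have : 0 <= 2 * (rnorm f * rnorm g) * (rnorm f * rnorm g - ip f g).
  by apply: le_trans h _; rewrite le_eqVlt; apply/orP; left; apply/eqP; ring.
by rewrite pmulr_rge0 ?subr_ge0// !mulr_gt0.
Qed.

Lemma ip_inj f g : (forall h, ip h f = ip h g) -> f = g.
Proof.
move=> fg; apply/eqP; rewrite -subr_eq0; apply/eqP/rnorm0_eq0/eqP.
by rewrite -sqrf_eq0 -ipE ipBr fg subrr.
Qed.

End inner_product.

(** * Bounded linear maps, coordinates and adjoints *)

(** [bounded_op] consists of endomorphisms, whereas the isometries below go from [ell2 R L] to
    [ell2 R I]. The bound stays existential, since no norm is put on these maps. *)
Record bmap (R : realType) (V W : normedModType R[i]) := BMap {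
  bmap_fun :> V -> W ;
  bmap_linear : linear bmap_fun ;
  bmap_bounded : exists2 M : R, 0 <= M & forall x, rnorm (bmap_fun x) <= M * rnorm x }.

HB.instance Definition _ (R : realType) (V W : normedModType R[i]) (f : bmap V W) :=
  GRing.isLinear.Build R[i] V W *:%R (bmap_fun f) (@bmap_linear R V W f).

Section bmap_operations.
Context (R : realType) (U V W : normedModType R[i]).

Let id_linear : linear (@id V). Proof. by []. Qed.

Let id_bounded : exists2 M : R, 0 <= M & forall x : V, rnorm x <= M * rnorm x.
Proof. by exists 1 => // x; rewrite mul1r. Qed.

Definition bid : bmap V V := BMap id_linear id_bounded.

Let comp_linear (g : bmap V W) (f : bmap U V) : linear (g \o f).
Proof. by move=> a x y /=; rewrite !linearP. Qed.

Let comp_bounded (g : bmap V W) (f : bmap U V) :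
  exists2 M : R, 0 <= M & forall x, rnorm ((g \o f) x) <= M * rnorm x.
Proof.
have [M M0 gM] := bmap_bounded g; have [N N0 fN] := bmap_bounded f.
exists (M * N); first exact: mulr_ge0.
by move=> x; rewrite (le_trans (gM _))// -mulrA ler_wpM2l.
Qed.

Definition bcomp (g : bmap V W) (f : bmap U V) : bmap U W :=
  BMap (comp_linear g f) (comp_bounded g f).

Let lin_linear (a : R[i]) (f g : bmap U V) : linear (fun x => f x + a *: g x).
Proof.
by move=> b x y; rewrite !linearP/= !scalerDr !scalerA mulrC addrACA.
Qed.

Let lin_bounded (a : R[i]) (f g : bmap U V) :
  exists2 M : R, 0 <= M & forall x, rnorm (f x + a *: g x) <= M * rnorm x.
Proof.
have [M M0 fM] := bmap_bounded f; have [N N0 gN] := bmap_bounded g.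
exists (M + rnorm a * N); first by rewrite addr_ge0// mulr_ge0// rnorm_ge0.
move=> x; rewrite (le_trans (rnormD _ _))// mulrDl lerD// rnormZ -mulrA.
by rewrite ler_wpM2l// rnorm_ge0.
Qed.

Definition blin (a : R[i]) (f g : bmap U V) : bmap U V :=
  BMap (lin_linear a f g) (lin_bounded a f g).

End bmap_operations.
Arguments bid {R V}.

Section bounded_op_bmap.
Context (R : realType) (X : normedModType R[i]).

Let op_bounded (f : bmap X X) : (f : X -> X) \in @bounded_linear R X.
Proof. by apply/bounded_linearP; split; [exact: bmap_linear|exact: bmap_bounded]. Qed.

Definition op_of_bmap (f : bmap X X) : bounded_op X := BoundedOp (op_bounded f).

Let bmap_of_op_bounded (T : bounded_op X) :
  exists2 M : R, 0 <= M & forall x, rnorm (T x) <= M * rnorm x.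
Proof. by have /bounded_linearP[] := bounded_op_subproof T. Qed.

Definition bmap_of_op (T : bounded_op X) : bmap X X :=
  BMap (@bounded_op_linear R X T) (bmap_of_op_bounded T).

Lemma bounded_opP (S T : bounded_op X) : (forall x, S x = T x) -> S = T.
Proof. by move=> ST; apply: val_inj; apply/funext. Qed.

End bounded_op_bmap.

Section coordinates.
Context (R : realType) (I : choiceType).
Local Notation H := (ell2 R I).
Implicit Types (f g : H) (D : set I).

Lemma ell2P f g : (forall i, f i = g i) -> f = g.
Proof. by move=> fg; apply: val_inj; apply/funext. Qed.

Lemma ell2_sumE (K : Type) (s : seq K) (F : K -> H) i :
  (\sum_(k <- s) F k) i = \sum_(k <- s) F k i.
Proof. by elim/big_rec2: _ => // k y x _ <-. Qed.

Lemma esum_single (K : choiceType) (a : K -> \bar R) k0 :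
  (0 <= a k0)%E -> (forall k, k != k0 -> a k = 0%E) -> (\esum_(k in [set: K]) a k = a k0)%E.
Proof.
move=> a0 ak; rewrite -[RHS](esum_set1 a0) [RHS]esum_mkcond.
apply: eq_esum => k _; case: ifPn => //; rewrite notin_setE => /eqP; exact: ak.
Qed.

Definition delta_fun (i : I) (z : R[i]) : I -> R[i] := fun j => if j == i then z else 0.

Let delta_sqsum i z : sqsum (delta_fun i z) = (rnorm z ^+ 2)%:E.
Proof.
rewrite /sqsum (esum_single (k0 := i)) /delta_fun ?eqxx//.
  by rewrite lee_fin sqr_ge0.
by move=> k /negbTE ->; rewrite rnorm0 expr0n.
Qed.

Let delta_subproof i z : delta_fun i z \in @ell2_pred R I.
Proof. by rewrite inE/= delta_sqsum ltry. Qed.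

Definition delta i z : H := Ell2 (delta_subproof i z).

Lemma deltaE i z j : delta i z j = if j == i then z else 0.
Proof. by []. Qed.

Lemma rnorm_delta i z : rnorm (delta i z) = rnorm z.
Proof.
apply/eqP; rewrite -(@eqrXn2 _ 2)// ?rnorm_ge0//; apply/eqP/EFin_inj.
by rewrite -sqsum_rnorm delta_sqsum.
Qed.

Lemma deltaD i z w : delta i (z + w) = delta i z + delta i w.
Proof.
apply: ell2P => j; change (delta i (z + w) j = delta i z j + delta i w j).
by rewrite !deltaE; case: eqP => //; rewrite addr0.
Qed.

Lemma deltaZ i z w : delta i (z * w) = z *: delta i w.
Proof.
apply: ell2P => j; change (delta i (z * w) j = z * delta i w j).
by rewrite !deltaE; case: eqP => //; rewrite mulr0.
Qed.

Lemma ip_delta i z g : ip (delta i z) g = complex.Re (z * (g i)^*).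
Proof.
(* The vectors [delta i z + g] and [g] differ at coordinate [i] only, and the two added deltas
   compensate for that difference. *)
have /rnorm_sq_additive : forall j,
    \sum_(u <- [:: delta i z + g; delta i (g i)]) rnorm (u j) ^+ 2 =
    \sum_(u <- [:: g; delta i (z + g i)]) rnorm (u j) ^+ 2.
  move=> j; rewrite !big_cons !big_nil.
  change (rnorm (delta i z j + g j) ^+ 2 + (rnorm (delta i (g i) j) ^+ 2 + 0) =
    rnorm (g j) ^+ 2 + (rnorm (delta i (z + g i) j) ^+ 2 + 0)).
  rewrite !deltaE; case: eqP => [->|_]; first by ring.
  by rewrite add0r.
rewrite !big_cons !big_nil !rnorm_delta.
have aux (a b c d e : R) : a + (b + 0) = c + (d + 0) -> (a - e - c) / 2 = (d - b - e) / 2.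
  by move=> h; congr (_ / _); lra.
move=> /aux h; rewrite /ip rnorm_delta h.
by case: z (g i) {h} => a b [c d]; rewrite !rnorm_sqE/=; field.
Qed.

Lemma coord_eq0 f i : (forall z, ip (delta i z) f = 0) -> f i = 0.
Proof.
move=> /(_ (f i)); rewrite ip_delta; case: (f i) => a b /= ab.
have {ab} : a ^+ 2 + b ^+ 2 = 0 by rewrite -ab; ring.
by move=> /eqP; rewrite paddr_eq0 ?sqr_ge0// !sqrf_eq0 => /andP[/eqP -> /eqP ->].
Qed.

Lemma ip_disjoint f g : (forall i, f i = 0 \/ g i = 0) -> ip f g = 0.
Proof.
move=> fg.
have /rnorm_sq_additive : forall i,
    \sum_(u <- [:: f + g]) rnorm (u i) ^+ 2 = \sum_(u <- [:: f; g]) rnorm (u i) ^+ 2.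
  move=> i; rewrite !big_cons !big_nil.
  change (rnorm (f i + g i) ^+ 2 + 0 = rnorm (f i) ^+ 2 + (rnorm (g i) ^+ 2 + 0)).
  have z0 : rnorm (0 : R[i]) ^+ 2 = 0 by rewrite rnorm0 expr0n.
  by case: (fg i) => ->; rewrite z0 !(add0r, addr0).
rewrite !big_cons !big_nil.
have aux (a b c : R) : a + 0 = b + (c + 0) -> (a - b - c) / 2 = 0.
  by move=> h; rewrite (_ : a - b - c = 0) ?mul0r//; lra.
exact: aux.
Qed.

Lemma rnorm_sqD f g : rnorm (f + g) ^+ 2 = rnorm f ^+ 2 + rnorm g ^+ 2 + 2 * ip f g.
Proof. by rewrite /ip; move: (rnorm _ ^+ _) (rnorm f ^+ _) (rnorm g ^+ _) => a b c; field. Qed.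

Definition pr_fun D f : I -> R[i] := fun i => if i \in D then f i else 0.

Let pr_subproof D f : pr_fun D f \in @ell2_pred R I.
Proof.
rewrite inE/=; apply: le_lt_trans (_ : (rnorm f ^+ 2)%:E < +oo)%E; last by rewrite ltry.
rewrite -sqsum_rnorm; apply: le_esum => i _; rewrite lee_fin /pr_fun.
by case: ifP => // _; rewrite rnorm0 expr0n sqr_ge0.
Qed.

Definition pr_ell2 D f : H := Ell2 (pr_subproof D f).

Lemma pr_ell2E D f i : pr_ell2 D f i = if i \in D then f i else 0.
Proof. by []. Qed.

Let pr_linear D : linear (pr_ell2 D).
Proof.
move=> a f g; apply: ell2P => i.
change (pr_ell2 D (a *: f + g) i = a * pr_ell2 D f i + pr_ell2 D g i).
by rewrite !pr_ell2E; case: ifP => // _; rewrite mulr0 addr0.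
Qed.

Let pr_le D f : rnorm (pr_ell2 D f) <= rnorm f.
Proof.
apply: le_rnorm_coord => i; rewrite pr_ell2E; case: ifP => // _.
by rewrite rnorm0 rnorm_ge0.
Qed.

Let pr_bounded D : exists2 M : R, 0 <= M & forall f, rnorm (pr_ell2 D f) <= M * rnorm f.
Proof. by exists 1 => // f; rewrite mul1r. Qed.

Definition pr D : bmap H H := BMap (@pr_linear D) (pr_bounded D).

Lemma prE D f i : pr D f i = if i \in D then f i else 0.
Proof. by []. Qed.

Lemma rnorm_pr D f : rnorm (pr D f) <= rnorm f.
Proof. exact: pr_le. Qed.

Lemma pr_id D f : (forall i, ~ D i -> f i = 0) -> pr D f = f.
Proof.
move=> fD; apply: ell2P => i; rewrite prE; case: ifPn => //.
by rewrite notin_setE => /fD.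
Qed.

Lemma pr_setC D f : f - pr D f = pr (~` D) f.
Proof.
apply: ell2P => i; change (f i - pr D f i = pr (~` D) f i).
by rewrite !prE in_setC; case: ifP => _; rewrite ?subrr ?subr0.
Qed.

Lemma pr_notin D f i : ~ D i -> pr D f i = 0.
Proof. by rewrite prE => Di; rewrite memNset. Qed.

Lemma pr_in D f i : D i -> pr D f i = f i.
Proof. by rewrite prE => Di; rewrite mem_set. Qed.

Lemma pr_fsetE (A : {fset I}) f : pr [set` A] f = \sum_(i <- A) delta i (f i).
Proof.
apply: ell2P => j; rewrite ell2_sumE prE; case: ifPn => [|]; rewrite ?notin_setE ?inE.
  move=> jA; rewrite (big_fsetD1 j jA) deltaE eqxx big1_seq => [|i]; first by rewrite /= addr0.
  by rewrite !inE => /andP[_ /andP[/negbTE ij _]]; rewrite deltaE eq_sym ij.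
move=> jA; rewrite big_seq big1// => i iA; rewrite deltaE.
by case: eqP => // ji; case: jA; rewrite ji.
Qed.

Lemma rnorm_pr_sq (A : {fset I}) f :
  rnorm (pr [set` A] f) ^+ 2 = \sum_(i <- A) rnorm (f i) ^+ 2.
Proof.
apply: EFin_inj; rewrite -sqsum_rnorm -sumEFin.
transitivity (\esum_(i in [set` A]) (rnorm (f i) ^+ 2)%:E)%E; last first.
  rewrite esum_fset; first by rewrite fsbig_finite//= set_fsetK.
    exact: finite_fset.
  by move=> i _; rewrite lee_fin sqr_ge0.
rewrite esum_mkcond; apply: eq_esum => i _; rewrite prE.
by case: ifP => // _; rewrite rnorm0 expr0n.
Qed.

Lemma rnorm_sq_pr D f : rnorm f ^+ 2 = rnorm (pr D f) ^+ 2 + rnorm (f - pr D f) ^+ 2.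
Proof.
have z : ip (pr D f) (f - pr D f) = 0.
  rewrite pr_setC; apply: ip_disjoint => i; rewrite !prE in_setC.
  by case: ifP; [right|left].
by have := rnorm_sqD (pr D f) (f - pr D f); rewrite addrC subrK z mulr0 addr0.
Qed.

(** Otherwise all finite sums, and hence |f|^2 itself, would be at most |f|^2 - e^2. *)
Lemma ell2_tail f (e : R) : 0 < e -> exists A : {fset I}, rnorm (f - pr [set` A] f) < e.
Proof.
move=> e0; apply: contrapT => /forallNP noA.
have leA (A : {fset I}) : \sum_(i <- A) rnorm (f i) ^+ 2 <= rnorm f ^+ 2 - e ^+ 2.
  rewrite -rnorm_pr_sq (rnorm_sq_pr [set` A] f).
  have : e ^+ 2 <= rnorm (f - pr [set` A] f) ^+ 2.
    have ef : e <= rnorm (f - pr [set` A] f) by rewrite leNgt; exact/negP/noA.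
    by rewrite ler_pXn2r// nnegrE ?rnorm_ge0// ltW.
  by rewrite -addrA lerDl subr_ge0.
have := leA fset0; rewrite big_seq_fset0 => ef.
have : rnorm f <= Num.sqrt (rnorm f ^+ 2 - e ^+ 2).
  rewrite rnorm_ell2; apply/ell2_norm_le; first exact: sqrtr_ge0.
  by move=> A; rewrite sqr_sqrtr.
rewrite -(@ler_pXn2r _ 2)// ?nnegrE ?rnorm_ge0 ?sqrtr_ge0// (sqr_sqrtr ef).
by rewrite lerDl oppr_ge0 leNgt exprn_gt0.
Qed.

(** Since [phi] is only real linear, its values at e_i and i e_i give the real and imaginary parts
    of the coordinate of g. Testing [phi] on a truncation h of g gives |h|^2 <= M |h|, hence square
    summability; equality then passes from finite supports to all of l^2 by boundedness. *)
Lemma riesz (phi : H -> R) (M : R) : 0 <= M ->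
  (forall f g, phi (f + g) = phi f + phi g) ->
  (forall (t : R) f, phi (t%:C *: f) = t * phi f) ->
  (forall f, phi f <= M * rnorm f) -> exists g, forall f, phi f = ip f g.
Proof.
move=> M0 phiD phiZ phiM.
pose gf i : R[i] := Complex (phi (delta i 1)) (phi (delta i 'i%C)).
have phi_delta i z : phi (delta i z) = complex.Re (z * (gf i)^*).
  have {1}-> : z = (complex.Re z)%:C + (complex.Im z)%:C * 'i%C.
    by case: z => a b; rewrite mulrC complexiE -complexE.
  rewrite deltaD -[X in delta i X + _]mulr1 !deltaZ phiD !phiZ.
  by case: z => a b /=; ring.
have phi0 : phi 0 = 0 by apply: (addrI (phi 0)); rewrite -phiD !addr0.
have phi_sum (A : {fset I}) f : phi (pr [set` A] f) = \sum_(i <- A) phi (delta i (f i)).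
  rewrite pr_fsetE; elim/big_rec2: _ => // i x y _ <-; exact: phiD.
have gP : gf \in @ell2_pred R I.
  apply/ell2_predP; exists M => // A.
  pose h : H := \sum_(i <- A) delta i (gf i).
  have hA i : i \in A -> h i = gf i.
    move=> iA; rewrite ell2_sumE (big_fsetD1 i iA) deltaE eqxx.
    rewrite big1_seq => [|j]; first by rewrite /= addr0.
    by rewrite !inE => /andP[_ /andP[/negbTE ij _]]; rewrite deltaE eq_sym ij.
  have hpr : pr [set` A] h = h.
    rewrite pr_fsetE; apply: eq_big_seq => i iA; congr delta; exact: hA.
  have hn : rnorm h ^+ 2 = \sum_(i <- A) rnorm (gf i) ^+ 2.
    rewrite -hpr rnorm_pr_sq; apply: eq_big_seq => i iA; rewrite hA//.
  have : phi h = rnorm h ^+ 2.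
    rewrite hn -hpr phi_sum; apply: eq_big_seq => i iA; rewrite phi_delta hA//.
    by rewrite rnorm_sqE; case: (gf i) => a b /=; ring.
  rewrite -hn => /esym hE.
  have [h0|h0] := eqVneq (rnorm h) 0; first by rewrite h0 expr0n/= sqr_ge0.
  have hp : 0 < rnorm h by rewrite lt_neqAle eq_sym h0 rnorm_ge0.
  have := phiM h; rewrite -hE expr2 ler_pM2r// => hM.
  by rewrite [leRHS]expr2 ler_pM ?rnorm_ge0.
exists (Ell2 gP) => f; apply/eqP; rewrite -subr_eq0; apply/eqP.
set g := Ell2 gP.
have fin (A : {fset I}) : phi (pr [set` A] f) = ip (pr [set` A] f) g.
  rewrite phi_sum pr_fsetE.
  elim/big_rec2: _ => [|i x y _ ->]; first by rewrite ip0l.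
  by rewrite ipDl; congr (_ + _); rewrite phi_delta ip_delta.
have phiN u : phi (- u) = - phi u.
  by apply/eqP; rewrite -addr_eq0 -phiD addNr phi0.
have bnd u : `|phi u - ip u g| <= (M + rnorm g) * rnorm u.
  have h v : phi v - ip v g <= (M + rnorm g) * rnorm v.
    rewrite mulrDl; apply: lerD; first exact: phiM.
    by rewrite -ipNl -[rnorm v]rnormN mulrC; exact: ip_le.
  have := h (- u); rewrite phiN ipNl rnormN opprK addrC => hN.
  by rewrite ler_norml (h u) andbT lerNl opprB.
apply/eqP; rewrite -normr_le0; apply/ler_addgt0Pr => e e0; rewrite add0r.
have M1 : 0 < M + rnorm g + 1 by rewrite ltr_wpDl// addr_ge0// rnorm_ge0.
have [|A fA] := @ell2_tail f (e / (M + rnorm g + 1)); first by rewrite divr_gt0.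
have -> : phi f - ip f g = phi (f - pr [set` A] f) - ip (f - pr [set` A] f) g.
  by rewrite ipBl phiD phiN fin opprB addrA addrNK.
apply: le_trans (bnd _) _; rewrite ltr_pdivlMr// in fA.
apply: le_trans (ltW fA); rewrite mulrC ler_wpM2l ?rnorm_ge0// lerDl//.
Qed.

End coordinates.
Arguments pr {R I} D : simpl never.
Arguments delta {R I} i z : simpl never.

Section adjoint.
Context (R : realType) (I J : choiceType).
Variable f : bmap (ell2 R I) (ell2 R J).

Lemma adjoint_exists : exists g : bmap (ell2 R J) (ell2 R I), forall x y, ip (f x) y = ip x (g y).
Proof.
have [M M0 fM] := bmap_bounded f.
have /choice[g gP] y : exists g, forall x, ip (f x) y = ip x g.
  apply: (@riesz _ _ (fun x => ip (f x) y) (M * rnorm y)).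
  - by rewrite mulr_ge0// rnorm_ge0.
  - by move=> u v; rewrite linearD ipDl.
  - by move=> t u; rewrite linearZ ipZl.
  - move=> x; apply: le_trans (ip_le _ _) _.
    by rewrite mulrAC ler_wpM2r// rnorm_ge0.
have gl : linear g.
  move=> c u v; apply: ip_inj => x; rewrite ipDr -!gP ipDr.
  congr (_ + _); first by rewrite -[c]conjcK -!ip_conj -linearZ gP.
have gb : exists2 N : R, 0 <= N & forall y, rnorm (g y) <= N * rnorm y.
  exists M => // y; have := ip_le (f (g y)) y; rewrite gP ipE => h.
  have [g0|g0] := eqVneq (rnorm (g y)) 0; first by rewrite g0 mulr_ge0// rnorm_ge0.
  have gp : 0 < rnorm (g y) by rewrite lt_neqAle eq_sym g0 rnorm_ge0.
  rewrite -(ler_pM2l gp) -expr2 (le_trans h)// mulrA ler_wpM2r ?rnorm_ge0//.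
  by rewrite mulrC.
by exists (BMap gl gb).
Qed.

Definition adj : bmap (ell2 R J) (ell2 R I) := sval (cid adjoint_exists).

Lemma ip_adj x y : ip (f x) y = ip x (adj y).
Proof. exact: (svalP (cid adjoint_exists)). Qed.

Lemma ip_adjl x y : ip (adj y) x = ip y (f x).
Proof. by rewrite ipC -ip_adj ipC. Qed.

End adjoint.

(** * Maps defined by families with disjoint supports *)

Section block_maps.
Context (R : realType) (L I : choiceType).

Definition disjoint_family (x : L -> ell2 R I) :=
  forall i l m, x l i != 0 -> x m i != 0 -> l = m.

(** X v is the series of the v_l x_l, defined coordinatewise without summation because each
    coordinate is charged by at most one x_l. Exchanging two nonnegative sums gives |X v|^2 as the
    sum of the |v_l|^2 |x_l|^2. *)
Lemma block_map_exists (x : L -> ell2 R I) (M : R) : 0 <= M ->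
  disjoint_family x -> (forall l, rnorm (x l) <= M) ->
  exists X : bmap (ell2 R L) (ell2 R I),
    [/\ forall v l i, x l i != 0 -> X v i = v l * x l i,
        forall v i, (forall l, x l i = 0) -> X v i = 0,
        forall v, rnorm (X v) <= M * rnorm v &
        (forall l, rnorm (x l) = 1) -> forall v, rnorm (X v) = rnorm v].
Proof.
move=> M0 xd xM.
pose Xf (v : ell2 R L) i : R[i] := if pselect (exists l, x l i != 0) is left h
  then v (sval (cid h)) * x (sval (cid h)) i else 0.
have X1 v l i : x l i != 0 -> Xf v i = v l * x l i.
  move=> xl; rewrite /Xf; case: pselect => [h|[]]; last by exists l.
  by rewrite (xd i _ l (svalP (cid h)) xl).
have X2 v i : (forall l, x l i = 0) -> Xf v i = 0.
  move=> xi; rewrite /Xf; case: pselect => // -[l xl].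
  by exfalso; move: xl; rewrite xi eqxx.
have sq v : sqsum (Xf v) = (\esum_(l in [set: L]) (rnorm (v l *: x l) ^+ 2)%:E)%E.
  pose a (i : I) (l : L) : \bar R := (rnorm (v l * x l i) ^+ 2)%:E.
  have a0 i l : (0 <= a i l)%E by rewrite lee_fin sqr_ge0.
  transitivity (\esum_(i in [set: I]) \esum_(l in [set: L]) a i l)%E.
    apply: eq_esum => i _.
    have [[l xl]|nx] := pselect (exists l, x l i != 0).
      rewrite (esum_single (k0 := l))// /a ?(X1 _ l)//.
      move=> m ml; have [xm|] := eqVneq (x m i) 0; first by rewrite xm mulr0 rnorm0 expr0n.
      by move=> /(xd i _ _)/(_ xl) mE; rewrite mE eqxx in ml.
    have xi l : x l i = 0 by apply/eqP/negPn/negP => xl; apply: nx; exists l.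
    rewrite X2// esum1 => [|l _]; first by rewrite rnorm0 expr0n.
    by rewrite /a xi mulr0 rnorm0 expr0n.
  rewrite esum_esum//.
  rewrite (reindex_esum ([set: L] `*` [set: I]) _ (fun p => (p.2, p.1)))//; last first.
    by split => [p _|[a1 b1] [a2 b2] _ _ [-> ->]//|[p q] _]//; exists (q, p).
  rewrite -(@esum_esum _ _ _ [set: L] (fun=> [set: I]) (fun l i => a i l))//.
  by apply: eq_esum => l _; rewrite -sqsum_rnorm.
have le v : (sqsum (Xf v) <= ((M * rnorm v) ^+ 2)%:E)%E.
  rewrite sq exprMn mulrC.
  have -> : (rnorm v ^+ 2 * M ^+ 2)%:E = (rnorm (M%:C *: v) ^+ 2)%:E.
    by rewrite rnormZ exprMn rnorm_real_ge0// mulrC.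
  rewrite -sqsum_rnorm; apply: le_esum => l _; rewrite lee_fin.
  rewrite ler_pXn2r ?nnegrE ?rnorm_ge0//.
  change (rnorm (v l *: x l) <= rnorm (M%:C * v l)).
  by rewrite rnormZ rnormM rnorm_real_ge0// mulrC ler_wpM2r ?rnorm_ge0.
have XP v : Xf v \in @ell2_pred R I.
  by rewrite inE/=; apply: le_lt_trans (le v) _; rewrite ltry.
have Xlin : linear (fun v => Ell2 (XP v)).
  move=> c v w; apply: ell2P => i.
  change (Xf (c *: v + w) i = c * Xf v i + Xf w i).
  have [[l xl]|nx] := pselect (exists l, x l i != 0).
    rewrite !(X1 _ l)// mulrA -mulrDl//.
  have xi l : x l i = 0 by apply/eqP/negPn/negP => xl; apply: nx; exists l.
  by rewrite !X2// mulr0 addr0.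
have Xle v : rnorm (Ell2 (XP v)) <= M * rnorm v.
  rewrite -(@ler_pXn2r _ 2)// ?nnegrE ?mulr_ge0 ?rnorm_ge0//.
  by rewrite -lee_fin -sqsum_rnorm; exact: le.
exists (BMap Xlin (ex_intro2 _ _ M M0 Xle)); split => // x1 v.
apply/eqP; rewrite -(@eqrXn2 _ 2)// ?rnorm_ge0//; apply/eqP/EFin_inj.
rewrite -!sqsum_rnorm [LHS]sq; apply: eq_esum => l _.
by rewrite rnormZ x1 mulr1.
Qed.

Lemma bmap_fin_le (G : bmap (ell2 R L) (ell2 R I)) (C : R) :
  (forall (A : {fset L}) v, rnorm (G (pr [set` A] v)) <= C * rnorm v) ->
  forall v, rnorm (G v) <= C * rnorm v.
Proof.
move=> GC v; apply/ler_addgt0Pr => e e0.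
have [M M0 GM] := bmap_bounded G.
have M1 : 0 < M + 1 by rewrite ltr_wpDl.
have [|A vA] := @ell2_tail _ _ v (e / (M + 1)); first by rewrite divr_gt0.
rewrite -[v in G v](subrK (pr [set` A] v)) linearD addrC.
rewrite (le_trans (rnormD _ _))//; apply: lerD; first exact: GC.
rewrite ltr_pdivlMr// in vA; apply: le_trans (GM _) (le_trans _ (ltW vA)).
by rewrite mulrC ler_wpM2l ?rnorm_ge0// lerDl.
Qed.

(** Each |v_l| is at most |v|, so it suffices that the images of the basis vectors are summable in
    norm. *)
Lemma bmap_summable_le (G : bmap (ell2 R L) (ell2 R I)) (err : L -> R) (C : R) :
  (forall A : {fset L}, \sum_(l <- A) err l <= C) ->
  (forall l, rnorm (G (delta l 1)) <= err l) ->
  forall v, rnorm (G v) <= C * rnorm v.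
Proof.
move=> errC Gerr; apply: bmap_fin_le => A v.
apply: (@le_trans _ _ ((\sum_(l <- A) err l) * rnorm v)); last first.
  by rewrite ler_wpM2r ?rnorm_ge0.
rewrite pr_fsetE linear_sum mulr_suml.
elim/big_rec2: _ => [|l x y _ yx]; first by rewrite rnorm0.
rewrite (le_trans (rnormD _ _))//; apply: lerD => //.
rewrite -[v l]mulr1 deltaZ linearZ rnormZ mulrC.
by apply: ler_pM; rewrite ?rnorm_ge0//; [exact: Gerr|exact: ell2_coord_le].
Qed.

End block_maps.

(** * Isometries and the defect operator *)

Section geometric_limits.
Context (R : realType).

Lemma exists_geometric_lt (rho C e : R) : 0 <= rho -> rho < 1 -> 0 < e ->
  exists n, C * rho ^+ n < e.
Proof.
move=> r0 r1 e0.
have [C0|C0] := leP C 0.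
  by exists 0%N; rewrite (le_lt_trans _ e0)// expr0 mulr1.
have cv : (fun n => rho ^+ n) @ \oo --> (0 : R) by apply: cvg_expr; rewrite ger0_norm.
have /cvgrPdist_lt/(_ (e / C)) := cv; rewrite divr_gt0// => /(_ erefl)[N _ NP].
exists N; have := NP N (leqnn N); rewrite /= sub0r normrN ger0_norm ?exprn_ge0//.
by rewrite ltr_pdivlMr// mulrC.
Qed.

(** Serves in place of passages to the limit: an identity for the limit of the iterates follows from
    a bound of the defect by C rho^n for every n. *)
Lemma le0_geometric (rho C r : R) : 0 <= rho -> rho < 1 ->
  (forall n, r <= C * rho ^+ n) -> r <= 0.
Proof.
move=> r0 r1 rC; apply/ler_addgt0Pr => e e0; rewrite add0r.
have [n /ltW nC] := @exists_geometric_lt rho C e r0 r1 e0.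
exact: le_trans (rC n) nC.
Qed.

Lemma geometric_limit (I : choiceType) (u : nat -> ell2 R I) (rho K : R) :
  0 <= rho -> rho < 1 -> 0 <= K ->
  (forall n, rnorm (u n.+1 - u n) <= K * rho ^+ n) ->
  exists l, forall n, rnorm (u n - l) <= K / (1 - rho) * rho ^+ n.
Proof.
move=> r0 r1 K0 uK.
have r10 : 0 < 1 - rho by rewrite subr_gt0.
(* Keeping the difference rho^n - rho^(n+k) makes the bound additive along the induction. *)
have ukn n k : rnorm (u n - u (n + k)%N) <= K / (1 - rho) * (rho ^+ n - rho ^+ (n + k)).
  elim: k => [|k IH]; first by rewrite addn0 !subrr rnorm0 mulr0.
  rewrite addnS; apply: le_trans (rnorm_tri _ (u (n + k)%N) _) _.
  rewrite [rnorm (u (n + k)%N - _)]rnormB (le_trans (lerD IH (uK _)))//.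
  rewrite le_eqVlt; apply/orP; left; apply/eqP; rewrite exprS; field.
  by rewrite gt_eqF.
have un n m : (n <= m)%N -> rnorm (u n - u m) <= K / (1 - rho) * rho ^+ n.
  move=> /subnKC <-; apply: le_trans (ukn _ _) _; rewrite ler_wpM2l//.
    by rewrite divr_ge0// ltW.
  by rewrite gerBl exprn_ge0.
have uc : cauchy (u @ \oo).
  apply/cauchyP => e e0.
  have er : e = (complex.Re e)%:C by rewrite RRe_real// gtr0_real.
  have e0' : 0 < complex.Re e by rewrite -ltcR -er.
  have [n nP] := @exists_geometric_lt rho (K / (1 - rho)) _ r0 r1 e0'.
  exists (u n), n => // m nm /=.
  rewrite -ball_normE /= er rnormE ltcR; exact: le_lt_trans (un n m nm) nP.
have cv : u @ \oo --> lim (u @ \oo) by exact: (@cauchy_cvg _ (u @ \oo) _ uc).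
exists (lim (u @ \oo)) => n; apply/ler_addgt0Pr => e e0.
have e0' : 0 < e%:C by rewrite ltcR.
have /cvgrPdist_lt/(_ _ e0')[N _ NP] := cv.
have := NP (maxn n N) (leq_maxr _ _); rewrite /= rnormE ltcR => h.
apply: le_trans (rnorm_tri _ (u (maxn n N)) _) _.
by apply: lerD; [exact: un (leq_maxl _ _)|rewrite rnormB; exact: ltW].
Qed.

End geometric_limits.

Section isometries.
Context (R : realType) (I J : choiceType).
Implicit Types f : bmap (ell2 R I) (ell2 R J).

Definition isometric f := forall x, rnorm (f x) = rnorm x.

Lemma isometric_ip f : isometric f -> forall x y, ip (f x) (f y) = ip x y.
Proof. by move=> ff x y; rewrite /ip -linearD !ff. Qed.

Lemma isometric_adjK f : isometric f -> forall x, adj f (f x) = x.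
Proof. by move=> ff x; apply: ip_inj => h; rewrite -ip_adj isometric_ip. Qed.

Lemma adj_le f (M : R) : 0 <= M -> (forall x, rnorm (f x) <= M * rnorm x) ->
  forall y, rnorm (adj f y) <= M * rnorm y.
Proof.
move=> M0 fM y; have := ip_le (f (adj f y)) y; rewrite ip_adj ipE => h.
have [g0|g0] := eqVneq (rnorm (adj f y)) 0; first by rewrite g0 mulr_ge0// rnorm_ge0.
have gp : 0 < rnorm (adj f y) by rewrite lt_neqAle eq_sym g0 rnorm_ge0.
rewrite -(ler_pM2l gp) -expr2 (le_trans h)// mulrA ler_wpM2r ?rnorm_ge0//.
by rewrite mulrC.
Qed.

Lemma adj_isometric_le f : isometric f -> forall y, rnorm (adj f y) <= rnorm y.
Proof.
move=> ff y; rewrite -[leRHS]mul1r; apply: adj_le => // x.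
by rewrite ff mul1r.
Qed.

End isometries.

Section defect_operator.
Context (R : realType) (L : choiceType).
Local Notation H := (ell2 R L).

(** The zero map, written as id - id. *)
Let bzero : bmap H H := blin (-1) bid bid.

(* [1 - Y] is the square root of [1 - T^* T] when [Y = (T^* T + Y^2) / 2]; the
   iteration of this equation from [0] converges geometrically. *)
Lemma defect_exists (T : bmap H H) (rho : R) : 0 <= rho -> rho < 1 ->
  (forall x, rnorm (T x) <= rho * rnorm x) ->
  exists D : bmap H H, forall x, rnorm (T x) ^+ 2 + rnorm (D x) ^+ 2 = rnorm x ^+ 2.
Proof.
move=> r0 r1 Tr.
pose A : bmap H H := bcomp (adj T) T.
pose Y := fix Y n : bmap H H := if n is m.+1 then
  blin 2^-1 bzero (blin 1 A (bcomp (Y m) (Y m))) else bzero.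
have Y0 x : Y 0%N x = 0 by rewrite /= scaleN1r subrr.
have YS n x : Y n.+1 x = 2^-1 *: (A x + Y n (Y n x)).
  by rewrite /= scaleN1r subrr add0r scale1r.
clearbody Y.
have Ar x : rnorm (A x) <= rho * (rho * rnorm x).
  apply: le_trans (adj_le r0 Tr _) _; rewrite ler_wpM2l//; exact: Tr.
have rx (x : H) : 0 <= rho * rnorm x by rewrite mulr_ge0// rnorm_ge0.
have rrx (x : H) : rho * (rho * rnorm x) <= rho * rnorm x.
  by rewrite ler_wpM2l// -[leRHS]mul1r ler_wpM2r ?rnorm_ge0// ltW.
have half2 (a b c : R) : a <= c -> b <= c -> 2^-1 * (a + b) <= c by move=> *; lra.
have Yr n x : rnorm (Y n x) <= rho * rnorm x.
  elim: n x => [|n IH] x; first by rewrite Y0 rnorm0.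
  rewrite YS rnormZ rnorm_half.
  apply: le_trans (_ : 2^-1 * (rnorm (A x) + rnorm (Y n (Y n x))) <= _).
    by rewrite ler_wpM2l ?invr_ge0// rnormD.
  apply: half2; first exact: le_trans (Ar x) (rrx x).
  by apply: le_trans (IH _) _; apply: le_trans (rrx x); rewrite ler_wpM2l.
have Ysym n x y : ip (Y n x) y = ip x (Y n y).
  elim: n x y => [|n IH] x y; first by rewrite !Y0 ip0l ip0r.
  have two : (2^-1 : R[i]) = (2^-1 : R)%:C by rewrite fmorphV rmorph_nat.
  rewrite !YS two ipZl ipZr ipDl ipDr !IH; congr (_ * (_ + _)).
  by rewrite /= ip_adjl ip_adj.
have Yd n x : rnorm (Y n.+1 x - Y n x) <= rnorm x * rho ^+ n.
  elim: n x => [|n IH] x.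
    rewrite YS !Y0 addr0 subr0 mulr1 rnormZ rnorm_half.
    have aux (a b c : R) : a <= b -> b <= c -> 0 <= c -> 2^-1 * a <= c by move=> *; lra.
    apply: (aux _ _ _ (Ar x)); last exact: rnorm_ge0.
    apply: le_trans (rrx x) _; rewrite -[leRHS]mul1r ler_wpM2r ?rnorm_ge0//.
    exact: ltW.
  (* Y_{n+1}^2 - Y_n^2 is split as Y_{n+1} (Y_{n+1} - Y_n) + (Y_{n+1} - Y_n) Y_n, which requires no
     commutation; each summand gains one factor [rho]. *)
  have -> : Y n.+2 x - Y n.+1 x = 2^-1 *: (Y n.+1 (Y n.+1 x - Y n x) +
      (Y n.+1 (Y n x) - Y n (Y n x))).
    rewrite [Y n.+2 x]YS [X in _ - X]YS -scalerBr; congr (_ *: _).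
    by rewrite opprD addrACA subrr add0r linearB addrA subrK.
  rewrite rnormZ rnorm_half.
  apply: le_trans (_ : 2^-1 * (rnorm (Y n.+1 (Y n.+1 x - Y n x)) +
      rnorm (Y n.+1 (Y n x) - Y n (Y n x))) <= _).
    by rewrite ler_wpM2l ?invr_ge0// rnormD.
  apply: half2.
    apply: le_trans (Yr _ _) _; rewrite exprS mulrCA ler_wpM2l//.
  apply: le_trans (IH _) _; rewrite exprS mulrA ler_wpM2r ?exprn_ge0//.
  by rewrite mulrC; exact: Yr.
pose C := (1 - rho)^-1.
have C0 : 0 <= C by rewrite invr_ge0 subr_ge0 ltW.
have /choice[Z ZP] x : exists l, forall n, rnorm (Y n x - l) <= C * rnorm x * rho ^+ n.
  have [l lP] := geometric_limit r0 r1 (rnorm_ge0 x) (fun n => Yd n x).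
  by exists l => n; rewrite [C * _]mulrC; exact: lP.
have Zlin : linear Z.
  move=> c x y; apply/eqP; rewrite -subr_eq0; apply/eqP/rnorm0_eq0/eqP.
  rewrite eq_le rnorm_ge0 andbT.
  apply: (@le0_geometric _ rho (C * rnorm (c *: x + y) +
    rnorm c * (C * rnorm x) + C * rnorm y)) => // n.
  have -> : Z (c *: x + y) - (c *: Z x + Z y) =
    (Z (c *: x + y) - Y n (c *: x + y)) + (c *: (Y n x - Z x) + (Y n y - Z y)).
    have -> : c *: (Y n x - Z x) + (Y n y - Z y) = Y n (c *: x + y) - (c *: Z x + Z y).
      by rewrite linearP scalerBr addrACA opprD.
    by rewrite addrA subrK.
  rewrite mulrDl mulrDl -[leRHS]addrA; apply: le_trans (rnormD _ _) _; apply: lerD.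
    by rewrite rnormB.
  apply: le_trans (rnormD _ _) _; apply: lerD; last exact: ZP.
  by rewrite rnormZ -mulrA ler_wpM2l ?rnorm_ge0.
have ZC x : rnorm (Z x) <= C * rnorm x.
  by have := ZP x 0%N; rewrite Y0 sub0r rnormN expr0 mulr1.
pose ZZ := BMap Zlin (ex_intro2 _ _ C C0 ZC).
have Zsym_le x y : ip (Z x) y <= ip x (Z y).
  rewrite -subr_le0.
  apply: (@le0_geometric _ rho (C * rnorm x * rnorm y + rnorm x * (C * rnorm y))) => // n.
  have -> : ip (Z x) y - ip x (Z y) = ip (Z x - Y n x) y + ip x (Y n y - Z y).
    by rewrite ipBl ipBr Ysym addrA subrK.
  rewrite mulrDl; apply: lerD; apply: le_trans (ip_le _ _) _.
    by rewrite mulrAC ler_wpM2r ?rnorm_ge0// rnormB.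
  by rewrite -mulrA ler_wpM2l ?rnorm_ge0.
have Zsym x y : ip (Z x) y = ip x (Z y).
  by apply/eqP; rewrite eq_le Zsym_le/= ipC [leRHS]ipC Zsym_le.
have ZE x : Z x + Z x = A x + Z (Z x).
  apply/eqP; rewrite -subr_eq0; apply/eqP/rnorm0_eq0/eqP.
  rewrite eq_le rnorm_ge0 andbT.
  apply: (@le0_geometric _ rho (C * rnorm x + C * rnorm x + C * rnorm x + C * rnorm (Z x))) => // n.
  have E2 : Y n.+1 x + Y n.+1 x = A x + Y n (Y n x).
    by rewrite YS -scalerDl -div1r -splitr scale1r.
  have -> : Z x + Z x - (A x + Z (Z x)) = (Z x - Y n.+1 x) + (Z x - Y n.+1 x) +
      Y n (Y n x - Z x) + (Y n (Z x) - Z (Z x)).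
    have aux (z y a p q w : H) : y + y = a + p ->
        z + z - (a + w) = z - y + (z - y) + (p - q) + (q - w).
      move=> E; rewrite -[RHS]addrA [p - q + _]addrA subrK.
      rewrite [z - y + (z - y)]addrACA -[- y - y]opprD E -[RHS]addrA !opprD.
      by congr (_ + _); rewrite -addrA addKr.
    by rewrite linearB; exact: aux.
  have ZPS : rnorm (Z x - Y n.+1 x) <= C * rnorm x * rho ^+ n.
    rewrite rnormB (le_trans (ZP _ _))// exprS mulrCA -[leRHS]mul1r.
    by rewrite ler_wpM2r ?mulr_ge0 ?exprn_ge0 ?rnorm_ge0// ltW.
  rewrite !mulrDl; apply: le_trans (rnormD _ _) _; apply: lerD; last exact: ZP.
  apply: le_trans (rnormD _ _) _; apply: lerD.
    by apply: le_trans (rnormD _ _) _; apply: lerD.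
  apply: le_trans (Yr _ _) _; apply: le_trans (ZP x n).
  by rewrite -[leRHS]mul1r ler_wpM2r ?rnorm_ge0// ltW.
exists (blin (-1) bid ZZ) => x.
have -> : blin (-1) bid ZZ x = x - Z x by rewrite /= scaleN1r.
(* Symmetry and the limit equation 2 Z = T^* T + Z^2 express |Z x|^2; substituted in the expansion
   of |x - Z x|^2, it leaves |x|^2 - |T x|^2. *)
have zz : ip (Z x) (Z x) = ip x (Z x) + ip x (Z x) - rnorm (T x) ^+ 2.
  rewrite Zsym -ipDr ZE ipDr -[rnorm (T x) ^+ 2]ipE ip_adj.
  by rewrite [ip x (A x) + _]addrC addrK.
rewrite -[rnorm (x - _) ^+ 2]ipE ipBl !ipBr ipE zz [ip (Z x) x]ipC.
move: (ip x (Z x)) (rnorm x ^+ 2) (rnorm (T x) ^+ 2) => a b c; ring.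
Qed.

End defect_operator.

Section swap.
Context (R : realType) (L I : choiceType).
Local Notation H := (ell2 R I).
Implicit Types A C X : bmap (ell2 R L) H.

(** W is 1 - A A^* - C C^* + A C^* + C A^*: it exchanges the two orthogonal ranges and fixes their
    common complement. Being symmetric of square 1, it is isometric and its own inverse. *)
Lemma swap_exists A C : isometric A -> isometric C ->
  (forall x y, ip (A x) (C y) = 0) ->
  exists W : bmap H H, [/\ isometric W, forall h, W (W h) = h,
    forall x, W (A x) = C x & forall h, adj A (W h) = adj C h].
Proof.
move=> iA iC AC.
pose W : bmap H H := blin 1 (blin 1 (blin (-1) (blin (-1) bid (bcomp A (adj A)))
  (bcomp C (adj C))) (bcomp A (adj C))) (bcomp C (adj A)).
have WE h : W h = h - A (adj A h) - C (adj C h) + A (adj C h) + C (adj A h).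
  by rewrite /= !scale1r !scaleN1r.
have AKC x : adj A (C x) = 0 by apply: ip_inj => h; rewrite -ip_adj ip0r AC.
have CKA x : adj C (A x) = 0 by apply: ip_inj => h; rewrite -ip_adj ip0r ipC AC.
have aA h : adj A (W h) = adj C h.
  rewrite WE !linearD !linearN/= !isometric_adjK// !AKC subrr sub0r oppr0 add0r addr0//.
have aC h : adj C (W h) = adj A h.
  rewrite WE !linearD !linearN/= !isometric_adjK// !CKA oppr0 !addr0 subrr add0r//.
have WW h : W (W h) = h.
  rewrite [W (W h)]WE aA aC WE.
  set a := A (adj A h); set b := C (adj C h); set c := A (adj C h); set d := C (adj A h).
  rewrite (_ : h - a - b + c + d - c - d + a + b = h)//.
  by rewrite [_ + d - c]addrAC !addrK [_ - b + a]addrAC !subrK.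
have sym (X X' : bmap (ell2 R L) H) h k : ip (X (adj X' h)) k = ip h (X' (adj X k)).
  by rewrite ip_adj ip_adjl.
have Wsym h k : ip (W h) k = ip h (W k).
  rewrite !WE !(ipDl, ipDr) !(ipNl, ipNr) (sym A A) (sym C C) (sym A C) (sym C A).
  exact: addrAC.
exists W; split => // [h|x].
  by apply/eqP; rewrite -(@eqrXn2 _ 2)// ?rnorm_ge0// -!ipE Wsym WW.
by rewrite WE !isometric_adjK// CKA !linear0 !addr0 subrr add0r.
Qed.

Lemma reflection_exists X : isometric X ->
  exists V : bmap H H, [/\ isometric V, forall h, V (V h) = h &
    forall h, 2^-1 *: (h + V h) = X (adj X h)].
Proof.
move=> iX.
(* This is 2 X X^* - 1, the term -1 being written as id - 2 id. *)
pose V : bmap H H := blin 2 (blin (-2) bid bid) (bcomp X (adj X)).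
have VE h : V h = X (adj X h) + X (adj X h) - h.
  rewrite /= [X in X + _](_ : _ = - h).
    by rewrite addrC scaler_nat mulr2n.
  by rewrite scaleNr scaler_nat mulr2n opprD addrA subrr add0r.
have aV h : adj X (V h) = adj X h.
  by rewrite VE linearB linearD/= isometric_adjK// addrK.
exists V; split.
- move=> h; apply/eqP; rewrite -(@eqrXn2 _ 2)// ?rnorm_ge0// -!ipE.
  have e1 : ip (X (adj X h)) h = ip (adj X h) (adj X h) by rewrite ip_adj.
  have e2 : ip h (X (adj X h)) = ip (adj X h) (adj X h) by rewrite ipC.
  rewrite VE ipBl !ipBr !ipDl !ipDr (isometric_ip iX) e1 e2.
  by apply/eqP; move: (ip h h) (ip (adj X h) (adj X h)) => a b; ring.
- by move=> h; rewrite [LHS]VE aV VE opprB addrCA subrr addr0.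
- by move=> h; rewrite VE addrC subrK scalerDr -scalerDl -div1r -splitr scale1r.
Qed.

End swap.

(** * Closed convex hulls of orbits in quotients *)

Section orbit_closure.
Context (R : realType) (X : normedModType R[i]).
Implicit Types (q x y z : X).

Lemma orbit_hull_convex q x y (t : R) : 0 <= t -> t <= 1 ->
  orbit_hull q x -> orbit_hull q y -> orbit_hull q (t%:C *: x + (1 - t)%:C *: y).
Proof.
move=> t0 t1 qx qy A [cA OA].
have t0' : 0 <= t%:C by rewrite ler0c.
have t1' : t%:C <= 1 by rewrite -(rmorph1 (real_complex R)) lecR.
have := cA x y (Itv01 t0' t1') (mem_set (qx A (conj cA OA))) (mem_set (qy A (conj cA OA))).
rewrite inE; congr (A _).
by rewrite rmorphB rmorph1.
Qed.

Lemma orbit_hull_id q : orbit_hull q q.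
Proof.
apply: sub_gen_smallest; exists (idfun : {linear X -> X}) => //; split => // y.
by exists y.
Qed.

(** The vectors that T sends into the hull form a convex set, and it contains the orbit because
    isometries compose. *)
Lemma orbit_hull_isometry q (T : {linear X -> X}) x :
  isometry_group T -> orbit_hull q x -> orbit_hull q (T x).
Proof.
move=> [Tn Ts]; apply: (@smallest_sub _ _ _ [set y | orbit_hull q (T y)]).
  move=> y z l; rewrite !inE /= => qy qz A [cA OA].
  have := cA _ _ l (mem_set (qy A (conj cA OA))) (mem_set (qz A (conj cA OA))).
  rewrite inE; congr (A _).
  by rewrite /conv /= linearD !linearZ.
move=> _ [S [Sn Ss] <-]; apply: sub_gen_smallest; exists (T \o S)%R => //.
split=> [y|y]; first by rewrite /= Tn Sn.
by have [z <-] := Ts y; have [w <-] := Ss z; exists w.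
Qed.

Lemma orbit_hull_rnorm q x : orbit_hull q x -> rnorm x <= rnorm q.
Proof.
apply: (@smallest_sub _ _ _ [set y | rnorm y <= rnorm q]).
  move=> y z l; rewrite !inE /= => yq zq.
  have l0 : 0 <= l%:num by [].
  have l1 : l%:num <= 1 by [].
  have lE : l%:num = (complex.Re l%:num)%:C by rewrite RRe_real// ger0_real.
  move: l0 l1; set t := complex.Re l%:num in lE *; rewrite lE ler0c.
  rewrite -(rmorph1 (real_complex R)) lecR => t0 t1.
  change (rnorm (l%:num *: (y : X) + (1 - l%:num) *: (z : X)) <= rnorm q).
  rewrite lE; apply: le_trans (rnormD _ _) _.
  rewrite !rnormZ -(rmorph1 (real_complex R)) -rmorphB !rnorm_real_ge0 ?subr_ge0//.
  apply: le_trans (lerD (ler_wpM2l t0 yq) (ler_wpM2l _ zq)) _; first by rewrite subr_ge0.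
  by rewrite -mulrDl addrC subrK mul1r.
by move=> _ [S [Sn _] <-]; rewrite /= /rnorm Sn.
Qed.

Definition orbit_closure q : set X := closure (orbit_hull q).

Lemma orbit_closureP q x :
  orbit_closure q x <-> forall e : R, 0 < e -> exists2 y, orbit_hull q y & rnorm (x - y) < e.
Proof. exact: closure_rnormP. Qed.

Lemma orbit_closure_id q : orbit_closure q q.
Proof. by apply: subset_closure; exact: orbit_hull_id. Qed.

Lemma orbit_closure_closed q x :
  (forall e : R, 0 < e -> exists2 y, orbit_closure q y & rnorm (x - y) <= e) ->
  orbit_closure q x.
Proof.
move=> h; apply/orbit_closureP => e e0.
have e2 : 0 < e / 2 by rewrite divr_gt0.
have [y /orbit_closureP/(_ _ e2)[z qz yz] xy] := h _ e2.
exists z => //; apply: le_lt_trans (rnorm_tri _ y _) _.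
by rewrite [ltRHS]splitr ler_ltD.
Qed.

Lemma orbit_closure_convex q x y (t : R) : 0 <= t -> t <= 1 ->
  orbit_closure q x -> orbit_closure q y ->
  orbit_closure q (t%:C *: x + (1 - t)%:C *: y).
Proof.
move=> t0 t1 /orbit_closureP qx /orbit_closureP qy; apply/orbit_closureP => e e0.
have e2 : 0 < e / 2 by rewrite divr_gt0.
have [x' qx' /ltW xx'] := qx _ e2; have [y' qy' /ltW yy'] := qy _ e2.
exists (t%:C *: x' + (1 - t)%:C *: y'); first exact: orbit_hull_convex.
rewrite opprD addrACA -!scalerBr; apply: le_lt_trans (rnormD _ _) _.
have t1' : 0 <= 1 - t by rewrite subr_ge0.
rewrite !rnormZ !rnorm_real_ge0//.
apply: le_lt_trans (lerD (ler_wpM2l t0 xx') (ler_wpM2l t1' yy')) _.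
by rewrite -mulrDl addrC subrK mul1r ltr_pdivrMr// ltr_pMr// ltr1n.
Qed.

Lemma orbit_closure_half q x y :
  orbit_closure q x -> orbit_closure q y -> orbit_closure q (2^-1 *: (x + y)).
Proof.
move=> qx qy; have : orbit_closure q ((2^-1 : R)%:C *: x + (1 - 2^-1)%:C *: y).
  by apply: orbit_closure_convex => //; lra.
have -> : 1 - 2^-1 = 2^-1 :> R by field.
by rewrite -scalerDr fmorphV rmorph_nat.
Qed.

Lemma orbit_closure_avg q (f : nat -> X) n : (forall k, orbit_closure q (f k)) ->
  orbit_closure q ((n.+1%:R : R[i])^-1 *: \sum_(k < n.+1) f k).
Proof.
move=> qf; elim: n => [|n IH].
  by rewrite big_ord_recl big_ord0 addr0 invr1 scale1r.
rewrite big_ord_recr /= scalerDr.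
have n2 : n.+2%:R != 0 :> R by rewrite pnatr_eq0.
have n1 : n.+1%:R != 0 :> R by rewrite pnatr_eq0.
(* The mean of n + 2 terms combines the mean of the first n + 1, with weight (n + 1) / (n + 2), and
   the last term. *)
have := @orbit_closure_convex q _ _ (n.+1%:R / n.+2%:R) _ _ IH (qf n.+1).
rewrite scalerA.
have -> : (n.+1%:R / n.+2%:R)%:C / n.+1%:R = n.+2%:R^-1 :> R[i].
  by rewrite rmorphM fmorphV !rmorph_nat mulrAC divff ?mul1r// pnatr_eq0.
have -> : (1 - n.+1%:R / n.+2%:R)%:C = n.+2%:R^-1 :> R[i].
  have -> : 1 - n.+1%:R / n.+2%:R = n.+2%:R^-1 :> R.
    by apply: (mulIf n2); rewrite mulrBl mul1r divfK// mulVf// -natrB// subSnn.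
  by rewrite fmorphV rmorph_nat.
apply; first by rewrite divr_ge0.
by rewrite ler_pdivrMr ?mul1r ?ler_nat// ltr0n.
Qed.

Lemma orbit_closure_isometry q (T : {linear X -> X}) x :
  isometry_group T -> orbit_closure q x -> orbit_closure q (T x).
Proof.
move=> TG /orbit_closureP qx; apply/orbit_closureP => e e0.
have [y qy xy] := qx e e0; exists (T y); first exact: orbit_hull_isometry.
by rewrite -linearB /rnorm (TG.1 (x - y)).
Qed.

Lemma orbit_closure_rnorm q x : orbit_closure q x -> rnorm x <= rnorm q.
Proof.
move=> /orbit_closureP qx; apply/ler_addgt0Pr => e e0.
have [y /orbit_hull_rnorm yq xy] := qx e e0.
rewrite -[x](subrK y) addrC (le_trans (rnormD _ _))// lerD// ltW//.
Qed.

End orbit_closure.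

Section quotient_isometries.
Context (R : realType) (X : normedModType R[i]) (F : closed_subspace (bounded_op X)).

Definition lmul_op (U : bmap X X) (T : bounded_op X) : bounded_op X :=
  op_of_bmap (bcomp U (bmap_of_op T)).

Definition rmul_op (T : bounded_op X) (U : bmap X X) : bounded_op X :=
  op_of_bmap (bcomp (bmap_of_op T) U).

(** Phi and Psi are inverse contractions preserving F, so both descend to contractions of the
    quotient; being inverse to each other, these are isometric and onto. *)
Lemma quot_isometry (Phi Psi : bounded_op X -> bounded_op X) :
  linear Phi -> linear Psi -> cancel Phi Psi -> cancel Psi Phi ->
  (forall T, T \in F -> Phi T \in F) -> (forall T, T \in F -> Psi T \in F) ->
  (forall T, rnorm (Phi T) <= rnorm T) -> (forall T, rnorm (Psi T) <= rnorm T) ->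
  exists2 Theta : {linear quot_space F -> quot_space F}, isometry_group Theta &
    forall T, Theta (quot_pi F T) = quot_pi F (Phi T).
Proof.
move=> Phil Psil PhiK PsiK PhiF PsiF Phin Psin.
have lB (P : bounded_op X -> bounded_op X) : linear P -> forall S T, P (S - T) = P S - P T.
  by move=> Pl S T; rewrite -[S - T]addrC -scaleN1r Pl scaleN1r addrC.
have /choice[s sP] : forall q : quot_space F, exists T, quot_pi F T = q.
  by move=> q; exact: quot_piS.
have wd T : quot_pi F (Phi (s (quot_pi F T))) = quot_pi F (Phi T).
  by apply/quot_piP; rewrite -lB//; apply: PhiF; apply/quot_piP; rewrite sP.
pose th (q : quot_space F) : quot_space F := quot_pi F (Phi (s q)).
have thl : linear th.
  move=> a p q; rewrite -(sP p) -(sP q) -linearP /th wd !wd Phil linearP//.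
pose Theta : {linear quot_space F -> quot_space F} :=
  HB.pack th (GRing.isLinear.Build _ _ _ _ th thl).
have le (P : bounded_op X -> bounded_op X) T : linear P ->
    (forall T, T \in F -> P T \in F) -> (forall T, rnorm (P T) <= rnorm T) ->
    quot_norm (quot_pi F (P T)) <= quot_norm (quot_pi F T).
  move=> Pl PF Pn; apply: quot_norm_ge => S /quot_piP ST.
  have -> : quot_pi F (P T) = quot_pi F (P S).
    by apply/esym/quot_piP; rewrite -lB//; exact: PF.
  exact: le_trans (quot_norm_le _ _) (Pn _).
have ThE T : Theta (quot_pi F T) = quot_pi F (Phi T) by exact: wd.
exists Theta; last exact: ThE.
split=> [q|q]; last by exists (quot_pi F (Psi (s q))); rewrite ThE PsiK.
rewrite !rnormE; apply: congr1; rewrite !rnorm_quot -(sP q) ThE.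
apply/eqP; rewrite eq_le le//=; have := le Psi (Phi (s q)) Psil PsiF Psin.
by rewrite PhiK.
Qed.

Hypothesis F_lmul : forall (U : bmap X X) T, (forall x, rnorm (U x) = rnorm x) ->
  T \in F -> lmul_op U T \in F.
Hypothesis F_rmul : forall (U : bmap X X) T, (forall x, rnorm (U x) = rnorm x) ->
  T \in F -> rmul_op T U \in F.

Lemma lmul_isometry (U V : bmap X X) : (forall x, rnorm (U x) = rnorm x) ->
  (forall x, U (V x) = x) -> (forall x, V (U x) = x) ->
  exists2 Theta : {linear quot_space F -> quot_space F}, isometry_group Theta &
    forall T, Theta (quot_pi F T) = quot_pi F (lmul_op U T).
Proof.
move=> Un UV VU.
have Vn x : rnorm (V x) = rnorm x by rewrite -(Un (V x)) UV.
have ll (W : bmap X X) : linear (lmul_op W).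
  by move=> a S T; apply: bounded_opP => x; exact: (linearP W).
have ln (W : bmap X X) : (forall x, rnorm (W x) = rnorm x) ->
    forall T, rnorm (lmul_op W T) <= rnorm T.
  move=> Wn T; apply: opnorm_on_le; first exact: opnorm_on_ge0.
  by move=> x _ x1; rewrite /= Wn; exact: opnorm_on_ge.
apply: (quot_isometry (Psi := lmul_op V)) => //; do ?exact: ln; do ?by move=> T; exact: F_lmul.
  by move=> T; apply: bounded_opP => x; exact: VU.
by move=> T; apply: bounded_opP => x; exact: UV.
Qed.

Lemma rmul_isometry (U V : bmap X X) : (forall x, rnorm (U x) = rnorm x) ->
  (forall x, U (V x) = x) -> (forall x, V (U x) = x) ->
  exists2 Theta : {linear quot_space F -> quot_space F}, isometry_group Theta &
    forall T, Theta (quot_pi F T) = quot_pi F (rmul_op T U).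
Proof.
move=> Un UV VU.
have Vn x : rnorm (V x) = rnorm x by rewrite -(Un (V x)) UV.
have rl (W : bmap X X) : linear (fun T => rmul_op T W).
  by move=> a S T; apply: bounded_opP.
have rn (W : bmap X X) : (forall x, rnorm (W x) = rnorm x) ->
    forall T, rnorm (rmul_op T W) <= rnorm T.
  move=> Wn T; apply: opnorm_on_le; first exact: opnorm_on_ge0.
  move=> x _ x1; have Wx1 : rnorm (W x) <= 1 by rewrite Wn.
  exact: (@opnorm_on_ge _ _ setT T (W x)).
apply: (quot_isometry (Phi := fun T => rmul_op T U) (Psi := fun T => rmul_op T V)) => //.
- by move=> T; apply: bounded_opP => x /=; rewrite UV.
- by move=> T; apply: bounded_opP => x /=; rewrite VU.
- by move=> T; exact: F_rmul.
- by move=> T; exact: F_rmul.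
- exact: rn.
- exact: rn.
Qed.

End quotient_isometries.

(** * Contractions in the closed convex hull *)

(** Transfinite recursion along [lt]: each choice avoids the union of the earlier supports, which is
    small. V and s are left abstract because points, vectors, pairs of vectors and whole sequences
    get selected in this way. *)
Lemma disjoint_selection (L I V : Type) (lt : L -> L -> Prop) (small : set I -> Prop)
    (P : L -> V -> Prop) (s : V -> set I) :
  small set0 -> well_founded lt -> (forall l m, l <> m -> lt l m \/ lt m l) ->
  (forall l (A : L -> set I), (forall m, lt m l -> small (A m)) ->
     small [set i | exists2 m, lt m l & A m i]) ->
  (forall l J, small J -> exists v, [/\ P l v, small (s v) & forall i, s v i -> ~ J i]) ->
  exists f : L -> V, (forall l, P l (f l)) /\
    forall l m i, s (f l) i -> s (f m) i -> l = m.
Proof.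
move=> small0 wf lt_total small_seg step.
have [[l0 _]|L0] := pselect (exists l : L, True); last first.
  by exists (fun l => False_rect V (L0 (ex_intro _ l Logic.I))); split => l; case: L0; exists l.
have [v0 _] := step l0 _ small0.
pose Q l (J : set I) v := [/\ P l v, small (s v) & forall i, s v i -> ~ J i].
pose G l (rec : forall m, lt m l -> V) : V :=
  if pselect (exists v, Q l [set i | exists m (ml : lt m l), s (rec m ml) i] v) is left h
  then sval (cid h) else v0.
pose f := Fix wf (fun=> V) G.
have fE l : f l = G l (fun m _ => f m).
  rewrite /f Fix_eq// => x g h gh; congr (G x _).
  by apply: functional_extensionality_dep => m; apply: functional_extensionality_dep.
have fQ l : Q l [set i | exists2 m, lt m l & s (f m) i] (f l).
  elim/(well_founded_ind wf): l => l IH.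
  have small_l : small [set i | exists2 m, lt m l & s (f m) i].
    by apply: (small_seg l (fun m => s (f m))) => m /IH[].
  have E : [set i | exists m (ml : lt m l), s (f m) i] = [set i | exists2 m, lt m l & s (f m) i].
    by apply/seteqP; split=> i; [case=> m [ml mi]|case=> m ml mi]; exists m => //; exists ml.
  rewrite [f l]fE /G E; case: pselect => [h|[]]; first exact: (svalP (cid h)).
  exact: step.
exists f; split => [l|l m i li mi]; first by have [] := fQ l.
apply: contrapT => /lt_total[] lm; [have [_ _ d] := fQ m|have [_ _ d] := fQ l].
  by apply: (d i mi); exists l.
by apply: (d i li); exists m.
Qed.

Section coordinate_isometries.
Context (R : realType) (L I : choiceType).

Lemma block_map_delta (x : L -> ell2 R I) (X : bmap (ell2 R L) (ell2 R I)) :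
  disjoint_family x ->
  (forall v l i, x l i != 0 -> X v i = v l * x l i) ->
  (forall v i, (forall l, x l i = 0) -> X v i = 0) ->
  forall l, X (delta l 1) = x l.
Proof.
move=> xd X1 X2 l; apply: ell2P => i.
have [[m xm]|nx] := pselect (exists m, x m i != 0).
  rewrite (X1 _ m)// deltaE; case: eqP => [->|ml]; first by rewrite mul1r.
  rewrite mul0r; apply/esym/eqP/negPn/negP => xl; apply: ml; exact: xd xm xl.
have xi m : x m i = 0 by apply/eqP/negPn/negP => xm; apply: nx; exists m.
by rewrite X2.
Qed.

(** E E^* is the coordinate projection because the difference is killed by E^*, hence orthogonal to
    the basis vectors over [range h], and vanishes at the other coordinates. *)
Lemma delta_isometry (h : L -> I) : injective h ->
  exists E : bmap (ell2 R L) (ell2 R I), [/\ isometric E,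
    forall v i, ~ range h i -> E v i = 0 &
    forall x, E (adj E x) = pr (range h) x].
Proof.
move=> hinj; pose x l : ell2 R I := delta (h l) 1.
have xE l i : x l i != 0 -> i = h l.
  by rewrite deltaE; case: (i =P h l) => //; rewrite eqxx.
have xd : disjoint_family x by move=> i l m /xE -> /xE /hinj.
have x1 l : rnorm (x l) = 1 by rewrite rnorm_delta rnorm1.
have [|E [E1 E2 _ En]] := block_map_exists ler01 xd; first by move=> l; rewrite x1.
have E0 v i : ~ range h i -> E v i = 0.
  move=> hi; apply: E2 => l; apply/eqP/negPn/negP => /xE il; apply: hi; exists l => //.
exists E; split => //; first exact: En.
move=> f; have iE : isometric E by exact: En.
pose z := pr (range h) f - E (adj E f).
have Ez : adj E z = 0.
  rewrite /z linearB/= isometric_adjK// -linearB/=; apply: ip_inj => u.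
  rewrite -ip_adj ip0r; apply: ip_disjoint => i.
  change (E u i = 0 \/ pr (range h) f i - f i = 0).
  have [hi|hi] := pselect (range h i); last by left; exact: E0.
  by right; rewrite pr_in// subrr.
have z0 i : z i = 0.
  have [[l _ <-]|hi] := pselect (range h i); last first.
    change (pr (range h) f i - E (adj E f) i = 0).
    by rewrite pr_notin// E0// subrr.
  apply: coord_eq0 => w; have <- : E (delta l w) = delta (h l) w.
    rewrite -[in LHS](mulr1 w) deltaZ linearZ/= (block_map_delta xd E1 E2).
    by rewrite /x -deltaZ mulr1.
  by rewrite ip_adj Ez ip0r.
have : z = 0 by apply: ell2P => i; rewrite z0.
by move/eqP; rewrite subr_eq0 => /eqP.
Qed.

End coordinate_isometries.

(** * Small and large sets of coordinates *)

Definition supp (R : realType) (I : choiceType) (x : ell2 R I) : set I := [set i | x i != 0].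

(* The small sets are the countable ones, with [L = I] of order type omega_1, for
   separable-range operators, and the finite ones, with [L = nat], for compact
   operators. *)
Record index_system (L I : choiceType) (lt : L -> L -> Prop) (small : set I -> Prop) : Prop :=
  IndexSystem {
    index_wf : well_founded lt ;
    index_total : forall l m, l <> m -> lt l m \/ lt m l ;
    small_sub : forall A B : set I, A `<=` B -> small B -> small A ;
    small0 : small set0 ;
    small1 : forall i, small [set i] ;
    smallU : forall A B : set I, small A -> small B -> small (A `|` B) ;
    small_segment : forall l (A : L -> set I), (forall m, lt m l -> small (A m)) ->
      small [set i | exists2 m, lt m l & A m i] ;
    large_range : forall h : L -> I, injective h -> ~ small (range h) ;
    index_pairing : exists g : L * nat -> L, injective g }.

Section large_sets.
Context (L I : choiceType) (lt : L -> L -> Prop) (small : set I -> Prop).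
Hypothesis S : index_system lt small.

Lemma large_injection (A : set I) : ~ small A ->
  exists2 h : L -> I, injective h & range h `<=` A.
Proof.
move=> nA.
have [|f [fA fd]] := @disjoint_selection L I I lt small (fun _ i => A i) (fun i => [set i])
    (small0 S) (index_wf S) (index_total S) (@small_segment _ _ _ _ S).
  move=> l J sJ.
  have [i [Ai nJ]] : exists i, A i /\ ~ J i.
    apply: contrapT => h; apply: nA; apply: (small_sub S _ sJ) => i Ai.
    by apply: contrapT => nJ; apply: h; exists i.
  by exists i; split => //; [exact: (small1 S)|move=> _ ->].
exists f => [l m lm|_ [l _ <-]]; last exact: fA.
exact: (fd l m (f l)).
Qed.

Lemma card_eq_range (A : set I) : ([set: L] #= A)%card ->
  exists2 h : L -> I, injective h & range h = A.
Proof.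
move=> /card_bijP[h [k hk kh]].
exists (fun l => set_val (h (SigSub (mem_set Logic.I : l \in [set: L])))).
  by move=> l m /val_inj /(can_inj hk) /(congr1 val).
apply/seteqP; split=> [_ [l _ <-]|i Ai]; first exact: set_mem (valP _).
exists (val (k (SigSub (mem_set Ai)))) => //.
rewrite [X in h X](_ : _ = k (SigSub (mem_set Ai))) ?kh//.
exact: val_inj.
Qed.

(** Realising [pr A] as E E^* requires an injection of L with range exactly A. Cantor-Bernstein
    provides it, as A lies in one injective image of L and contains another. *)
Lemma large_bijection (j : L -> I) (A : set I) : injective j -> A `<=` range j -> ~ small A ->
  exists2 h : L -> I, injective h & range h = A.
Proof.
move=> jinj Aj nA; have [f finj fA] := large_injection nA.
have LA : ([set: L] #<= A)%card.
  have /inj_card_eq fL : {in [set: L] &, injective f} by move=> l m _ _ /finj.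
  apply: card_le_trans (subset_card_le fA).
  by move: fL; rewrite card_eq_le => /andP[].
have AL : (A #<= [set: L])%card.
  exact: card_le_trans (subset_card_le Aj) (card_image_le j [set: L]).
apply: card_eq_range; exact: Cantor_Bernstein.
Qed.

(** An injection of L * nat into L cuts a copy of L inside A into countably many copies. *)
Lemma large_pieces (A : set I) : ~ small A ->
  exists P : nat -> set I, [/\ forall n, P n `<=` A, forall n, ~ small (P n) &
    forall m n i, P m i -> P n i -> m = n].
Proof.
move=> nA; have [f finj fA] := large_injection nA; have [g ginj] := index_pairing S.
exists (fun n => range (fun l => f (g (l, n)))); split.
- by move=> n _ [l _ <-]; apply: fA; exists (g (l, n)).
- by move=> n; apply: (large_range S) => l m /finj /ginj [].
- by move=> m n _ [l _ <-] [k _ /finj /ginj []].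
Qed.

(** At most one index makes A minus Z k small: with two of them, disjointness of the Z k would make
    A a union of two small sets. The same holds for B, so among three indices one serves both. *)
Lemma large_split3 (A B : set I) (Z Z' : nat -> set I) : ~ small A -> ~ small B ->
  (forall m n i, Z m i -> Z n i -> m = n) -> (forall m n i, Z' m i -> Z' n i -> m = n) ->
  exists k, ~ small (A `\` Z k) /\ ~ small (B `\` Z' k).
Proof.
move=> nA nB Zd Zd'.
have split2 (C : set I) (W : nat -> set I) m n : ~ small C ->
    (forall m n i, W m i -> W n i -> m = n) -> m <> n ->
    small (C `\` W m) -> small (C `\` W n) -> False.
  move=> nC Wd mn sm sn; apply: nC; apply: (small_sub S _ (smallU S sm sn)) => i Ci.
  have [Wm|Wm] := pselect (W m i); last by left.
  by right; split => // Wn; apply: mn; exact: Wd Wm Wn.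
apply: contrapT => /forallNP h.
have h' k : small (A `\` Z k) \/ small (B `\` Z' k).
  have [|] := pselect (small (A `\` Z k)); first by left.
  by move=> a; right; apply: contrapT => b; apply: (h k).
have [a0|b0] := h' 0%N; have [a1|b1] := h' 1%N; have [a2|b2] := h' 2%N;
  solve [ exact: (split2 A Z 0%N 1%N) | exact: (split2 A Z 0%N 2%N)
        | exact: (split2 A Z 1%N 2%N) | exact: (split2 B Z' 0%N 1%N)
        | exact: (split2 B Z' 0%N 2%N) | exact: (split2 B Z' 1%N 2%N)].
Qed.

End large_sets.

(** * From one element of norm 1 to all strict contractions *)

Section contractions_in_orbit_closure.
Context (R : realType) (L I : choiceType).
Context (lt : L -> L -> Prop) (small : set I -> Prop).
Local Notation H := (ell2 R I).
Context (F : closed_subspace (bounded_op H)).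
Hypothesis S : index_system lt small.
Hypothesis F_lmul : forall (U : bmap H H) T, (forall x, rnorm (U x) = rnorm x) ->
  T \in F -> lmul_op U T \in F.
Hypothesis F_rmul : forall (U : bmap H H) T, (forall x, rnorm (U x) = rnorm x) ->
  T \in F -> rmul_op T U \in F.
(** The analytic input about the ideal, supplied by [sep_ops_step] and [compact_ops_step]. The error
    is fixed before J, so that it can be summed over the family selected afterwards. *)
Hypothesis step : forall (T : bounded_op H) (e : R), rnorm (quot_pi F T) = 1 ->
  0 < e -> e < 1 -> rnorm T < 1 + e ->
  exists2 err : L -> R, (forall A : {fset L}, \sum_(l <- A) err l <= e) &
    forall l J, small J -> exists x y : H,
      [/\ small (supp x `|` supp y), (forall i, (supp x `|` supp y) i -> ~ J i),
          rnorm x = 1, `|rnorm y - 1| <= e & rnorm (T x - y) <= err l].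

Lemma almost_isometry (T : bounded_op H) (e : R) (J J' : set I) :
  rnorm (quot_pi F T) = 1 -> 0 < e -> e < 1 -> rnorm T < 1 + e ->
  ~ small J -> ~ small J' ->
  exists X Y : bmap (ell2 R L) H, [/\ isometric X, isometric Y,
    forall v, rnorm (T (X v) - Y v) <= (e + e) * rnorm v,
    (exists K, [/\ K `<=` J, ~ small K & forall v i, K i -> X v i = 0]) &
    (exists K, [/\ K `<=` J', ~ small K & forall v i, K i -> Y v i = 0])].
Proof.
move=> T1 e0 e1 Te nJ nJ'.
have [err errS st] := step T1 e0 e1 Te.
pose P l (p : H * H) := [/\ rnorm p.1 = 1, `|rnorm p.2 - 1| <= e &
  rnorm (T p.1 - p.2) <= err l].
pose s (p : H * H) := supp p.1 `|` supp p.2.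
have [|f [fP fd]] := @disjoint_selection L I _ lt small P s (small0 S) (index_wf S)
    (index_total S) (@small_segment _ _ _ _ S).
  by move=> l K /(st l)[x [y [? ? ? ? ?]]]; exists (x, y).
have [g ginj] := index_pairing S.
pose x k l := (f (g (l, k))).1; pose y k l := (f (g (l, k))).2.
have xd m n l l' i : x m l i != 0 -> x n l' i != 0 -> (l, m) = (l', n).
  by move=> a b; apply: ginj; apply: (fd _ _ i); left.
have yd m n l l' i : y m l i != 0 -> y n l' i != 0 -> (l, m) = (l', n).
  by move=> a b; apply: ginj; apply: (fd _ _ i); right.
pose Z k : set I := [set i | exists l, x k l i != 0].
pose Z' k : set I := [set i | exists l, y k l i != 0].
have Zd m n i : Z m i -> Z n i -> m = n by move=> [l a] [l' b]; have [] := xd _ _ _ _ _ a b.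
have Zd' m n i : Z' m i -> Z' n i -> m = n by move=> [l a] [l' b]; have [] := yd _ _ _ _ _ a b.
(* Among three disjoint copies of the family, one leaves large parts of [J] and
   [J'] free. *)
have [k [nZ nZ']] := large_split3 S nJ nJ' Zd Zd'.
have xkd : disjoint_family (x k) by move=> i l m a b; have [] := xd _ _ _ _ _ a b.
have ykd : disjoint_family (y k) by move=> i l m a b; have [] := yd _ _ _ _ _ a b.
have x1 l : rnorm (x k l) = 1 by have [] := fP (g (l, k)).
have ye l : `|rnorm (y k l) - 1| <= e by have [] := fP (g (l, k)).
have Txy l : rnorm (T (x k l) - y k l) <= err (g (l, k)) by have [] := fP (g (l, k)).
have y0 l : 0 < rnorm (y k l).
  by have := ye l; rewrite ler_norml => /andP[+ _]; move: (rnorm _) => r; lra.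
have y2 l : rnorm (y k l) <= 2.
  by have := ye l; rewrite ler_norml => /andP[_]; move: (rnorm _) => r; lra.
pose c l : R[i] := (rnorm (y k l))^-1%:C.
pose w l := c l *: y k l.
have wE l i : w l i = c l * y k l i by [].
have w1 l : rnorm (w l) = 1.
  by rewrite /w rnormZ rnorm_real_ge0 ?invr_ge0 ?rnorm_ge0// mulVf// gt_eqF.
have w0 l i : w l i != 0 -> y k l i != 0.
  by apply: contraNN => /eqP yl; rewrite wE yl mulr0.
have c0 l : c l != 0 by rewrite -(rmorph0 (real_complex R)) (inj_eq (@complexI R)) invr_eq0 gt_eqF.
have w0' l i : y k l i != 0 -> w l i != 0 by move=> yl; rewrite wE mulf_neq0.
have wd : disjoint_family w by move=> i l m /w0 a /w0 b; exact: ykd a b.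
have [|X [X1 X2 _ Xn]] := block_map_exists ler01 xkd; first by move=> l; rewrite x1.
have [|Y [Y1 Y2 _ Yn]] := block_map_exists ler01 wd; first by move=> l; rewrite w1.
(* [Y'] uses the images before normalization: T X - Y' is controlled by the sum of [err], and Y' - Y
   by the distance of the norms from 1, whence the bound e + e. *)
have [|Y' [Y1' Y2' _ _]] := block_map_exists (ler0n R 2) ykd; first exact: y2.
have {}Xn : isometric X by exact: Xn.
have {}Yn : isometric Y by exact: Yn.
exists X, Y; split => //.
- move=> v; rewrite mulrDl.
  apply: le_trans (rnorm_tri _ (Y' v) _) _; apply: lerD.
    pose G := blin (-1) (bcomp (bmap_of_op T) X) Y'.
    have GE u : G u = T (X u) - Y' u by rewrite /= scaleN1r.
    (* The map l -> g (l, k) is injective, so sums of [err] along it are sums over finite subsets of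
       L. *)
    rewrite -GE; apply: (@bmap_summable_le _ _ _ G (fun l => err (g (l, k)))).
      move=> A; apply: le_trans (errS ((fun l => g (l, k)) @` A)%fset).
      by rewrite big_imfset//= => l l' _ _ /ginj[].
    by move=> l; rewrite GE (block_map_delta xkd X1 X2) (block_map_delta ykd Y1' Y2').
  rewrite -(Yn v) -[e in e * _](rnorm_real_ge0 (ltW e0)) -rnormZ.
  apply: le_rnorm_coord => i.
  change (rnorm (Y' v i - Y v i) <= rnorm (e%:C * Y v i)).
  have [[l yl]|ny] := pselect (exists l, y k l i != 0); last first.
    have yi l : y k l i = 0 by apply/eqP/negPn/negP => yl; apply: ny; exists l.
    rewrite Y2'// Y2 ?subrr ?rnorm0 ?rnorm_ge0// => l.
    by rewrite wE yi mulr0.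
  rewrite (Y1' _ l)// (Y1 _ l) ?w0'// wE.
  have -> : v l * y k l i - v l * (c l * y k l i) =
      (rnorm (y k l) - 1)%:C * (v l * (c l * y k l i)).
    have yc : (rnorm (y k l))%:C * c l = 1 by rewrite /c -rmorphM divff ?rmorph1// gt_eqF.
    rewrite rmorphB rmorph1 mulrBl mul1r; congr (_ - _).
    by rewrite mulrCA [_ * (c l * _)]mulrA yc mul1r.
  rewrite [leLHS]rnormM [leRHS]rnormM ler_wpM2r ?rnorm_ge0//.
  by rewrite rnorm_real (rnorm_real_ge0 (ltW e0)).
- exists (J `\` Z k); split; [by move=> i []|exact: nZ|move=> v i [_ nz]].
  by apply: X2 => l; apply/eqP/negPn/negP => xl; apply: nz; exists l.
- exists (J' `\` Z' k); split; [by move=> i []|exact: nZ'|move=> v i [_ nz]].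
  by apply: Y2 => l; apply/eqP/negPn/negP => /w0 yl; apply: nz; exists l.
Qed.

Lemma quot_piB_le (T U : bounded_op H) (M : R) : 0 <= M ->
  (forall x, rnorm (T x - U x) <= M * rnorm x) ->
  rnorm (quot_pi F T - quot_pi F U) <= M.
Proof.
move=> M0 TU; rewrite -quot_piB rnorm_quot; apply: le_trans (quot_norm_le F _) _.
rewrite rnorm_op; apply: opnorm_on_le => // x _ x1.
by apply: le_trans (TU x) _; rewrite ler_piMr.
Qed.

Variables (q : quot_space F).
Hypothesis q1 : rnorm q = 1.
Local Notation K := (orbit_closure q).

Lemma orbit_closure_lmul (W : bmap H H) T : isometric W -> (forall h, W (W h) = h) ->
  K (quot_pi F T) -> K (quot_pi F (lmul_op W T)).
Proof.
move=> Wn WW KT; have [Th ThG <-] := lmul_isometry F_lmul Wn WW WW.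
exact: orbit_closure_isometry.
Qed.

Lemma orbit_closure_rmul (W : bmap H H) T : isometric W -> (forall h, W (W h) = h) ->
  K (quot_pi F T) -> K (quot_pi F (rmul_op T W)).
Proof.
move=> Wn WW KT; have [Th ThG <-] := rmul_isometry F_rmul Wn WW WW.
exact: orbit_closure_isometry.
Qed.

Lemma orbit_closure_half_op (S1 S2 T : bounded_op H) :
  K (quot_pi F S1) -> K (quot_pi F S2) -> (forall x, 2^-1 *: (S1 x + S2 x) = T x) ->
  K (quot_pi F T).
Proof.
move=> K1 K2 ST; have -> : T = 2^-1 *: (S1 + S2) by apply: bounded_opP => x; rewrite -ST.
by rewrite linearZ linearD; exact: orbit_closure_half.
Qed.

Lemma range_disjoint (A B : bmap (ell2 R L) H) (J K' : set I) :
  (forall v i, J i -> A v i = 0) -> (forall v i, ~ K' i -> B v i = 0) -> K' `<=` J ->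
  forall u v, ip (A u) (B v) = 0.
Proof.
move=> AJ BK KJ u v; apply: ip_disjoint => i.
have [Ki|nK] := pselect (K' i); first by left; apply: AJ; exact: KJ.
by right; exact: BK.
Qed.

(** The range of A may meet that of X, so X is first exchanged with an isometry C carried by the
    part N of J that X leaves free, where A vanishes too. This gives T X X^* W1 W2 = T X A^*, and
    likewise W4 W3 Y = B through C' carried by N'. *)
Lemma partial_isometry_in (A B : bmap (ell2 R L) H) (J J' : set I) :
  isometric A -> isometric B -> ~ small J -> ~ small J' ->
  (forall v i, J i -> A v i = 0) -> (forall v i, J' i -> B v i = 0) ->
  K (quot_pi F (op_of_bmap (bcomp B (adj A)))).
Proof.
move=> iA iB nJ nJ' AJ BJ; apply: orbit_closure_closed => e0 e0_gt0.
(* Half of e0, because [almost_isometry] has error e + e; the bound 2^-1 ensures e < 1. *)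
pose e : R := Num.min (e0 / 2) 2^-1.
have ege0 : 0 < e by rewrite lt_min divr_gt0//=; lra.
have e1 : e < 1 by rewrite gt_min; apply/orP; right; lra.
have ee : e + e <= e0.
  by rewrite [leRHS]splitr; apply: lerD; rewrite ge_min lexx.
have [T Tq Tn] := quot_norm_adherent q ege0.
rewrite -rnorm_quot q1 in Tn.
have T1 : rnorm (quot_pi F T) = 1 by rewrite Tq.
have [X [Y [iX iY TXY [N [NJ nN XN]] [N' [NJ' nN' YN]]]]] :=
  almost_isometry T1 ege0 e1 Tn nJ nJ'.
have [h hinj hN] := large_injection S nN; have [h' hinj' hN'] := large_injection S nN'.
have [C [iC C0 _]] := delta_isometry R hinj; have [C' [iC' C0' _]] := delta_isometry R hinj'.
have XC := range_disjoint XN C0 hN.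
have YC := range_disjoint YN C0' hN'.
have AC := range_disjoint AJ C0 (subset_trans hN NJ).
have BC := range_disjoint BJ C0' (subset_trans hN' NJ').
have [W1 [iW1 W1K _ W1C]] := swap_exists iX iC XC.
have [W2 [iW2 W2K _ W2A]] := swap_exists iC iA (fun u v => etrans (ipC _ _) (AC v u)).
have [W3 [iW3 W3K W3C _]] := swap_exists iY iC' YC.
have [W4 [iW4 W4K W4B _]] := swap_exists iC' iB (fun u v => etrans (ipC _ _) (BC v u)).
have [V [iV VV VX]] := reflection_exists iX.
have KT : K (quot_pi F T) by rewrite Tq; exact: orbit_closure_id.
have KX : K (quot_pi F (rmul_op T (bcomp X (adj X)))).
  apply: (orbit_closure_half_op KT (orbit_closure_rmul iV VV KT)) => x.
  by rewrite /= -VX -linearD -linearZ.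
have := orbit_closure_lmul iW4 W4K (orbit_closure_lmul iW3 W3K
  (orbit_closure_rmul iW2 W2K (orbit_closure_rmul iW1 W1K KX))).
set Z := lmul_op _ _ => KZ; exists (quot_pi F Z) => //.
apply: le_trans ee; have ee0 : 0 <= e + e by rewrite addr_ge0// ltW.
apply: quot_piB_le => //.
move=> x; have -> : Z x = W4 (W3 (T (X (adj A x)))).
  by rewrite /= W1C W2A.
have -> : op_of_bmap (bcomp B (adj A)) x = W4 (W3 (Y (adj A x))) by rewrite W3C W4B.
rewrite -!linearB iW4 iW3 rnormB; apply: le_trans (TXY _) _.
by rewrite ler_wpM2l// adj_isometric_le.
Qed.

Lemma bounded_op_sumE n (U : nat -> bounded_op H) x :
  (\sum_(k < n) U k : bounded_op H) x = \sum_(k < n) U k x.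
Proof. by elim/big_rec2: _ => // k y T _ <-. Qed.

(** The summed errors are bounded independently of n, so they vanish in the mean. *)
Lemma orbit_closure_avg_limit (T : bounded_op H) (U : nat -> bounded_op H) (M : R) :
  0 <= M -> (forall k, K (quot_pi F (U k))) ->
  (forall n x, rnorm (\sum_(k < n) (T x - U k x)) <= M * rnorm x) -> K (quot_pi F T).
Proof.
move=> M0 KU TU; apply: orbit_closure_closed => e e0.
pose n := Num.truncn (M / e).
have nM : M / n.+1%:R <= e.
  by rewrite ler_pdivrMr ?ltr0n// mulrC -ler_pdivrMr// ltW// truncnS_gt.
pose V : bounded_op H := (n.+1%:R : R[i])^-1 *: \sum_(k < n.+1) U k.
exists (quot_pi F V).
  by rewrite linearZ linear_sum; exact: (@orbit_closure_avg _ _ q (fun k => quot_pi F (U k)) n KU).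
apply: quot_piB_le; first exact: ltW.
move=> x; apply: (@le_trans _ _ (M / n.+1%:R * rnorm x)); last first.
  by rewrite ler_wpM2r ?rnorm_ge0.
have -> : T x - V x = (n.+1%:R : R[i])^-1 *: \sum_(k < n.+1) (T x - U k x).
  change (T x - (n.+1%:R : R[i])^-1 *: (\sum_(k < n.+1) U k : bounded_op H) x =
    (n.+1%:R : R[i])^-1 *: \sum_(k < n.+1) (T x - U k x)).
  rewrite bounded_op_sumE sumrB scalerBr; congr (_ - _).
  by rewrite sumr_const card_ord -[T x *+ _]scaler_nat scalerA mulVf ?scale1r// pnatr_eq0.
by rewrite rnormZ rnorm_inv rnorm_nat mulrAC [leRHS]mulrC ler_wpM2l ?invr_ge0.
Qed.

Lemma rnorm_pr_sum (P : nat -> set I) n (x : H) : (forall m k i, P m i -> P k i -> m = k) ->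
  rnorm (\sum_(k < n) pr (P k) x) <= rnorm x.
Proof.
move=> Pd; apply: le_rnorm_coord => i; rewrite ell2_sumE.
have [[m mn Pm]|nP] := pselect (exists2 m : 'I_n, true & P m i).
  rewrite (bigD1 m)// (pr_in _ Pm) big1 => [|k km]; first by rewrite /= addr0.
  apply: pr_notin => Pk.
  by move: km; rewrite (_ : k = m) ?eqxx//; apply: val_inj; exact: Pd Pk Pm.
rewrite big1 ?rnorm0 ?rnorm_ge0// => k _; apply: pr_notin => Pk.
by apply: nP; exists k.
Qed.

(** Pieces are removed in pairs: on the left, [P l.*2] receives the defect part and [P l.*2.+1]
    stays free for the dilation; on the right, [P k.*2] is the free set of Ak. Both free sets are
    what [partial_isometry_in] asks for. *)
Lemma compression_in (D : set I) (P : nat -> set I) (j : L -> I) (T : bounded_op H) (rho : R) k l :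
  injective j -> range j = D -> 0 <= rho -> rho < 1 ->
  (forall x, rnorm (T x) <= rho * rnorm x) ->
  (forall n, P n `<=` D) -> (forall n, ~ small (P n)) ->
  (forall m n i, P m i -> P n i -> m = n) ->
  K (quot_pi F (op_of_bmap (bcomp (pr (D `\` (P l.*2 `|` P l.*2.+1)))
    (bcomp (bmap_of_op T) (pr (D `\` (P k.*2 `|` P k.*2.+1))))))).
Proof.
move=> jinj jD r0 r1 Tr PD nP Pd.
have isoA m : exists A : bmap (ell2 R L) H, [/\ isometric A,
    forall v i, (P m.*2 `|` P m.*2.+1) i -> A v i = 0 &
    forall x, A (adj A x) = pr (D `\` (P m.*2 `|` P m.*2.+1)) x].
  have [||h hinj hE] := large_bijection S jinj (A := D `\` (P m.*2 `|` P m.*2.+1)).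
  - by rewrite jD => i [].
  (* The piece of index 2 (m + 1) is not among those removed, so the difference is large. *)
  - apply: contra_not (nP m.+1.*2) => sD; apply: (small_sub S _ sD) => i Pi.
    by split; [exact: PD Pi|case=> /(Pd _ _ _ Pi); lia].
  have [A [iA A0 AE]] := delta_isometry R hinj; exists A; split => // [v i Pi|x].
    by apply: A0; rewrite hE => -[].
  by rewrite AE hE.
have [Ak [iAk Ak0 AkE]] := isoA k; have [Al [iAl Al0 AlE]] := isoA l.
pose Q := bcomp (adj Al) (bcomp (bmap_of_op T) Ak).
have Qr x : rnorm (Q x) <= rho * rnorm x.
  by apply: le_trans (adj_isometric_le iAl _) (le_trans (Tr _) _); rewrite iAk.
have [Df DfE] := defect_exists r0 r1 Qr.
have [h hinj hP] := large_injection S (nP l.*2).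
have [C [iC C0 _]] := delta_isometry R hinj.
have AC : forall u v, ip (Al u) (C v) = 0.
  by apply: (range_disjoint Al0 C0) => i /hP; left.
(* For |c| = 1 this is isometric, because Al and C have orthogonal ranges and |Q x|^2 + |Df x|^2 =
   |x|^2. The mean over c = 1 and c = -1 is Al Q, and Al Q Ak^* is the compression of T. *)
pose B (c : R[i]) := blin c (bcomp Al Q) (bcomp C Df).
have KB c : rnorm c = 1 -> K (quot_pi F (op_of_bmap (bcomp (B c) (adj Ak)))).
  move=> c1; apply: (@partial_isometry_in Ak (B c) (P k.*2) (P l.*2.+1)) => //.
  - move=> x; apply/eqP; rewrite -(@eqrXn2 _ 2)// ?rnorm_ge0//.
    rewrite [B c x]/= -linearZ rnorm_sqD AC mulr0 addr0 iAl iC rnormZ c1 mul1r.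
    by rewrite DfE.
  - by move=> v i Pi; apply: Ak0; left.
  - move=> v i Pi.
    change (Al (Q v) i + c * C (Df v) i = 0).
    rewrite Al0 ?C0 ?mulr0 ?addr0//; last by right.
    by move=> /hP /(Pd _ _ _ Pi); lia.
have := KB 1 (rnorm1 R); have := KB (-1) (etrans (rnormN _) (rnorm1 R)) => KBN KB1.
apply: (orbit_closure_half_op KB1 KBN) => x.
rewrite /= scale1r scaleN1r addrACA subrr addr0 scalerDr -scalerDl -div1r -splitr scale1r.
by rewrite AkE AlE.
Qed.

(** T has to live on an injective image D of L, so that complements of pieces in D are ranges of
    isometries of [ell2 R L]. The averaging is done on the left for a fixed compression on the
    right, then on the right; in both rounds disjointness of the J m bounds the summed errors by rho
    |x|. *)
Lemma contraction_in (j : L -> I) (T : bounded_op H) (rho : R) :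
  injective j -> (forall x, T x = pr (range j) (T (pr (range j) x))) ->
  0 <= rho -> rho < 1 -> (forall x, rnorm (T x) <= rho * rnorm x) -> K (quot_pi F T).
Proof.
move=> jinj TD r0 r1 Tr; set D := range j in TD.
have [P [PD nP Pd]] := large_pieces S (large_range S jinj).
pose J m := P m.*2 `|` P m.*2.+1.
have Jd m n i : J m i -> J n i -> m = n.
  by move=> [a|a] [/(Pd _ _ _ a)|/(Pd _ _ _ a)] E; lia.
have prJ m (x : H) : pr D x - pr (D `\` J m) x = pr (J m) x.
  have JD i : J m i -> D i by case; exact: PD.
  apply: ell2P => i; change (pr D x i - pr (D `\` J m) x i = pr (J m) x i).
  have [Ji|nJ] := pselect (J m i).
    rewrite !(@pr_in _ _ (J m))// pr_in ?pr_notin ?subr0//; first by case.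
    exact: JD.
  rewrite (@pr_notin _ _ (J m))//.
  have [Di|nD] := pselect (D i); first by rewrite !pr_in// subrr.
  by rewrite !pr_notin ?subrr// => -[].
have prD x : pr D (pr D x) = pr D x by apply: pr_id => i; exact: pr_notin.
have TD1 x : pr D (T x) = T x by rewrite TD prD.
have TD2 x : T (pr D x) = T x by rewrite TD prD -TD.
pose U k l := op_of_bmap (bcomp (pr (D `\` J l)) (bcomp (bmap_of_op T) (pr (D `\` J k)))).
have KU k l : K (quot_pi F (U k l)).
  have h0 := @compression_in D P j T rho k l jinj erefl r0 r1 Tr PD nP Pd.
  exact: h0.
have KU' k : K (quot_pi F (rmul_op T (pr (D `\` J k)))).
  apply: (@orbit_closure_avg_limit _ (U k) rho) => // n x.
  under eq_bigr => l _.
    have -> : rmul_op T (pr (D `\` J k)) x - U k l x = pr (J l) (T (pr (D `\` J k) x)).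
      by rewrite -prJ TD1.
    over.
  apply: le_trans (rnorm_pr_sum _ _ Jd) _; apply: le_trans (Tr _) _.
  by rewrite ler_wpM2l// rnorm_pr.
apply: (@orbit_closure_avg_limit _ (fun k => rmul_op T (pr (D `\` J k))) rho) => // n x.
under eq_bigr => k _.
  have -> : T x - rmul_op T (pr (D `\` J k)) x = T (pr (J k) x).
    by rewrite -prJ linearB/= TD2.
  over.
rewrite -linear_sum; apply: le_trans (Tr _) _.
by rewrite ler_wpM2l// rnorm_pr_sum.
Qed.

End contractions_in_orbit_closure.

(** * Separable-range operators *)

Lemma countable_setU (T : Type) (A B : set T) :
  countable A -> countable B -> countable (A `|` B).
Proof.
by move=> cA cB; rewrite -bigcup2E; apply: bigcup_countable => // -[|[|n]] _ //=.
Qed.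

Section supports.
Context (R : realType) (I : choiceType).
Local Notation H := (ell2 R I).
Implicit Types f : H.

Lemma notin_supp f i : ~ supp f i -> f i = 0.
Proof. by move=> /negP/negPn/eqP. Qed.

Lemma supp_pr (D : set I) f : supp (pr D f) `<=` D `&` supp f.
Proof.
move=> i; change (pr D f i != 0 -> (D `&` supp f) i).
by rewrite prE; case: ifPn => [/set_mem Di fi|]; rewrite ?eqxx.
Qed.

Lemma suppZ (c : R[i]) f : supp (c *: f) `<=` supp f.
Proof.
move=> i; rewrite /supp /=; apply: contraNN => /eqP fi.
by apply/eqP; change (c * f i = 0); rewrite fi mulr0.
Qed.

Lemma countable_supp f : countable (supp f).
Proof.
have inv0 n : 0 < n.+1%:R^-1 :> R by rewrite invr_gt0.
have /choice[A AP] n : exists A : {fset I}, rnorm (f - pr [set` A] f) < n.+1%:R^-1.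
  exact: ell2_tail.
apply: (@sub_countable _ _ _ (\bigcup_n [set` A n])); last first.
  by apply: bigcup_countable => // n _; apply: finite_set_countable; exact: finite_fset.
apply: subset_card_le => i fi; apply: contrapT => nA.
have ni n : ~ [set` A n] i by move=> Ai; apply: nA; exists n.
have fi0 : 0 < rnorm (f i) by rewrite -ltcR -rnormE normr_gt0.
have [n nf] : exists n : nat, n.+1%:R^-1 < rnorm (f i).
  exists (Num.truncn (rnorm (f i))^-1).
  by rewrite -[ltRHS]invrK ltf_pV2 ?posrE ?invr_gt0// truncnS_gt.
have := lt_trans (AP n) nf; apply/negP; rewrite -leNgt.
have -> : f i = (f - pr [set` A n] f) i.
  by change (f i = f i - pr [set` A n] f i); rewrite pr_notin// subr0.
exact: ell2_coord_le.
Qed.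

Lemma quot_unit_witness (F : closed_subspace (bounded_op H)) (T : bounded_op H)
    (D : set I) (e : R) :
  rmul_op T (pr D) \in F -> 0 < e ->
  exists x : H, [/\ rnorm x <= 1, forall i, D i -> x i = 0 & rnorm (quot_pi F T) - e < rnorm (T x)].
Proof.
move=> TF e0; apply: contrapT => no.
have nx (x : H) : rnorm x <= 1 -> rnorm (T (pr (~` D) x)) <= rnorm (quot_pi F T) - e.
  move=> x1; rewrite leNgt; apply/negP => lt; apply: no; exists (pr (~` D) x); split => //.
    exact: le_trans (rnorm_pr _ _) x1.
  by move=> i Di; apply: pr_notin.
pose T' := rmul_op T (pr (~` D)).
have TT : quot_pi F T = quot_pi F T'.
  apply/quot_piP; have -> : T - T' = rmul_op T (pr D); last by [].
  apply: bounded_opP => x; change (T x - T (pr (~` D) x) = T (pr D x)).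
  by rewrite -pr_setC linearB/= opprB addrC subrK.
have : rnorm (quot_pi F T) <= rnorm (quot_pi F T) - e.
  rewrite {1}TT; apply: le_trans (quot_norm_le _ _) _; apply: opnorm_on_le.
    by apply: le_trans (nx 0 _); rewrite ?rnorm_ge0// rnorm0.
  by move=> x _; exact: nx.
by rewrite lerDl oppr_ge0 leNgt e0.
Qed.

(** Dividing by |x| <= 1 cannot decrease |T x|. The outcome is a scalar multiple, so that
    coordinates where x vanishes are preserved. *)
Lemma unit_normalize (T : bounded_op H) (x : H) (c : R) :
  rnorm x <= 1 -> 0 <= c -> c < rnorm (T x) ->
  exists a : R[i], [/\ a != 0, rnorm (a *: x) = 1 & c < rnorm (T (a *: x))].
Proof.
move=> x1 c0 cT.
have x0 : 0 < rnorm x.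
  rewrite lt_neqAle rnorm_ge0 andbT eq_sym; apply/eqP => /rnorm0_eq0 x0.
  by move: cT; rewrite x0 linear0 rnorm0 ltNge c0.
have an : rnorm ((rnorm x)^-1%:C) = (rnorm x)^-1 by rewrite rnorm_real_ge0 ?invr_ge0 ?ltW.
exists ((rnorm x)^-1%:C); split.
- by rewrite -(rmorph0 (real_complex R)) (inj_eq (@complexI R)) invr_eq0 gt_eqF.
- by rewrite rnormZ an mulVf// gt_eqF.
- rewrite linearZ rnormZ an; apply: lt_le_trans cT _.
  by rewrite -[leLHS]mul1r ler_wpM2r ?rnorm_ge0// invf_ge1.
Qed.

(** Coordinate j of T x is determined by pairing x with the multiples of T^* e_j, so only the
    coordinates in the support of this vector enter. *)
Lemma coord_bmap_eq0 (T : bmap H H) (x : H) (j : I) :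
  (forall i, supp (adj T (delta j 1)) i -> x i = 0) -> T x j = 0.
Proof.
move=> x0; apply: coord_eq0 => z; rewrite ipC ip_adj -[z]mulr1 deltaZ linearZ/=.
apply: ip_disjoint => i; have [si|/notin_supp si] := pselect (supp (adj T (delta j 1)) i).
  by left; exact: x0.
by right; change (z * adj T (delta j 1) i = 0); rewrite si mulr0.
Qed.

End supports.

Section separable_ideal.
Context (R : realType) (X : normedModType R[i]).

Lemma sep_ops_lmul (U : bmap X X) T : T \in sep_ops X -> lmul_op U T \in sep_ops X.
Proof.
move=> /sep_opP[D cD TD]; apply/sep_opP; exists (U @` D).
  by apply: card_le_trans (card_image_le _ _) _.
move=> _ [x _ <-]; apply/closure_rnormP => e e0.
have [M M0 UM] := bmap_bounded U.
have M1 : 0 < M + 1 by rewrite ltr_wpDl.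
have e1 : 0 < e / (M + 1) by rewrite divr_gt0.
have [|d Dd xd] := (closure_rnormP D (T x)).1 _ _ e1; first by apply: TD; exists x.
exists (U d); first by exists d.
rewrite /= -linearB; apply: le_lt_trans (UM _) _; rewrite ltr_pdivlMr// in xd.
by apply: le_lt_trans xd; rewrite mulrC ler_wpM2l ?rnorm_ge0// lerDl.
Qed.

Lemma sep_ops_rmul (U : bmap X X) T : T \in sep_ops X -> rmul_op T U \in sep_ops X.
Proof.
move=> /sep_opP[D cD TD]; apply/sep_opP; exists D => //.
by move=> _ [x _ <-]; apply: TD; exists (U x).
Qed.

End separable_ideal.

Section separable_coordinate_subspaces.
Context (R : realType) (I : choiceType).
Local Notation H := (ell2 R I).

Lemma complex_rat_dense (z : R[i]) (e : R) : 0 < e ->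
  exists p q : rat, rnorm (z - Complex (ratr p) (ratr q)) < e.
Proof.
move=> e0; have e2 : 0 < e / 2 by rewrite divr_gt0.
have near (a : R) : exists p : rat, `|a - ratr p| < e / 2.
  have [|p] := @rat_in_itvoo R (a - e / 2) (a + e / 2); first by lra.
  by rewrite in_itv/= => /andP[h1 h2]; exists p; rewrite ltr_norml; lra.
case: z => a b; have [p pa] := near a; have [q qb] := near b; exists p, q.
have -> : Complex a b - Complex (ratr p) (ratr q) =
    (a - ratr p)%:C + (b - ratr q)%:C * 'i%C.
  by apply/eqP; rewrite eq_complex/=; apply/andP; split; apply/eqP; ring.
apply: le_lt_trans (rnormD _ _) _; rewrite rnormM rnorm_i mulr1 !rnorm_real.
by rewrite [ltRHS]splitr ltrD.
Qed.

Lemma coordinate_subspace_separable (D : set I) : countable D ->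
  exists2 E : set H, countable E & [set x : H | forall i, ~ D i -> x i = 0] `<=` closure E.
Proof.
move=> /countable_injP[f finj].
(* [f] codes D by natural numbers. Codes of no element give 0, so that S is total on a countable
   type of sequences. *)
pose d (n : nat) (z : R[i]) : H :=
  if pselect (exists2 i, D i & f i = n) is left h then delta (sval (cid2 h)) z else 0.
have dE i z : D i -> d (f i) z = delta i z.
  move=> Di; rewrite /d; case: pselect => [h|[]]; last by exists i.
  case: (cid2 h) => k Dk /= fk; congr (delta _ z).
  by apply: finj => //; exact: mem_set.
pose S (s : seq (nat * rat * rat)) : H :=
  \sum_(k <- s) d k.1.1 (Complex (ratr k.1.2) (ratr k.2)).
exists (range S).
  by apply: card_le_trans (card_image_le _ _) _; exact: countableP.
move=> x xD; apply/closure_rnormP => e e0.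
have e2 : 0 < e / 2 by rewrite divr_gt0.
have [A xA] := ell2_tail x e2.
have fin (s : seq I) (r : R) : 0 < r ->
    exists t, rnorm (\sum_(i <- s) delta i (x i) - S t) < r.
  elim: s r => [|i s IH] r r0.
    by exists [::]; rewrite /S !big_nil subrr rnorm0.
  have r2 : 0 < r / 2 by rewrite divr_gt0.
  have [t st] := IH _ r2; rewrite big_cons.
  have [Di|/xD xi] := pselect (D i); last first.
    exists t; rewrite xi (_ : delta i 0 = 0) ?add0r.
      by apply: lt_trans st _; rewrite ltr_pdivrMr// ltr_pMr// ltr1n.
    by rewrite -(mul0r 1) deltaZ scale0r.
  have [p [q pq]] := complex_rat_dense (x i) r2.
  exists ((f i, p, q) :: t); rewrite /S big_cons /= dE// opprD addrACA.
  apply: le_lt_trans (rnormD _ _) _; rewrite [ltRHS]splitr ltrD//.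
  rewrite -scaleN1r -deltaZ -deltaD rnorm_delta mulN1r//.
have [t tx] := fin A _ e2; exists (S t); first by exists t.
apply: le_lt_trans (rnorm_tri _ (pr [set` A] x) _) _.
by rewrite [ltRHS]splitr; apply: ltrD; [exact: xA|rewrite pr_fsetE; exact: tx].
Qed.

End separable_coordinate_subspaces.

Section separable_case.
Context (R : realType) (I : choiceType).
Local Notation H := (ell2 R I).

Lemma sep_ops_rmul_pr (T : bounded_op H) (D : set I) : countable D ->
  rmul_op T (pr D) \in sep_ops H.
Proof.
move=> cD; apply: (sep_ops_lmul (bmap_of_op T) (T := op_of_bmap (pr D))).
have [E cE DE] := coordinate_subspace_separable R cD; apply/sep_opP; exists E => //.
by move=> _ [x _ <-]; apply: DE => i; exact: pr_notin.
Qed.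

(** Here T x itself serves as y and the error is 0: J is enlarged by the countable supports of the
    T^* e_j for j in J, and an x vanishing there has T x vanishing on J exactly. *)
Lemma sep_ops_step (T : bounded_op H) (e : R) :
  rnorm (quot_pi (sep_ops H) T) = 1 -> 0 < e -> e < 1 -> rnorm T < 1 + e ->
  exists2 err : I -> R, (forall A : {fset I}, \sum_(l <- A) err l <= e) &
    forall l J, countable J -> exists x y : H,
      [/\ countable (supp x `|` supp y), (forall i, (supp x `|` supp y) i -> ~ J i),
          rnorm x = 1, `|rnorm y - 1| <= e & rnorm (T x - y) <= err l].
Proof.
move=> T1 e0 e1 Te; exists (fun=> 0) => [A|_ J cJ]; first by rewrite big1 ?ltW.
pose J' := J `|` \bigcup_(j in J) supp (adj (bmap_of_op T) (delta j 1)).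
have cJ' : countable J'.
  by apply: countable_setU => //; apply: bigcup_countable => // j _; exact: countable_supp.
have [x [x1 xJ xT]] := quot_unit_witness (sep_ops_rmul_pr T cJ') e0.
rewrite T1 in xT.
have [|a [a0 ax1 axT]] := unit_normalize x1 _ xT; first by rewrite subr_ge0 ltW.
have axJ i : J' i -> (a *: x) i = 0.
  by move=> Ji; change (a * x i = 0); rewrite xJ// mulr0.
exists (a *: x), (T (a *: x)); split => //.
- by apply: countable_setU; exact: countable_supp.
- move=> i si Ji; case: si => /eqP; apply; first by apply: axJ; left.
  change (bmap_of_op T (a *: x) i = 0); apply: coord_bmap_eq0 => k sk.
  by apply: axJ; right; exists i.
- rewrite ler_norml; apply/andP; split; first by rewrite lerBrDr addrC ltW.
  rewrite lerBlDr addrC; apply: le_trans (ltW Te).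
  by rewrite -[leRHS]mulr1 -ax1; exact: rnorm_op_le.
- by rewrite subrr rnorm0.
Qed.

End separable_case.

Lemma infinite_injection (I : Type) (A : set I) : infinite_set A ->
  exists2 h : nat -> I, injective h & range h `<=` A.
Proof.
move=> /infiniteP/card_leP[f].
pose n' n : [set: nat] := SigSub (mem_set Logic.I : n \in [set: nat]).
exists (fun n => set_val (f (n' n))).
  move=> m n /val_inj/(@inj _ _ _ f) mn.
  by have /(congr1 val) : n' m = n' n by apply: mn; rewrite inE.
by move=> _ [n _ <-]; exact: set_mem (valP _).
Qed.

(** * Index systems of order types omega_1 and omega *)

Section omega1.
Context (I : choiceType) (r : rel I).
Hypothesis r_omega1 : omega1_order r.

Lemma omega1_index_system :
  index_system (fun i j : I => r i j /\ i <> j) (@countable I).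
Proof.
have [wo unc seg] := r_omega1.
(* [well_order] speaks of unique minima of nonempty sets; antisymmetry and totality are read off the
   minima of pairs. *)
have pair_wo x y : exists z, [/\ z = x \/ z = y, r z x & r z y] /\
    forall t, (t = x \/ t = y) -> r t x -> r t y -> z = t.
  have [|z [[zxy lz] zu]] := wo (mem [set x; y]).
    by exists x; rewrite inE; left.
  rewrite inE in zxy; exists z; split.
    by split => //; apply: lz; rewrite inE; [left|right].
  move=> t txy tx ty; apply: zu; split; first by rewrite inE.
  by move=> u; rewrite inE => -[|] ->.
have anti x y : r x y -> r y x -> x = y.
  move=> xy yx.
  have xx : r x x by have [z [[[]-> //]]] := pair_wo x x.
  have yy : r y y by have [z [[[]-> //]]] := pair_wo y y.
  have [z [_ zu]] := pair_wo x y.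
  by rewrite -(zu x (or_introl erefl) xx xy) (zu y (or_intror erefl) yx yy).
have total i j : i <> j -> (r i j /\ i <> j) \/ (r j i /\ j <> i).
  have [z [[[->|->] rx ry] _]] := pair_wo i j; first by left.
  by move=> ij; right; split => // ji; apply: ij.
have wf : well_founded (fun i j : I => r i j /\ i <> j).
  move=> i; apply: contrapT => nA.
  have [|z [[zN lz] _]] := wo (mem [set k | ~ Acc (fun i j : I => r i j /\ i <> j) k]).
    by exists i; rewrite inE.
  rewrite inE /= in zN; apply: zN; split => k [kz nkz]; apply: contrapT => nk.
  by apply: nkz; apply: anti => //; apply: lz; rewrite inE.
have segment l (A : I -> set I) : (forall m, r m l /\ m <> l -> countable (A m)) ->
    countable [set i | exists2 m, r m l /\ m <> l & A m i].
  move=> cA; have -> : [set i | exists2 m, r m l /\ m <> l & A m i] =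
      \bigcup_(m in [set m | r m l /\ m <> l]) A m.
    by apply/seteqP; split=> i [m lm Am]; exists m.
  apply: bigcup_countable => //; apply: sub_countable (seg l).
  by apply: subset_card_le => m [].
have subc (A B : set I) : A `<=` B -> countable B -> countable A.
  by move=> AB; apply: sub_countable; exact: subset_card_le.
have large (h : I -> I) : injective h -> ~ countable (range h).
  move=> hinj; rewrite (_ : countable (range h) = countable [set: I])//.
  by apply: eq_countable; apply: inj_card_eq => x y _ _ /hinj.
split => //.
  exact: countable_setU.
(* The pairing of L with nat: each l selects an injective sequence off the countable set already
   used, whose complement is infinite as I is uncountable. Disjointness of the ranges makes the
   joint map injective. *)
have [|f [fP fd]] := @disjoint_selection I I (nat -> I) (fun i j : I => r i j /\ i <> j)
    (@countable I) (fun _ v => injective v) (fun v => range v) (countable0 _) wf total segment.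
  move=> l J cJ; have nJ : infinite_set (~` J).
    move=> /finite_set_countable cJC; apply: unc.
    by rewrite -(setvU J); exact: countable_setU.
  have [v vinj vJ] := infinite_injection nJ; exists v; split => //.
  by apply: card_le_trans (card_image_le _ _) _; exact: countableP.
exists (fun p => f p.1 p.2) => -[l n] [m k] /= lm.
have E : l = m.
  by apply: (fd l m (f l n)); [exists n|exists k].
by rewrite -E in lm *; rewrite (fP _ _ _ lm).
Qed.

End omega1.

Lemma nat_index_system (I : choiceType) :
  index_system (fun m n : nat => (m < n)%N) (@finite_set I).
Proof.
split.
- by move=> n; elim/ltn_ind: n => n IH; split.
- by move=> l m /eqP; rewrite neq_ltn => /orP[]; [left|right].
- by move=> A B; exact: sub_finite_set.
- exact: finite_set0.
- exact: finite_set1.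
- by move=> A B fA fB; rewrite finite_setU.
- move=> l A fA; have -> : [set i | exists2 m, (m < l)%N & A m i] = \bigcup_(m in `I_l) A m.
    by apply/seteqP; split=> i [m lm Am]; exists m.
  by apply: bigcup_finite => //; exact: finite_II.
- move=> h hinj; rewrite (_ : finite_set (range h) = finite_set [set: nat]).
    exact: infinite_nat.
  by apply: eq_finite_set; apply: inj_card_eq => x y _ _ /hinj.
- by exists (@choice.pickle (nat * nat)%type); exact: (pcan_inj choice.pickleK).
Qed.

(** * Compact operators *)

Section compact_ideal.
Context (R : realType) (X : completeNormedModType R[i]).

Lemma precompact_sub_compact (A B : set X) : A `<=` B -> compact B -> precompact A.
Proof.
move=> AB cB; apply: (@precompact_subset _ _ B) => //.
by rewrite precompact_closed//; apply: compact_closed => //; exact: norm_hausdorff.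
Qed.

Lemma compact_ops_lmul (U : bmap X X) T : T \in compact_ops X -> lmul_op U T \in compact_ops X.
Proof.
move=> /compact_opP; rewrite precompactE => cT; apply/compact_opP.
have Uc : continuous U.
  move=> x; apply/cvgrPdist_lt => e e0.
  have er : e = (complex.Re e)%:C by rewrite RRe_real// gtr0_real.
  rewrite er ltcR in e0.
  have [M M0 UM] := bmap_bounded U.
  have M1 : 0 < M + 1 by rewrite ltr_wpDl.
  have e1 : 0 < (complex.Re e / (M + 1))%:C by rewrite ltcR divr_gt0.
  have : \forall y \near x, `|x - y| < (complex.Re e / (M + 1))%:C.
    by have /cvgrPdist_lt := @cvg_id _ (nbhs x); apply.
  apply: filterS => y; rewrite rnormE ltcR ltr_pdivlMr// => xy.
  rewrite -linearB er rnormE ltcR; apply: le_lt_trans (UM _) _.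
  by apply: le_lt_trans xy; rewrite mulrC ler_wpM2l ?rnorm_ge0// lerDl.
apply: (precompact_sub_compact _ (continuous_compact (continuous_subspaceT Uc) cT)).
by move=> _ [x x1 <-]; exists (T x) => //; apply: subset_closure; exists x.
Qed.

Lemma compact_ops_rmul (U : bmap X X) T : (forall x, rnorm (U x) = rnorm x) ->
  T \in compact_ops X -> rmul_op T U \in compact_ops X.
Proof.
move=> Un /compact_opP; rewrite precompactE => cT; apply/compact_opP.
apply: (precompact_sub_compact _ cT) => _ [x x1 <-]; apply: subset_closure.
by exists (U x) => //; rewrite /= rnormE Un -rnormE.
Qed.

(** Meant for v = T e_i and w = T (i e_i): one coordinate of a vector of the unit ball lies in the
    unit disc, hence its real and imaginary parts lie in [-1, 1]. *)
Lemma compact_segment_span (v w : X) :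
  compact ((fun p : R * R => p.1%:C *: v + p.2%:C *: w) @` (`[-1, 1] `*` `[-1, 1])).
Proof.
have sc (u : X) : continuous (fun a : R => a%:C *: u).
  move=> a; apply/cvgrPdist_lt => e e0.
  have er : e = (complex.Re e)%:C by rewrite RRe_real// gtr0_real.
  rewrite er ltcR in e0.
  have u1 : 0 < rnorm u + 1 by rewrite ltr_wpDl// rnorm_ge0.
  have e1 : 0 < complex.Re e / (rnorm u + 1) by rewrite divr_gt0.
  have : \forall b \near a, `|a - b| < complex.Re e / (rnorm u + 1).
    by have /cvgrPdist_lt := @cvg_id _ (nbhs a); apply.
  apply: filterS => b; rewrite ltr_pdivlMr// => ab.
  rewrite -scalerBl -rmorphB er rnormE ltcR rnormZ rnorm_real.
  by apply: le_lt_trans ab; rewrite ler_wpM2l// lerDl.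
apply: continuous_compact; last by apply: compact_setX; exact: segment_compact.
apply: continuous_subspaceT => p; apply: cvgD.
  by apply: (cvg_comp fst (fun a : R => a%:C *: v) _ (sc v p.1)); exact: cvg_fst.
by apply: (cvg_comp snd (fun a : R => a%:C *: w) _ (sc w p.2)); exact: cvg_snd.
Qed.

End compact_ideal.

Section compact_case.
Context (R : realType) (I : choiceType).
Local Notation H := (ell2 R I).

Lemma abs_Re_le (z : R[i]) : `|complex.Re z| <= rnorm z.
Proof. by rewrite -sqrtr_sqr /rnorm normc_def /= ler_wsqrtr// lerDl sqr_ge0. Qed.

Lemma abs_Im_le (z : R[i]) : `|complex.Im z| <= rnorm z.
Proof. by rewrite -sqrtr_sqr /rnorm normc_def /= ler_wsqrtr// lerDr sqr_ge0. Qed.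

Lemma compact_ops_rmul_pr (T : bounded_op H) (A : set I) : finite_set A ->
  rmul_op T (pr A) \in compact_ops H.
Proof.
move=> /finite_fsetP[{}A ->].
have -> : rmul_op T (pr [set` A]) = \sum_(i <- A) rmul_op T (pr [set` [fset i]%fset]).
  apply: bounded_opP => x.
  transitivity (\sum_(i <- A) T (delta i (x i))).
    change (T (pr [set` A] x) = \sum_(i <- A) T (delta i (x i))).
    by rewrite pr_fsetE linear_sum.
  have -> : (\sum_(i <- A) rmul_op T (pr [set` [fset i]%fset]) : bounded_op H) x =
      \sum_(i <- A) rmul_op T (pr [set` [fset i]%fset]) x.
    by elim/big_rec2: _ => // i y U _ <-.
  apply: eq_bigr => i _.
  change (T (delta i (x i)) = T (pr [set` [fset i]%fset] x)).
  by rewrite pr_fsetE big_seq_fset1.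
apply: rpred_sum => i _; apply/compact_opP.
have cs := @compact_segment_span R H (T (delta i 1)) (T (delta i 'i%C)).
refine (@precompact_sub_compact R H _ _ _ cs).
move=> _ [x + <-]; rewrite /= rnormE -(rmorph1 (real_complex R)) lecR => x1.
have xi1 : rnorm (x i) <= 1 by apply: le_trans (ell2_coord_le x i) x1.
exists (complex.Re (x i), complex.Im (x i)).
  by split; rewrite /= in_itv/= -ler_norml; apply: le_trans xi1;
    [exact: abs_Re_le|exact: abs_Im_le].
change ((complex.Re (x i))%:C *: T (delta i 1) + (complex.Im (x i))%:C *: T (delta i 'i%C) =
  T (pr [set` [fset i]%fset] x)).
rewrite pr_fsetE big_seq_fset1 -!linearZ -linearD -!deltaZ -deltaD mulr1.
congr (T (delta i _)).
by case: (x i) => a b; rewrite mulrC complexiE -complexE.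
Qed.

(** The image of the unit ball is covered by finitely many balls of radius e / 2, and finitely many
    centres have their essential supports in one finite set. *)
Lemma compact_tail (k : bounded_op H) (e : R) : k \in compact_ops H -> 0 < e ->
  exists2 A : set I, finite_set A & forall x, rnorm x <= 1 -> rnorm (k x - pr A (k x)) <= e.
Proof.
move=> /compact_opP + e0; rewrite precompactE compact_cover => ck.
have e2 : 0 < e / 2 by rewrite divr_gt0.
have [||D _ cov] := ck H [set: H] (fun x => ball x (e / 2)%:C).
- by move=> x _; apply: ball_open; rewrite ltcR.
- by move=> x _; exists x => //; apply: ballxx; rewrite ltcR.
have /choice[A AP] (d : H) : exists A : {fset I}, rnorm (d - pr [set` A] d) < e / 2.
  exact: ell2_tail.
exists (\bigcup_(d in [set` D]) [set` A d]).
  by apply: bigcup_finite => [|d _]; exact: finite_fset.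
move=> x x1; have [|d Dd dx] := cov (k x).
  apply: subset_closure; exists x => //=.
  by rewrite rnormE -(rmorph1 (real_complex R)) lecR.
move: dx; rewrite -ball_normE/= rnormE ltcR => dx.
set B := \bigcup_(d in _) _.
have -> : k x - pr B (k x) = pr (~` B) (k x - d) + pr (~` B) d.
  by rewrite pr_setC -linearD subrK.
apply: le_trans (rnormD _ _) _; rewrite [leRHS]splitr; apply: lerD.
  by apply: le_trans (rnorm_pr _ _) _; rewrite rnormB ltW.
apply: le_trans (ltW (AP d)); rewrite pr_setC; apply: le_rnorm_coord => i.
rewrite !prE !in_setC; case: ifPn => [nB|_]; last by rewrite rnorm0 rnorm_ge0.
rewrite ifT//; apply: contra nB => /set_mem Ai; apply: mem_set; by exists d.
Qed.

(** Coordinate j of T x is a pairing with T^* e_j, whose mass outside a finite set is small. *)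
Lemma finite_coord_small (T : bmap H H) (J : set I) (e : R) : finite_set J -> 0 < e ->
  exists2 A : set I, finite_set A &
    forall x : H, rnorm x <= 1 -> (forall i, A i -> x i = 0) -> rnorm (pr J (T x)) <= e.
Proof.
move=> /finite_fsetP[{}J ->] e0; pose n := size J.
(* Each of the n coordinates gets the share e / (n + 1), which is positive even when [J] is
   empty. *)
have n1 : 0 < n.+1%:R :> R by rewrite ltr0n.
have e1 : 0 < e / n.+1%:R by rewrite divr_gt0.
have /choice[A AP] (j : I) : exists A : {fset I},
    rnorm (adj T (delta j 1) - pr [set` A] (adj T (delta j 1))) < e / n.+1%:R.
  exact: ell2_tail.
exists (\bigcup_(j in [set` J]) [set` A j]).
  by apply: bigcup_finite => [|d _]; exact: finite_fset.
move=> x x1 xA.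
have small j : j \in J -> rnorm (T x j) <= e / n.+1%:R.
  move=> jJ; set z := T x j.
  have zz : rnorm z ^+ 2 = ip (delta j z) (T x).
    by rewrite ip_delta -/z rnorm_sqE; case: z => a b /=; ring.
  have [z0|z0] := eqVneq (rnorm z) 0; first by rewrite z0 ltW.
  have zp : 0 < rnorm z by rewrite lt_neqAle eq_sym z0 rnorm_ge0.
  rewrite -(ler_pM2l zp) -expr2 zz ipC ip_adj -[z in delta j z]mulr1 deltaZ linearZ/=.
  set g := adj T (delta j 1).
  have -> : ip x (z *: g) = ip x (z *: (g - pr [set` A j] g)).
    rewrite scalerBr ipBr [X in _ - X]ip_disjoint ?subr0// => i.
    have [Ai|nA] := pselect ([set` A j] i); first by left; apply: xA; exists j.
    by right; change (z * pr [set` A j] g i = 0); rewrite pr_notin// mulr0.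
  apply: le_trans (ip_le _ _) _; rewrite rnormZ -[leRHS]mul1r.
  apply: ler_pM; rewrite ?mulr_ge0 ?rnorm_ge0//.
  by rewrite ler_wpM2l ?rnorm_ge0// ltW// AP.
rewrite pr_fsetE; apply: (@le_trans _ _ (\sum_(j <- J) e / n.+1%:R)).
  rewrite big_seq [leRHS]big_seq; elim/big_rec2: _ => [|j a b jJ ab]; first by rewrite rnorm0.
  apply: le_trans (rnormD _ _) _; apply: lerD => //.
  by rewrite rnorm_delta small.
rewrite big_const_seq count_predT iter_addr_0 -/n -[_ *+ _]mulr_natr mulrAC ler_pdivrMr//.
by rewrite ler_pM2l// ler_nat.
Qed.

(** Up to e / 2 only finitely many output coordinates matter, and on those [finite_coord_small]
    applies. *)
Lemma compact_small (k : bounded_op H) (e : R) : k \in compact_ops H -> 0 < e ->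
  exists2 A : set I, finite_set A &
    forall x : H, rnorm x <= 1 -> (forall i, A i -> x i = 0) -> rnorm (k x) <= e.
Proof.
move=> kK e0; have e2 : 0 < e / 2 by rewrite divr_gt0.
have [J fJ JP] := compact_tail kK e2.
have [A fA AP] := finite_coord_small (bmap_of_op k) fJ e2.
exists A => // x x1 xA; rewrite -(subrK (pr J (k x)) (k x)) [e]splitr.
apply: le_trans (rnormD _ _) _; apply: lerD; first exact: JP.
exact: AP.
Qed.

Lemma finite_unit_witness (T : bounded_op H) (A : set I) (e : R) : finite_set A ->
  0 < e -> e <= rnorm (quot_pi (compact_ops H) T) ->
  exists x : H, [/\ rnorm x = 1, finite_set (supp x), forall i, A i -> x i = 0 &
    rnorm (quot_pi (compact_ops H) T) - e < rnorm (T x)].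
Proof.
move=> fA e0 ec; set c := rnorm (quot_pi _ T) in ec *.
have [x [x1 xA xT]] := quot_unit_witness (compact_ops_rmul_pr T fA) e0.
rewrite -/c in xT.
have [M M0 TM] := bmap_bounded (bmap_of_op T).
have M1 : 0 < M + 1 by rewrite ltr_wpDl.
(* Truncating x at this precision changes T x by less than the gap between |T x| and c - e. *)
have d0 : 0 < (rnorm (T x) - (c - e)) / (M + 1) by rewrite divr_gt0// subr_gt0.
have [B xB] := ell2_tail x d0.
pose u := pr [set` B] x.
have uT : c - e < rnorm (T u).
  have h : rnorm (T x) <= rnorm (T u) + rnorm (T (x - u)).
    by rewrite -[x in T x](subrK u) addrC linearD; exact: rnormD.
  have h2 : rnorm (T (x - u)) < rnorm (T x) - (c - e).
    apply: le_lt_trans (TM _) _; rewrite ltr_pdivlMr// in xB.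
    by apply: le_lt_trans xB; rewrite mulrC ler_wpM2l ?rnorm_ge0// lerDl.
  by move: h h2; move: (rnorm (T x)) (rnorm (T u)) (rnorm (T (x - u))) => a b d; lra.
have [||a [a0 au1 auT]] := @unit_normalize _ _ T u (c - e) _ _ uT.
- exact: le_trans (rnorm_pr _ _) x1.
- by rewrite subr_ge0.
exists (a *: u); split => //.
- apply: sub_finite_set (finite_fset B) => i /suppZ /supp_pr[] //.
- move=> i Ai; change (a * u i = 0); rewrite /u prE.
  by case: ifP; rewrite ?xA ?mulr0.
Qed.

Lemma sum_geometric_le (e : R) (A : {fset nat}) : 0 <= e ->
  \sum_(n <- A) e / 2 ^+ n.+1 <= e.
Proof.
move=> e0.
have fin n : \sum_(k < n) e / 2 ^+ k.+1 = e - e / 2 ^+ n.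
  elim: n => [|n IH]; first by rewrite big_ord0 expr0 divr1 subrr.
  have n0 : 2 ^+ n != 0 :> R by rewrite expf_neq0.
  by rewrite big_ord_recr/= IH exprS; field.
pose m := (\max_(n <- A) n).+1.
have Am n : n \in A -> (n < m)%N by move=> nA; rewrite ltnS; exact: leq_bigmax_seq.
clearbody m.
apply: (@le_trans _ _ (\sum_(k < m) e / 2 ^+ k.+1)); last first.
  by rewrite fin lerBlDr lerDl divr_ge0// exprn_ge0.
rewrite -(big_mkord xpredT (fun k => e / 2 ^+ k.+1)) /index_iota subn0.
rewrite [leRHS](bigID (mem A))/=; apply: ler_wpDr.
  by apply: sumr_ge0 => k _; rewrite divr_ge0// exprn_ge0.
rewrite -[leRHS]big_filter le_eqVlt; apply/orP; left; apply/eqP.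
apply: perm_big; apply: uniq_perm; rewrite ?fset_uniq ?filter_uniq ?iota_uniq//.
move=> k; rewrite mem_filter mem_iota /= add0n.
by have [kA|] := boolP (k \in A); rewrite //= Am.
Qed.

(** T x need neither have finite support nor vanish on J, so y is a truncation of it, and the error
    e / 2^(n+1) pays half for each defect. As this error is at most e / 2 and |T x| > 1 - e / 2, the
    norm of y stays above 1 - e. *)
Lemma compact_ops_step (T : bounded_op H) (e : R) :
  rnorm (quot_pi (compact_ops H) T) = 1 -> 0 < e -> e < 1 -> rnorm T < 1 + e ->
  exists2 err : nat -> R, (forall A : {fset nat}, \sum_(l <- A) err l <= e) &
    forall l J, finite_set J -> exists x y : H,
      [/\ finite_set (supp x `|` supp y), (forall i, (supp x `|` supp y) i -> ~ J i),
          rnorm x = 1, `|rnorm y - 1| <= e & rnorm (T x - y) <= err l].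
Proof.
move=> T1 e0 e1 Te; exists (fun n => e / 2 ^+ n.+1) => [A|n J fJ].
  by apply: sum_geometric_le; exact: ltW.
set d := e / 2 ^+ n.+1.
have d0 : 0 < d by rewrite divr_gt0// exprn_gt0.
have de : d <= e / 2.
  by rewrite /d ler_pM2l// lef_pV2 ?posrE ?exprn_gt0// exprS ler_peMr// exprn_ege1// ler1n.
have d2 : 0 < d / 2 by rewrite divr_gt0.
have e2 : 0 < e / 2 by rewrite divr_gt0.
have [A fA AP] := finite_coord_small (bmap_of_op T) fJ d2.
have [||x [x1 fx xAJ xT]] := @finite_unit_witness T (A `|` J) (e / 2) _ e2.
- by rewrite finite_setU.
- by rewrite T1; lra.
have [B xB] := ell2_tail (T x) d2.
pose y := pr ([set` B] `\` J) (T x).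
have supp_y : supp y `<=` [set` B] `\` J by move=> i /supp_pr[].
have Ty : rnorm (T x - y) <= d.
  have -> : T x - y = (T x - pr [set` B] (T x)) + pr ([set` B] `&` J) (T x).
    apply: ell2P => i;
    change (T x i - y i = T x i - pr [set` B] (T x) i + pr ([set` B] `&` J) (T x) i).
    rewrite /y !prE in_setD in_setI.
    by case: (i \in [set` B]); case: (i \in J); rewrite /= ?subrr ?subr0 ?add0r ?addr0.
  rewrite [d]splitr; apply: le_trans (rnormD _ _) _; apply: lerD; first exact: ltW.
  apply: (@le_trans _ _ (rnorm (pr J (T x)))).
    apply: le_rnorm_coord => i; rewrite !prE in_setI.
    by case: (i \in [set` B]); case: (i \in J); rewrite /= ?rnorm0 ?rnorm_ge0.
  by apply: AP => [|i Ai]; [rewrite x1|apply: xAJ; left].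
exists x, y; split => //.
- rewrite finite_setU; split => //; apply: sub_finite_set supp_y _.
  by apply: finite_setD; exact: finite_fset.
- move=> i [/eqP xi Ji|/supp_y[]//]; apply: xi; apply: xAJ; by right.
- have yT : rnorm y <= rnorm (T x) by exact: rnorm_pr.
  have Tx : rnorm (T x) <= rnorm T.
    by rewrite -[leRHS]mulr1 -x1; exact: rnorm_op_le.
  have Txy : rnorm (T x) <= rnorm (T x - y) + rnorm y.
    by rewrite -[T x in X in X <= _](subrK y); exact: rnormD.
  rewrite T1 in xT.
  move: Ty yT Tx Txy xT Te de.
  move: (rnorm (T x - y)) (rnorm y) (rnorm (T x)) (rnorm T) => a b c f.
  clear -e0 d0 => *; rewrite ler_norml; apply/andP; split; lra.
Qed.

End compact_case.

(** * Unit balls *)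

Section unit_ball.
Context (R : realType).

Lemma norm_le1 (V : normedZmodType R[i]) (x : V) : (`|x| <= 1) = (rnorm x <= 1).
Proof. by rewrite rnormE -(rmorph1 (real_complex R)) lecR. Qed.

Lemma norm_eq1 (V : normedZmodType R[i]) (x : V) : `|x| = 1 -> rnorm x = 1.
Proof. by rewrite /rnorm => ->. Qed.

(** Shrinking p by the factor 1 - d before lifting leaves room for a representative of norm below 1;
    the construction of the defect operator requires this strict bound. *)
Lemma quot_ball_approx (X : normedModType R[i]) (F : closed_subspace (bounded_op X))
    (p : quot_space F) (e : R) : rnorm p <= 1 -> 0 < e ->
  exists (S : bounded_op X) (rho : R),
    [/\ 0 <= rho, rho < 1, forall x, rnorm (S x) <= rho * rnorm x &
    rnorm (p - quot_pi F S) <= e].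
Proof.
move=> p1 e0; pose d := Num.min e 2^-1.
have d0 : 0 < d by rewrite lt_min e0/=; lra.
have de : d <= e by rewrite ge_min lexx.
have d1 : d <= 2^-1 by rewrite ge_min lexx orbT.
pose t := 1 - d.
have t0 : 0 <= t by rewrite /t; lra.
have tp : quot_norm (t%:C *: p) <= t.
  by rewrite -rnorm_quot rnormZ rnorm_real_ge0// ler_piMr.
have d2 : 0 < d / 2 by rewrite divr_gt0.
have [S Sp Sn] := quot_norm_adherent (t%:C *: p) d2.
exists S, (t + d / 2); split.
- by rewrite addr_ge0// ltW.
- by rewrite /t; lra.
- move=> x; apply: le_trans (rnorm_op_le S x) _; rewrite ler_wpM2r ?rnorm_ge0//.
  by apply: le_trans (ltW Sn) _; rewrite lerD2r.
- rewrite Sp -[p in p - _]scale1r -scalerBl rnormZ.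
  have -> : 1 - t%:C = d%:C by rewrite /t rmorphB rmorph1 opprB addrC subrK.
  rewrite rnorm_real_ge0 ?(ltW d0)//; apply: le_trans de.
  by rewrite ler_piMr// ltW.
Qed.

End unit_ball.

(** * Norm closure, for separable-range operators *)

Section norm_convex_transitive.
Context (R : realType) (I : choiceType) (r : rel I).

Lemma sep_ops_convex_transitive : omega1_order r ->
  convex_transitive (quot_space (sep_ops (ell2 R I))).
Proof.
move=> rI q /norm_eq1 q1; apply/seteqP; split=> [p /orbit_closure_rnorm|p] /=; rewrite norm_le1.
  by rewrite q1.
move=> p1; apply: orbit_closure_closed => e e0.
have [S [rho [r0 r1 Sr pS]]] := quot_ball_approx p1 e0.
exists (quot_pi (sep_ops (ell2 R I)) S) => //.
have idr : range (@id I) = setT by apply/seteqP; split=> // i _; exists i.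
apply: (contraction_in (omega1_index_system rI) _ _ _ q1 _ _ r0 r1 Sr (j := id)) => //.
- by move=> U T _; exact: sep_ops_lmul.
- by move=> U T _; exact: sep_ops_rmul.
- exact: sep_ops_step.
- by move=> x; have prT (u : ell2 R I) : pr setT u = u;
    [apply: pr_id => i; case|rewrite idr !prT].
Qed.

End norm_convex_transitive.

(** * Closure for tau, for compact operators *)

Section tau_convex_transitive.
Context (R : realType) (I : choiceType).
Local Notation H := (ell2 R I).
Local Notation F := (compact_ops H).

Lemma tau_ball_open (T : bounded_op H) (Y : set H) (e : R) :
  GRing.submod_closed (mem Y) -> separable_set Y ->
  open ([set V | opnorm_on Y (T - V) < e] : set (tau_op H)).
Proof.
move=> Ysub Ysep; apply/tau_openP => V /= VT.
exists Y, (e - opnorm_on Y (T - V)); split => //; first by rewrite subr_gt0.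
move=> W /= VW; have -> : T - W = (T - V) + (V - W) by rewrite addrA subrK.
by apply: le_lt_trans (opnorm_onD _ _ _) _; rewrite addrC -ltrBrDr.
Qed.

Lemma coordinate_subspace_submod (J : set I) :
  GRing.submod_closed (mem [set x : H | forall i, ~ J i -> x i = 0]).
Proof.
split=> [|a x y]; rewrite !inE//= => xJ yJ i nJ.
by change (a * x i + y i = 0); rewrite xJ// yJ// mulr0 addr0.
Qed.

(** If |p| > 1, a sequence of unit vectors with disjoint finite supports nearly attains |p| under T.
    They occupy countably many coordinates, so one tau-neighbourhood controls V on all of them, and
    the compact part of V is small on one of them, because only finitely many supports meet a given
    finite set. *)
Lemma tau_closure_sub_ball (q : quot_space F) : rnorm q = 1 ->
  @closure (tau_quot F) (orbit_hull q) `<=` [set p : quot_space F | `|p| <= 1].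
Proof.
move=> q1 p clp; rewrite /= norm_le1 leNgt; apply/negP => p1.
(* The estimates yield c - e < e + e + (1 + e), that is c < 1 + 4 e, which the divisor 5
   contradicts. *)
pose c := rnorm p; pose e := (c - 1) / 5.
have e0 : 0 < e by rewrite /e divr_gt0// subr_gt0.
have ce : c = 1 + 5 * e by rewrite /e; field.
have [T Tp] := quot_piS p.
pose P (n : nat) (x : H) := rnorm x = 1 /\ c - e < rnorm (T x).
have S := nat_index_system I.
have [|f [fP fd]] := @disjoint_selection nat I H _ (@finite_set I) P (@supp R I)
    (small0 S) (index_wf S) (index_total S) (@small_segment _ _ _ _ S).
  move=> n J fJ; have [|x [x1 fx xJ xT]] := @finite_unit_witness R I T J e fJ e0.
    by rewrite Tp -/c; lra.
  rewrite Tp in xT; exists x; split => //.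
  by move=> i /eqP xi Ji; apply: xi; exact: xJ.
pose J := \bigcup_n supp (f n).
have cJ : countable J by apply: bigcup_countable => // n _; exact: countable_supp.
pose Y := [set x : H | forall i, ~ J i -> x i = 0].
have Ysep : separable_set Y.
  by have [E cE YE] := coordinate_subspace_separable R cJ; exact: separable_setW cE YE.
have fY n : Y (f n) by move=> i nJ; apply: notin_supp => fi; apply: nJ; exists n.
pose U : set (tau_op H) := [set V | opnorm_on Y (T - V) < e].
have oU : open U by apply: tau_ball_open => //; exact: coordinate_subspace_submod.
have nU : @nbhs _ (tau_quot F) p (quot_pi F @` U).
  apply: open_nbhs_nbhs; split; first by exists U.
  exists T => //; rewrite /U /= subrr.
  by apply: le_lt_trans e0; apply: opnorm_on_le => // x _ _; rewrite [leLHS]rnorm0.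
have [w [/orbit_hull_rnorm qw [V UV Vw]]] := clp _ nU.
rewrite q1 -Vw in qw.
have [V1 V1V V1n] := quot_norm_adherent (quot_pi F V) e0.
have kF : V - V1 \in F by apply/quot_piP.
have [A fA kA] := compact_small kF e0.
have [n nA] : exists n, forall i, A i -> f n i = 0.
  apply: contrapT => /forallNP no.
  have /choice[h hP] n : exists i, A i /\ supp (f n) i.
    apply: contrapT => nh; apply: (no n) => i Ai; apply: notin_supp => fi.
    by apply: nh; exists i.
  have hinj : injective h.
    by move=> m k mk; apply: (fd m k (h m)); [exact: (hP m).2|rewrite mk; exact: (hP k).2].
  apply: (large_range S hinj); apply: sub_finite_set fA => _ [m _ <-].
  exact: (hP m).1.
have [f1 fT] := fP n.
have h1 : rnorm (T (f n)) <= rnorm ((T - V) (f n)) + rnorm (V (f n)).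
  by rewrite -[T (f n)](subrK (V (f n))); exact: rnormD.
have h2 : rnorm ((T - V) (f n)) < e.
  by apply: le_lt_trans UV; apply: opnorm_on_ge; rewrite ?f1//; exact: fY.
have h3 : rnorm (V (f n)) <= rnorm ((V - V1) (f n)) + rnorm (V1 (f n)).
  by rewrite -[V (f n)](subrK (V1 (f n))); exact: rnormD.
have h4 : rnorm ((V - V1) (f n)) <= e by apply: kA; rewrite ?f1.
have h5 : rnorm (V1 (f n)) <= rnorm V1.
  by rewrite -[leRHS]mulr1 -f1; exact: rnorm_op_le.
have h6 : rnorm V1 < 1 + e by apply: lt_le_trans V1n _; rewrite lerD2r.
move: fT h1 h2 h3 h4 h5 h6.
move: (rnorm (T (f n))) (rnorm ((T - V) (f n))) (rnorm (V (f n)))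
  (rnorm ((V - V1) (f n))) (rnorm (V1 (f n))) (rnorm V1) => a1 a2 a3 a4 a5 a6.
clear -e0 ce => *; lra.
Qed.

(** The representative S0 of p is S + W up to a compact operator k, with S a strict contraction and
    W small. On Y, S coincides with its compression S1 to countably many coordinates, to which
    [contraction_in] applies; S1 and S may differ in the quotient, but tau does not see it near
    p. *)
Lemma ball_sub_tau_closure (q : quot_space F) : infinite_set [set: I] -> rnorm q = 1 ->
  [set p : quot_space F | `|p| <= 1] `<=` @closure (tau_quot F) (orbit_hull q).
Proof.
move=> infI q1 p; rewrite /= norm_le1 => p1 B.
rewrite nbhsE => -[_ [[U oU <-] [S0 US0 S0p]] UB].
have [Y [e [Ysub [D [cD DY YD]] e0 YU]]] := (tau_openP U).1 oU S0 US0.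
have e2 : 0 < e / 2 by rewrite divr_gt0.
have e4 : 0 < e / 4 by rewrite divr_gt0.
have [S [rho [r0 r1 Sr pS]]] := quot_ball_approx p1 e4.
have [W Wp Wn] := quot_norm_adherent (p - quot_pi F S) e4.
have {}Wn : rnorm W < e / 2.
  apply: lt_le_trans Wn _; apply: le_trans (lerD pS (lexx _)) _.
  by clear; lra.
have [h0 h0inj _] := infinite_injection infI.
(* By density, [pr J] fixes Y and S Y as soon as J contains the supports of the d and S d. Adding
   [range h0] makes J infinite, hence an injective image of nat. *)
pose J := (\bigcup_(d in D) (supp d `|` supp (S d))) `|` range h0.
have cJ : countable J.
  apply: countable_setU; last by apply: card_le_trans (card_image_le _ _) _; exact: countableP.
  by apply: bigcup_countable => // d _; apply: countable_setU; exact: countable_supp.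
have [j jinj jJ] : exists2 j : nat -> I, injective j & range j = J.
  apply: card_eq_range; apply: Cantor_Bernstein => //.
  apply: card_le_trans (subset_card_le (_ : range h0 `<=` J)); last by move=> i; right.
  have /inj_card_eq : {in [set: nat] &, injective h0} by move=> l m _ _ /h0inj.
  by rewrite card_eq_le => /andP[].
have YJ y : Y y -> pr J y = y /\ pr J (S y) = S y.
  move=> Yy.
  have DJ d : D d -> pr J d = d /\ pr J (S d) = S d.
    by move=> Dd; split; apply: pr_id => i nJ; apply: notin_supp => di; apply: nJ; left;
      exists d => //; by [left|right].
  have lim (T : bmap H H) : (forall d, D d -> pr J (T d) = T d) -> pr J (T y) = T y.
    move=> TD; apply/eqP; rewrite -subr_eq0; apply/eqP/rnorm0_eq0/eqP.
    rewrite eq_le rnorm_ge0 andbT; apply/ler_addgt0Pr => a a0; rewrite add0r.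
    have [M M0 TM] := bmap_bounded T.
    have M1 : 0 < M + M + 1 by rewrite ltr_wpDl// addr_ge0.
    have a1 : 0 < a / (M + M + 1) by rewrite divr_gt0.
    have [d Dd yd] := (closure_rnormP D y).1 (YD _ Yy) _ a1.
    have -> : pr J (T y) - T y = pr J (T (y - d)) - T (y - d).
      have e1 : T (y - d) = T y - T d by rewrite linearB.
      have e3 : pr J (T y - T d) = pr J (T y) - pr J (T d) by rewrite linearB.
      by rewrite e1 e3 (TD d Dd) opprB addrA subrK.
    apply: le_trans (rnormD _ _) _; rewrite rnormN.
    apply: le_trans (lerD (le_trans (rnorm_pr _ _) (TM _)) (TM _)) _.
    rewrite -mulrDl; rewrite ltr_pdivlMr// in yd; apply: le_trans (ltW yd).
    by rewrite mulrC ler_wpM2l ?rnorm_ge0// lerDl.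
  split; first by apply: (lim bid) => d /DJ[].
  by apply: (lim (bmap_of_op S)) => d /DJ[].
pose S1 := op_of_bmap (bcomp (pr J) (bcomp (bmap_of_op S) (pr J))).
have S1E u : S1 u = pr J (S (pr J u)) by [].
have KS1 : orbit_closure q (quot_pi F S1).
  apply: (contraction_in (nat_index_system I) _ _ _ q1 jinj _ r0 r1) => //.
  - by move=> U' T _; exact: compact_ops_lmul.
  - by move=> U' T; exact: compact_ops_rmul.
  - exact: compact_ops_step.
  - move=> x; have prJ u : pr J (pr J u) = pr J u by apply: pr_id => i; exact: pr_notin.
    by rewrite jJ !S1E !prJ.
  - move=> x; apply: le_trans (rnorm_pr _ _) _; apply: le_trans (Sr _) _.
    by rewrite ler_wpM2l// rnorm_pr.
have /orbit_closureP/(_ _ e2)[w qw wS1] := KS1.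
(* This margin gives the representative Z a norm below e / 2. *)
have d0 : 0 < e / 2 - rnorm (quot_pi F S1 - w) by rewrite subr_gt0.
have [Z Zw Zn] := quot_norm_adherent (quot_pi F S1 - w) d0.
rewrite addrC subrK in Zn.
pose k := S0 - S - W.
have kF : k \in F.
  have -> : k = (S0 - S) - W by [].
  by apply/quot_piP; rewrite quot_piB S0p Wp.
(* V represents w because k is compact, and on Y, where S1 = S, the difference S0 - V reduces to Z +
   W. *)
pose V := S1 - Z + k.
have Vw : quot_pi F V = w.
  have -> : w = quot_pi F (S1 - Z) by rewrite quot_piB Zw opprB addrC subrK.
  by apply/quot_piP; rewrite /V addrAC subrr add0r.
exists w; split => //; apply: UB; exists V => //; apply: YU => /=.
apply: (@le_lt_trans _ _ (rnorm Z + rnorm W)); last first.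
  by rewrite [ltRHS]splitr; apply: ltrD.
apply: opnorm_on_le; first by rewrite addr_ge0// rnorm_ge0.
move=> x Yx x1.
have -> : (S0 - V) x = Z x + W x.
  have [xJ SxJ] := YJ _ Yx.
  have S1x : S1 x = S x by rewrite S1E xJ SxJ.
  change (S0 x - (S1 x - Z x + (S0 x - S x - W x)) = Z x + W x).
  rewrite S1x; move: (S0 x) (S x) (Z x) (W x) => a b c d.
  rewrite [b - c + _]addrACA (_ : b + (a - b) = a); last by rewrite addrC subrK.
  by rewrite opprD addrA subrr add0r -opprD opprK.
apply: le_trans (rnormD _ _) _.
have opn (T : bounded_op H) : rnorm (T x) <= rnorm T.
  by apply: le_trans (rnorm_op_le T x) _; rewrite ler_piMr// opnorm_on_ge0.
by apply: lerD; exact: opn.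
Qed.

End tau_convex_transitive.

Theorem theorem3p3 (R : realType) :
  (forall (I : choiceType) (r : rel I), omega1_order r ->
     convex_transitive (quot_space (sep_ops (ell2 R I)))) /\
  (forall I : choiceType, infinite_set [set: I] ->
     tau_convex_transitive (compact_ops (ell2 R I))).
Proof.
split=> [I r rI|I infI]; first exact: sep_ops_convex_transitive rI.
move=> q /norm_eq1 q1; apply/seteqP; split; first exact: tau_closure_sub_ball.
exact: ball_sub_tau_closure.
Qed.
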